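(* Let $M$ be a complete noncompact Riemannian manifold with the global doubling property. Then there does not exist a $W^{1,1}_{loc}$ weak solution $f:M\to\mathbb{R}$ of the level set formulation of the inverse mean curvature flow $$\operatorname{div}\Big(\frac{\nabla f}{|\nabla f|}\Big)=|\nabla f|\quad\text{on }M$$ that satisfies $$\lim_{r\to\infty}\operatorname{ess\,inf}_{x\in B(x_0,r)}|\nabla f|(x)>0$$ for some $x_0\in M$.
   Context: $B(x,r)$ is the geodesic ball of radius $r$ centered at $x$, and $dv$ is the Riemannian volume element. Global doubling property: there is a constant $D(M)>0$ such that for all $r>0$ and all $x\in M$, $\mathrm{Vol}(B(x,2r))\le D(M)\,\mathrm{Vol}(B(x,r))$. Weak solution: $f\in W^{1,1}_{loc}(M)$ is a weak solution of $\operatorname{div}(\nabla f/|\nabla f|)=|\nabla f|$ on $M$ if for every $\psi\in C_0^\infty(M)$, $$\int_M\frac{\nabla f}{|\nabla f|}\cdot\nabla\psi\,dv=-\int_M|\nabla f|\,\psi\,dv .$$ Here $\nabla f/|\nabla f|$ is required to make sense almost everywhere; in particular constant functions are not admissible as weak solutions. *)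

(* Defs.v *)
From HB Require Import structures.
From mathcomp Require Import all_boot all_order all_algebra.
From mathcomp Require Import all_classical all_reals all_analysis.

Set Implicit Arguments.
Unset Strict Implicit.
Unset Printing Implicit Defensive.

Import Order.TTheory GRing.Theory Num.Theory.
Import numFieldNormedType.Exports.

Local Open Scope classical_set_scope.
Local Open Scope ring_scope.

(* T with its Borel sigma-algebra. *)
Notation borel T := (g_sigma_algebraType (@open T)).

(* n-dimensional Lebesgue measure on the Borel sets of R^n: the n-fold product of
   lebesgue_measure, transported to row vectors one coordinate at a time. *)
Section lebesgue_rV.
Context {R : realType}.

Definition cons_rV n (xv : measurableTypeR R * borel 'rV[R]_n) :
  borel 'rV[R]_n.+1 := row_mx (xv.1%:M : 'rV[R]_1) (xv.2 : 'rV[R]_n).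

Lemma cons_rV_ball n (a b : R) (v w : 'rV[R]_n) e : 0 < e ->
  ball a e b -> ball v e w ->
  ball (cons_rV (a, v) : 'rV[R]_n.+1) e (cons_rV (b, w) : 'rV[R]_n.+1).
Proof.
rewrite /ball/= => e0 ab; case=> _ vw; split=> // i j; rewrite /cons_rV/= !(mxE, ord1).
by case: fintype.splitP => k _; rewrite ?mxE ?ord1 ?eqxx//=; exact: vw.
Qed.

Lemma measurable_cons_rV n : measurable_fun setT (@cons_rV n).
Proof.
apply: (@measurability _ _ _ (borel 'rV[R]_n.+1) setT (@cons_rV n)
  (@open 'rV[R]_n.+1)) => //.
move=> _ [U oU <-]; rewrite setTI.
pose B (i : rat * 'rV[rat]_n * nat) : set (measurableTypeR R * borel 'rV[R]_n) :=
  ball (ratr i.1.1 : R) i.2.+1%:R^-1 `*`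
  ball (map_mx ratr i.1.2 : 'rV[R]_n) i.2.+1%:R^-1.
pose F i := if `[< B i `<=` @cons_rV n @^-1` U >] then B i else set0.
have -> : @cons_rV n @^-1` U = \bigcup_i F i.
  rewrite eqEsubset; split; last first.
    by move=> x [i _]; rewrite /F; case: asboolP => // + Bx; exact.
  move=> [a v] Uav.
  have /nbhs_ballP[e /= e0 eU] : nbhs (cons_rV (a, v) : 'rV[R]_n.+1) U.
    by apply: open_nbhs_nbhs; split.
  have [k ke] : exists k, k.+1%:R^-1 < e / 2.
    have e20 : 0 < e / 2 by rewrite divr_gt0.
    by have [k _ /(_ k (leqnn _))/= ke] := near_infty_natSinv_lt (PosNum e20);
      exists k.
  have k0 : 0 < k.+1%:R^-1 :> R by rewrite invr_gt0.
  have appr (x : R) : exists q : rat, ball (ratr q : R) k.+1%:R^-1 x.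
    have /rat_in_itvoo[q] : x - k.+1%:R^-1 < x + k.+1%:R^-1.
      by rewrite ltrD2l gtrN.
    rewrite in_itv/= => /andP[q1 q2]; exists q.
    by rewrite /ball/= ltr_norml ltrBrDr ltrBlDr addrC q1 addrC q2.
  have [q qa] := appr a; have [w wv] := choice (fun j => appr (v 0 j)).
  have wvk : ball (map_mx ratr (\row_j w j) : 'rV[R]_n) k.+1%:R^-1 v.
    by split=> // i j; rewrite !mxE ord1; exact: wv.
  exists (q, \row_j w j, k) => //; rewrite /F; case: asboolP => [_|] //=.
  case; move=> [b u] [/= qb wu]; apply: eU; apply: cons_rV_ball => //.
    apply: (@le_ball _ _ _ (k.+1%:R^-1 + k.+1%:R^-1)); first by rewrite -mulr2n -[_ *+ 2]mulr_natr -ler_pdivlMr// ltW.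
    by apply: ball_triangle qb; exact: ball_sym.
  apply: (@le_ball _ _ _ (k.+1%:R^-1 + k.+1%:R^-1)); first by rewrite -mulr2n -[_ *+ 2]mulr_natr -ler_pdivlMr// ltW.
  by apply: ball_triangle wu; exact: ball_sym.
apply: countable_bigcupT_measurable => [|i]; first exact: countableP.
rewrite /F; case: asboolP => // _; apply: measurableX.
  exact: measurable_realfun.measurable_ball.
by apply: sub_sigma_algebra; apply: ball_open; rewrite invr_gt0.
Qed.

Section step.
Variables (n : nat) (m : {sigma_finite_measure set (borel 'rV[R]_n) -> \bar R}).

Definition lebesgue_rVS : set (borel 'rV[R]_n.+1) -> \bar R :=
  pushforward (product_measure1 (@lebesgue_measure R) m) (@cons_rV n).

Let pf : {measure set (borel 'rV[R]_n.+1) -> \bar R} :=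
  measure_function_pushforward__canonical__measure_function_Measure
    (product_measure1 (@lebesgue_measure R) m) (@measurable_cons_rV n).

HB.instance Definition _ := isMeasure.Build _ _ _ lebesgue_rVS
  (measure0 pf) (measure_ge0 pf) (@measure_semi_sigma_additive _ _ _ pf).

Lemma lebesgue_rVS_sigma_finite : sigma_finite setT lebesgue_rVS.
Proof.
have /sigma_finiteP[F [TF ndF Foo]] := sigma_finiteT (@lebesgue_measure R).
have /sigma_finiteP[G [TG ndG Goo]] := sigma_finiteT m.
have mhead : measurable_fun setT (fun v : borel 'rV[R]_n.+1 => v 0 0 : measurableTypeR R).
  apply: (@measurability _ _ _ (measurableTypeR R) setT _
    (@measurable_realfun.RGenOpens.G R)).
    exact: measurable_realfun.RGenOpens.measurableE.
  move=> _ [_ [x [y ->]] <-]; rewrite setTI; apply: sub_sigma_algebra.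
  by apply: open_comp => // v _; exact: coord_continuous.
have mtail : measurable_fun setT (fun v : borel 'rV[R]_n.+1 =>
    @rsubmx R 1 1 n v : borel 'rV[R]_n).
  apply: (@measurability _ _ _ (borel 'rV[R]_n) setT _ (@open 'rV[R]_n)) => //.
  move=> _ [U oU <-]; rewrite setTI; apply: sub_sigma_algebra.
  by apply: open_comp => // v _; exact: continuous_rsubmx.
exists (fun k => [set v : 'rV[R]_n.+1 | F k (v 0 0) /\ G k (@rsubmx R 1 1 n v)]).
  rewrite predeqE => v; split=> // _.
  have [i _ Fi] : (\bigcup_i F i) (v 0 0) by rewrite -TF.
  have [j _ Gj] : (\bigcup_i G i) (@rsubmx R 1 1 n v) by rewrite -TG.
  exists (maxn i j) => //; split.
    by move: Fi; exact/subsetPset/ndF/leq_maxl.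
  by move: Gj; exact/subsetPset/ndG/leq_maxr.
move=> k; have [mF Fk] := Foo k; have [mG Gk] := Goo k; split.
  apply: measurableI.
    by rewrite -[X in measurable X]setTI; exact: mhead.
  by rewrite -[X in measurable X]setTI; exact: mtail.
rewrite /lebesgue_rVS /pushforward.
rewrite (_ : _ @^-1` _ = F k `*` G k).
  by rewrite product_measure1E// lte_mul_pinfty// ge0_fin_numE.
rewrite predeqE => -[a w] /=; rewrite /cons_rV/= row_mxKr mxE.
by case: fintype.splitP => // j _; rewrite mxE ord1 eqxx.
Qed.

HB.instance Definition _ := @Measure_isSigmaFinite.Build _ _ _
  lebesgue_rVS lebesgue_rVS_sigma_finite.
End step.

Fixpoint lebesgue_rV n : {sigma_finite_measure set (borel 'rV[R]_n) -> \bar R} :=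
  match n with
  | 0 => dirac ((0 : 'rV[R]_0) : borel 'rV[R]_0)
  | n'.+1 => lebesgue_rVS (lebesgue_rV n')
  end.

End lebesgue_rV.

Section smooth.
Context {R : realType} {n : nat}.
Implicit Types (U : set 'rV[R]_n) (f : 'rV[R]_n -> R).

Definition partial (i : 'I_n) f (y : 'rV[R]_n) : R := 'D_(delta_mx 0 i) f y.

(* For U open: f has continuous partial derivatives up to order k on U. *)
Fixpoint Ck k U f : Prop :=
  (forall y, U y -> {for y, continuous f}) /\
  match k with
  | 0 => True
  | k'.+1 => forall i : 'I_n,
      (forall y, U y -> derivable f y (delta_mx 0 i)) /\ Ck k' U (partial i f)
  end.

Definition smooth U f := forall k, Ck k U f.

Definition supp_compact (T : topologicalType) (f : T -> R) (U : set T) :=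
  compact (closure [set x | f x != 0]) /\ closure [set x | f x != 0] `<=` U.

Definition loc_integrable U f :=
  measurable_fun (U : set (borel 'rV[R]_n)) (f : borel 'rV[R]_n -> R) /\
  forall K, K `<=` U -> compact K ->
    (\int[lebesgue_rV n]_(y in K) `|f y|%:E < +oo)%E.

(* h is the i-th distributional derivative of f on the open set U. *)
Definition weak_partial U (i : 'I_n) f (h : 'rV[R]_n -> R) :=
  forall eta, smooth setT eta -> supp_compact eta U ->
    (\int[lebesgue_rV n]_(y in U) (f y * partial i eta y)%:E =
     - \int[lebesgue_rV n]_(y in U) (h y * eta y)%:E)%E.

End smooth.

Section charts.
Context (R : realType) (n : nat) (T : topologicalType).

(* A homeomorphism from the open set cdom onto the open set cimg of R^n; cfun
   and cinv are total functions, only relevant on cdom and cimg. *)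
Record chart := Chart {
  cdom : set T;
  cfun : T -> 'rV[R]_n;
  cinv : 'rV[R]_n -> T;
  cimg := cfun @` cdom;
  cdom_open : open cdom;
  cimg_open : open cimg;
  cfunK : forall x, cdom x -> cinv (cfun x) = x;
  cfun_continuous : forall x, cdom x -> {for x, continuous cfun};
  cinv_continuous : forall y, cimg y -> {for y, continuous cinv} }.

Definition transition (c d : chart) := cfun d \o cinv c.
Definition overlap (c d : chart) := cfun c @` (cdom c `&` cdom d).

End charts.
Arguments chart : clear implicits.

(* Connected, Hausdorff, second countable smooth manifold without boundary, of
   dimension n, with a smooth Riemannian metric. Vectors are row vectors, so
   'J f y acts on the right and rmetric c y is the matrix (g_ij) of the metric
   at the point y of cimg c. *)
Record riemannian_manifold (R : realType) (n : nat) := RiemannianManifold {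
  carrier :> ptopologicalType;
  rm_hausdorff : hausdorff_space carrier;
  rm_second_countable : @second_countable carrier;
  rm_connected : connected [set: carrier];
  atlas : set (chart R n carrier);
  atlas_cover : forall x, exists2 c, atlas c & cdom c x;
  atlas_smooth : forall c d, atlas c -> atlas d -> forall j : 'I_n,
    smooth (overlap c d) (fun y => transition c d y 0 j);
  rmetric : chart R n carrier -> 'rV[R]_n -> 'M[R]_n;
  rmetric_smooth : forall c, atlas c -> forall i j : 'I_n,
    smooth (cimg c) (fun y => rmetric c y i j);
  rmetric_sym : forall c, atlas c -> forall y, cimg c y ->
    (rmetric c y)^T = rmetric c y;
  rmetric_pos : forall c, atlas c -> forall y, cimg c y ->
    forall u : 'rV[R]_n, u != 0 -> 0 < (u *m rmetric c y *m u^T) 0 0;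
  rmetric_compat : forall c d, atlas c -> atlas d -> forall y, overlap c d y ->
    rmetric c y = 'J (transition c d) y *m rmetric d (transition c d y)
                  *m ('J (transition c d) y)^T }.

Section riemannian.
Context {R : realType} {n : nat} (M : riemannian_manifold R n).
Local Notation chart := (chart R n M).

Definition chart_at (x : M) : chart := sval (cid2 (atlas_cover x)).

(* A tangent vector at a point is given by its coordinates in the charts around
   this point. *)
Definition tcoords := chart -> 'rV[R]_n.
Definition is_tangent (x : M) (u : tcoords) :=
  forall c d, atlas c -> atlas d -> cdom c x -> cdom d x ->
    u d = u c *m 'J (transition c d) (cfun c x).

(* By rmetric_compat, for tangent vectors u and v, this does not depend on the
   chart. *)
Definition inner (x : M) (u v : tcoords) : R :=
  let c := chart_at x in (u c *m rmetric c (cfun c x) *m (v c)^T) 0 0.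
Definition tnorm (x : M) (u : tcoords) : R := Num.sqrt (inner x u u).

Definition velocity (gamma : R -> M) (t : R) : tcoords :=
  fun c => derive1 (cfun c \o gamma) t.

Definition C1_curve (I : set R) (gamma : R -> M) :=
  forall t, I t -> {for t, continuous gamma} /\
    forall c, atlas c -> cdom c (gamma t) ->
      derivable (cfun c \o gamma) t 1 /\
      {for t, continuous (fun s => velocity gamma s c)}.

(* On each closed interval of the partition, gamma extends to a C^1 curve on an
   open neighbourhood of this interval. *)
Definition piecewise_C1 (gamma : R -> M) :=
  exists2 s : seq R, itv_partition 0 1 s &
  forall i, (i < size s)%N ->
    let a := nth 1 (0 :: s) i in let b := nth 1 (0 :: s) i.+1 in
    exists2 e : R, 0 < e & exists2 delta : R -> M,
      C1_curve `]a - e, b + e[ delta & {in `[a, b], gamma =1 delta}.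

Definition curve_length (gamma : R -> M) : \bar R :=
  (\int[lebesgue_measure]_(t in `[0%R, 1%R]) (tnorm (gamma t) (velocity gamma t))%:E)%E.

Definition geodesic_dist (x y : M) : \bar R :=
  ereal_inf [set curve_length gamma | gamma in
    [set gamma | [/\ piecewise_C1 gamma, gamma 0 = x & gamma 1 = y]]].

Definition gball (x : M) (r : R) : set M := [set y | (geodesic_dist x y < r%:E)%E].

(* Cauchy completeness for the geodesic distance. *)
Definition complete_manifold :=
  forall u : nat -> M,
  (forall e : R, 0 < e -> exists N, forall i j, (N <= i)%N -> (N <= j)%N ->
    (geodesic_dist (u i) (u j) < e%:E)%E) ->
  exists l, forall e : R, 0 < e -> exists N, forall i, (N <= i)%N ->
    (geodesic_dist l (u i) < e%:E)%E.

(* dv = sqrt(det g) dy in every chart; this determines dv. *)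
Definition riemannian_volume (dv : {measure set (borel M) -> \bar R}) :=
  forall c, atlas c -> forall A : set (borel M), measurable A -> A `<=` cdom c ->
  dv A = (\int[lebesgue_rV n]_(y in (cfun c @` A : set (borel 'rV[R]_n)))
            (Num.sqrt (\det (rmetric c y)))%:E)%E.

Definition smooth_fun (psi : M -> R) :=
  forall c, atlas c -> smooth (cimg c) (psi \o cinv c).

Definition differential (psi : M -> R) (x : M) (c : chart) : 'rV[R]_n :=
  \row_i partial i (psi \o cinv c) (cfun c x).

(* Coordinates g^ij d_j psi. *)
Definition grad (psi : M -> R) (x : M) : tcoords :=
  fun c => differential psi x c *m invmx (rmetric c (cfun c x)).

(* f is in W^{1,1}_loc with weak gradient X: in each chart, f is locally
   integrable and has the locally integrable functions g_ij X^j as weak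
   derivatives. *)
Definition W11loc_grad (f : M -> R) (X : M -> tcoords) :=
  (forall x, is_tangent x (X x)) /\
  forall c, atlas c ->
    loc_integrable (cimg c) (f \o cinv c) /\
    forall i : 'I_n,
      let h y := (X (cinv c y) c *m rmetric c y) 0 i in
      loc_integrable (cimg c) h /\ weak_partial (cimg c) i (f \o cinv c) h.

Section measure.
Variable dv : {measure set (borel M) -> \bar R}.

Definition doubling :=
  exists2 D : R, 0 < D & forall (r : R) (x : M), 0 < r ->
    (dv (gball x (2 * r)) <= D%:E * dv (gball x r))%E.

(* f, with weak gradient X, is a weak solution of
   div(grad f / |grad f|) = |grad f| on M. *)
Definition weak_IMCF (f : M -> R) (X : M -> tcoords) :=
  [/\ W11loc_grad f X,
     (\forall x \ae dv, tnorm x (X x) != 0) &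
     forall psi, smooth_fun psi -> supp_compact psi setT ->
       (\int[dv]_x (inner x (fun c => (tnorm x (X x))^-1 *: X x c) (grad psi x))%:E
        = - \int[dv]_x (tnorm x (X x) * psi x)%:E)%E ].

(* Same as the library's ess_inf, relative to the subset A. *)
Definition ess_inf_on (A : set M) (h : M -> R) : \bar R :=
  ereal_sup [set z | \forall x \ae dv, A x -> (z <= (h x)%:E)%E].

End measure.
End riemannian.

(* Main.v *)
From HB Require Import structures.
Require Import Defs.
From mathcomp Require Import all_boot all_order all_algebra.
From mathcomp Require Import all_classical all_reals all_analysis.
From mathcomp Require Import perm measurable_realfun.
From mathcomp Require Import ring lra.

(** Why the theorem is true.  Write [X] for the weak gradient of [f] and [V r] for
the volume of the geodesic ball of radius [r] around [x0].  If the limit of the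
essential infima is positive, then [|X| >= c > 0] almost everywhere on the ball
of radius [r], for all large [r].  Test the equation with a smooth [phi >= 0]
that is at least 1/2 on this ball, vanishes off the ball of radius [4 r] and is
locally [C / r]-Lipschitz, where [C] does not depend on [r].  As
[X / |X|] has length at most one,

  [c / 2 * V r <= \int |X| phi = - \int <X / |X|, grad phi> <= K / r * V (8 r)
                                                        <= K / r * D ^ 3 * V r],

by doubling, and [0 < V r < oo], which is absurd as soon as [r > 2 K D ^ 3 / c].
So the equation forces the essential infimum of [|X|] over a large ball to be at
most of the order of the reciprocal of the radius.

The work lies in providing [phi].  The obvious candidate is
[psi = max 0 (2 - d(x0, .) / r)], which is only Lipschitz, while the equation is
tested on smooth functions of compact support.  Hence two ingredients.

Compactness ([hopf_rinow]): on a manifold that is complete for the geodesic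
distance, closed balls are compact, so that [phi] has compact support.  Balls
of radius less than [R0] being compact, an ultrafilter on the closed ball of
radius [R0] contains arbitrarily small balls and so, by completeness, has a
limit; local compactness then goes beyond [R0], and a supremum argument
concludes.

Smoothing ([lipschitz_smoothing]): a Lipschitz function of compact support is
uniformly close to smooth functions whose local Lipschitz constant is larger by
at most a dimensional factor.  In a chart where the metric is comparable to the
flat one, take the values of the function at the points of a fine lattice and
average them with the weights given by a smooth partition of unity
([lattice_smoothing]): at most [5 ^ n] weights matter near a point, each varies
on the scale of the mesh, and so does the function, so the slope is bounded
whatever the mesh.  Finitely many charts are treated one after the other
([patch_step]): replacing [phi] by [phi + b * (S - phi)] with a cutoff [b] adds
at most [|S - phi|] times the Lipschitz constant of [b] to the slope, and this
is as small as desired because [S] and [phi] are both close to [psi].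

Both rest on a comparison of the geodesic distance with normalised coordinates
([dist_lower], [dist_upper]), so that a local Lipschitz bound for the distance
is also a bound for the gradient ([grad_norm_le]).  The two integrals are
compared with constants through pointwise bounds alone: the integral of a
nonnegative function is a supremum over the simple functions below it, hence
monotone for arbitrary integrands ([le_integral_nonmeas]). *)

Set Implicit Arguments.
Unset Strict Implicit.
Unset Printing Implicit Defensive.

Import Order.TTheory GRing.Theory Num.Theory.
Import numFieldNormedType.Exports.

Local Open Scope classical_set_scope.
Local Open Scope ring_scope.

(** * Functions of class C^k on R^n *)

Section calculus.
Context {R : realType} {n : nat}.
Implicit Types (U : set 'rV[R]_n) (f g : 'rV[R]_n -> R).
Local Notation e_ i := (delta_mx 0 i : 'rV[R]_n).

(** Restricting [f] to a line turns its difference quotients into those of a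
function of one real variable, literally; hence one-variable results such as
the mean value theorem and the chain rule apply to directional derivatives. *)
Lemma line_growth f (x v : 'rV[R]_n) (t : R) :
  (fun h : R => h^-1 *: (((fun s : R => f (x + s *: v)) \o shift t) (h *: 1) -
                   f (x + t *: v))) =
  (fun h => h^-1 *: ((f \o shift (x + t *: v)) (h *: v) - f (x + t *: v))).
Proof.
apply/funext => h /=; congr (_ *: (f _ - _)).
by rewrite [h%:A]mulr1 scalerDl addrCA.
Qed.

Lemma derivable_line f (x v : 'rV[R]_n) (t : R) :
  derivable f (x + t *: v) v <->
  derivable (fun s : R => f (x + s *: v)) t 1.
Proof. by rewrite /derivable line_growth. Qed.

Lemma derive_line f (x v : 'rV[R]_n) (t : R) :
  'D_1 (fun s : R => f (x + s *: v)) t = 'D_v f (x + t *: v).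
Proof. by rewrite /derive line_growth. Qed.

Lemma derive_line0 f (x v : 'rV[R]_n) :
  'D_1 (fun s : R => f (x + s *: v)) 0 = 'D_v f x.
Proof. by rewrite derive_line scale0r addr0. Qed.

Lemma derivable_line0 f (x v : 'rV[R]_n) :
  derivable f x v <-> derivable (fun s : R => f (x + s *: v)) 0 1.
Proof. by rewrite -derivable_line scale0r addr0. Qed.

Lemma near_continuous (T S : topologicalType) (f g : T -> S) y :
  (\forall x \near y, f x = g x) -> {for y, continuous f} ->
  {for y, continuous g}.
Proof.
move=> fg; rewrite /prop_for /continuous_at -(nbhs_singleton fg) => cf.
by apply: cvg_trans cf; apply: near_eq_cvg; exact: fg.
Qed.

(** Being of class C^k is a local property.  As [Ck] constrains values of the
derivatives at each point of [U], agreement has to hold near each point. *)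
Lemma Ck_near k U f g : (forall y, U y -> \forall x \near y, f x = g x) ->
  Ck k U f -> Ck k U g.
Proof.
elim: k U f g => [|k IH] U f g fg /= [cf df]; split.
1,3: by move=> y Uy; apply: near_continuous (cf y Uy); exact: fg.
- by [].
- move=> i; have [di Cdi] := df i; split.
    by move=> y Uy; apply: near_eq_derivable (di y Uy); exact: fg.
  apply: IH Cdi => y Uy; have /near_join := fg y Uy.
  by apply: filterS => x fgx; exact: near_eq_derive.
Qed.

Lemma CkS k U V f : V `<=` U -> Ck k U f -> Ck k V f.
Proof.
elim: k U V f => [|k IH] U V f VU /= [cf df]; split; try by move=> y /VU; exact: cf.
  by [].
move=> i; have [di Cdi] := df i; split; first by move=> y /VU; exact: di.
exact: IH Cdi.
Qed.

Lemma CkSk k U f : Ck k.+1 U f -> Ck k U f.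
Proof.
elim: k U f => [|k IH] U f /=; first by case.
move=> [cf df]; split => // i; have [di Cdi] := df i; split => //.
exact: IH Cdi.
Qed.

Lemma Ck_pointwise k U f : (forall y, U y -> Ck k [set y] f) -> Ck k U f.
Proof.
elim: k U f => [|k IH] U f /= H; split.
1,3: by move=> y Uy; have [+ _] := H y Uy; apply.
- by [].
- move=> i; split; first by move=> y Uy; have [_ /(_ i)[+ _]] := H y Uy; apply.
  by apply: IH => y Uy; have [_ /(_ i)[_]] := H y Uy.
Qed.

Lemma Ck_cst k U (a : R) : Ck k U (cst a).
Proof.
elim: k U a => [|k IH] U a /=; split => //; try by move=> y _; exact: cst_continuous.
move=> i; split; first by move=> y _; exact: derivable_cst.
rewrite (_ : partial i (cst a) = cst 0); first exact: IH.
by apply/funext => y; rewrite /partial derive_cst.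
Qed.

Lemma CkD k U f g : open U -> Ck k U f -> Ck k U g -> Ck k U (f + g).
Proof.
move=> oU; elim: k f g => [|k IH] f g /= [cf df] [cg dg]; split.
1,3: by move=> y Uy; apply: continuousD; [exact: cf|exact: cg].
- by [].
- move=> i; have [di Cdi] := df i; have [gi Cgi] := dg i; split.
    by move=> y Uy; apply: derivableD; [exact: di|exact: gi].
  apply: Ck_near (IH _ _ Cdi Cgi) => y Uy.
  near=> x; rewrite /partial deriveD//; [apply: di|apply: gi];
  by near: x; exact: open_nbhs_nbhs.
Unshelve. all: by end_near. Qed.

Lemma CkM k U f g : open U -> Ck k U f -> Ck k U g -> Ck k U (f * g).
Proof.
move=> oU; elim: k f g => [|k IH] f g /=.
  move=> [cf _] [cg _]; split => // y Uy.
  by apply: continuousM; [exact: cf|exact: cg].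
move=> [cf df] [cg dg]; split.
  by move=> y Uy; apply: continuousM; [exact: cf|exact: cg].
move=> i; have [di Cdi] := df i; have [gi Cgi] := dg i; split.
  by move=> y Uy; apply: derivableM; [exact: di|exact: gi].
have Cf : Ck k U f by apply: CkSk.
have Cg : Ck k U g by apply: CkSk.
apply: Ck_near (CkD oU (IH _ _ Cf Cgi) (IH _ _ Cg Cdi)) => y Uy.
near=> x; rewrite /partial deriveM//; [apply: di|apply: gi];
  by near: x; exact: open_nbhs_nbhs.
Unshelve. all: by end_near. Qed.

Lemma Ck_sum k U (I : Type) (r : seq I) (F : I -> 'rV[R]_n -> R) : open U ->
  (forall i, Ck k U (F i)) -> Ck k U (fun y => \sum_(i <- r) F i y).
Proof.
move=> oU HF; elim: r => [|i r IH].
  by under eq_fun do rewrite big_nil; exact: Ck_cst.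
by under eq_fun do rewrite big_cons; exact: (CkD oU (HF i) IH).
Qed.

Lemma Ck_prod k U (I : Type) (r : seq I) (F : I -> 'rV[R]_n -> R) : open U ->
  (forall i, Ck k U (F i)) -> Ck k U (fun y => \prod_(i <- r) F i y).
Proof.
move=> oU HF; elim: r => [|i r IH].
  by under eq_fun do rewrite big_nil; exact: Ck_cst.
by under eq_fun do rewrite big_cons; exact: (CkM oU (HF i) IH).
Qed.

(** Stated with iterated one-variable derivatives rather than with [Ck] on
one-dimensional row vectors, since the functions to be composed with live on
the line. *)
Definition smooth1 (h : R -> R) := forall k x, derivable (derive1n k h) x 1.

Lemma smooth1_derive h : smooth1 h -> smooth1 (derive1 h).
Proof. by move=> sh k x; rewrite -derive1Sn; exact: sh. Qed.

Lemma smooth1_continuous h : smooth1 h -> continuous h.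
Proof.
by move=> sh x; apply/differentiable_continuous/derivable1_diffP; exact: (sh 0%N).
Qed.

Lemma is_derive_comp1 (h : R -> R) g (x v : 'rV[R]_n) :
  derivable h (g x) 1 -> derivable g x v ->
  is_derive x v (h \o g) (derive1 h (g x) * 'D_v g x).
Proof.
move=> dh /derivable_line0 dg.
have dh' : derivable h ((fun s : R => g (x + s *: v)) 0) 1.
  by rewrite /= scale0r addr0.
have /derivable1_diffP dhg : differentiable (h \o (fun s : R => g (x + s *: v))) (0 : R).
  by apply: differentiable_comp; apply/derivable1_diffP.
apply: DeriveDef; first exact/derivable_line0.
rewrite -derive_line0 -[LHS]derive1E.
by rewrite (derive1_comp dg dh') /= scale0r addr0; congr (_ * _);
  rewrite derive1E derive_line0.
Qed.

Lemma Ck_comp1 k U h g : open U -> smooth1 h -> Ck k U g -> Ck k U (h \o g).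
Proof.
move=> oU; elim: k h => [|k IH] h sh /=.
  move=> [cg _]; split => // y Uy; apply: continuous_comp; first exact: cg.
  exact: smooth1_continuous.
move=> [cg dg]; split.
  move=> y Uy; apply: continuous_comp; first exact: cg.
  exact: smooth1_continuous.
move=> i; have [gi Cgi] := dg i; split.
  move=> y Uy; have [] // := @is_derive_comp1 h g y (e_ i) _ _.
    exact: (sh 0%N).
  exact: gi.
have Cg : Ck k U g by apply: CkSk.
apply: Ck_near (CkM oU (IH _ (smooth1_derive sh) Cg) Cgi) => y Uy.
near=> x.
have [] // := @is_derive_comp1 h g x (e_ i) _ _; first exact: (sh 0%N).
by apply: gi; near: x; exact: open_nbhs_nbhs.
Unshelve. all: by end_near. Qed.

Lemma near0_norm_lt (d : R) : 0 < d ->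
  \forall h \near nbhs (0 : 'rV[R]_n), `|h| < d.
Proof.
move=> d0; have := @pseudometric_normed_Zmodule.nbhs0_lt R 'rV[R]_n d d0.
by rewrite near_simpl.
Qed.

(** Move from [y] to [y + h] one coordinate at a time and apply the mean value
theorem on each of the [n] segments; the partial derivatives met on the way are
close to those at [y]. *)
Lemma C1_expansion f (y : 'rV[R]_n) :
  (forall i : 'I_n, \forall x \near y, derivable f x (e_ i)) ->
  (forall i, {for y, continuous (partial i f)}) ->
  forall e : R, 0 < e -> \forall h \near (0 : 'rV[R]_n),
    `|f (h + y) - f y - \sum_i h 0 i * partial i f y| <= e * `|h|.
Proof.
move=> df cf e e0.
(* n + 1 rather than n, as n may be zero. *)
pose en := e / n.+1%:R.
have en0 : 0 < en by rewrite divr_gt0.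
have : \forall x \near y, forall i : 'I_n, derivable f x (e_ i) /\
    `|partial i f y - partial i f x| <= en.
  apply: (@filter_forall _ 'I_n (fun i x => derivable f x (e_ i) /\ `|partial i f y - partial i f x| <= en) (nbhs y) (nbhs_filter y)) => i.
  apply: filterI; first exact: df.
  by have /cvgrPdist_le/(_ _ en0) := cf i.
move=> /nbhs_ballP[d /= d0 Bd].
near=> h.
have hd : `|h| < d by near: h; exact: near0_norm_lt.
(* The vector h with only its first k coordinates kept. *)
pose p k : 'rV[R]_n := \row_i (if (i < k)%N then h 0 i else 0).
have hi i : `|h 0 i| <= `|h|.
  by rewrite [leRHS]/Num.Def.normr/= mx_normrE (le_bigmax _ _ (0, i)).
have pd k i (t : R) : `|t| <= `|h 0 i| -> k = i :> nat -> ball y d (y + p k + t *: e_ i).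
  move=> th ki; split; first by [].
  move=> a j; rewrite !ord1 !mxE /ball /= ki.
  have [->|ij] := eqVneq j i; rewrite ?ltnn ?eqxx /=.
    rewrite mulr1 addr0 opprD addrA subrr sub0r normrN.
    by rewrite (le_lt_trans th)// (le_lt_trans (hi i)).
  rewrite mulr0 addr0 opprD addrA subrr sub0r normrN.
  by case: ifP => _; rewrite ?normr0// (le_lt_trans (hi j)).
have step (i : 'I_n) : `|f (y + p i.+1) - f (y + p i) - h 0 i * partial i f y|
    <= en * `|h|.
  have pS : p i.+1 = p i + h 0 i *: e_ i.
    apply/rowP => j; rewrite !mxE eqxx /= ltnS leq_eqVlt.
    have [->|ij] := eqVneq j i; first by rewrite eqxx ltnn mulr1 add0r.
    by rewrite -val_eqE/= in ij; rewrite (negbTE ij) mulr0 addr0.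
  pose q (t : R) := f (y + p i + t *: e_ i).
  have qd (t : R) : `|t| <= `|h 0 i| -> is_derive t 1 q (partial i f (y + p i + t *: e_ i)).
    move=> th; have [+ _] := Bd _ (pd _ _ _ th erefl) i.
    by move=> dfi; apply: DeriveDef; [exact/derivable_line|exact: derive_line].
  have [c ch ->] : exists2 c : R, `|c| <= `|h 0 i| &
      f (y + p i.+1) - f (y + p i) = partial i f (y + p i + c *: e_ i) * h 0 i.
    rewrite pS addrA.
    have qo (a b : R) : (forall t : R, a <= t <= b -> `|t| <= `|h 0 i|) ->
        forall t, t \in `]a, b[ -> is_derive t 1 q (partial i f (y + p i + t *: e_ i)).
      move=> ab t; rewrite in_itv /= => /andP[/ltW t0 /ltW t1]; apply: qd.
      by apply: ab; rewrite t0.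
    have qc (a b : R) : (forall t : R, a <= t <= b -> `|t| <= `|h 0 i|) ->
        {within `[a, b], continuous q}.
      move=> ab; apply: derivable_within_continuous => t; rewrite in_itv /= => /ab.
      by move=> /qd[].
    have [h0|h0] := leP 0 (h 0 i).
      have ab (t : R) : 0 <= t <= h 0 i -> `|t| <= `|h 0 i|.
        by move=> /andP[t0 th]; rewrite !ger0_norm.
      have [c] := MVT_segment h0 (qo _ _ ab) (qc _ _ ab).
      rewrite in_itv /= => /ab cb; rewrite subr0 /q scale0r addr0 => E.
      by exists c.
    have ab (t : R) : h 0 i <= t <= 0 -> `|t| <= `|h 0 i|.
      by move=> /andP[t0 th]; rewrite !ler0_norm ?lerN2// ltW.
    have [c] := MVT_segment (ltW h0) (qo _ _ ab) (qc _ _ ab).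
    rewrite in_itv /= => /ab cb; rewrite /q scale0r addr0 sub0r => E.
    by exists c => //; rewrite -opprB E mulrN opprK.
  have [_ cc] := Bd _ (pd _ _ _ ch erefl) i.
  rewrite (mulrC (h 0 i)) -mulrBl normrM ler_pM// distrC//.
have -> : f (h + y) - f y - \sum_i h 0 i * partial i f y =
    \sum_(i < n) (f (y + p i.+1) - f (y + p i) - h 0 i * partial i f y).
  rewrite [RHS]big_split/= sumrN; congr (_ - _).
  rewrite -(big_mkord xpredT (fun k => f (y + p k.+1) - f (y + p k))).
  rewrite (telescope_sumr_eq (fun k => f (y + p k)))//.
  have -> : p n = h by apply/rowP => i; rewrite mxE ltn_ord.
  have -> : p 0%N = 0 by apply/rowP => i; rewrite !mxE.
  by rewrite addr0 (addrC h).
rewrite (le_trans (ler_norm_sum _ _ _))// (le_trans (ler_sum _ (fun i _ => step i)))//.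
rewrite sumr_const card_ord -mulrnAl ler_wpM2r//.
rewrite /en -mulr_natr -mulrA (ler_piMr (ltW e0))// mulrC ler_pdivrMr// mul1r.
by rewrite ler_nat.
Unshelve. all: by end_near. Qed.

(** The classical fact that continuous partial derivatives imply
differentiability; it gives access to the chain rule for differentials, with
which velocities and metrics change under transition maps. *)
Lemma C1_diff f (y : 'rV[R]_n) :
  (forall i : 'I_n, \forall x \near y, derivable f x (e_ i)) ->
  (forall i, {for y, continuous (partial i f)}) ->
  differentiable f y /\ forall v, 'd f y v = \sum_i v 0 i * partial i f y.
Proof.
move=> df cf.
pose D : 'cV[R]_n := \col_i partial i f y.
have DE v : (v *m D) 0 0 = \sum_i v 0 i * partial i f y.
  by rewrite mxE; apply: eq_bigr => i _; rewrite mxE.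
pose L (v : 'rV[R]_n) : R := (v *m D) 0 0.
have linL : linear L by move=> a u v; rewrite /L mulmxDl -scalemxAl !mxE.
pose Lm := GRing.isLinear.Build _ _ _ _ _ linL.
pose LL : {linear 'rV[R]_n -> R} := HB.pack L Lm.
have cL : continuous LL.
  move=> x; apply: differentiable_continuous.
  have -> : (LL : _ -> R) = \sum_i (fun v : 'rV[R]_n => v 0 i * partial i f y).
    by apply/funext => v; rewrite fct_sumE /= /L DE.
  apply: differentiable_sum => i; apply: differentiableM => //.
  exact: differentiable_coord.
have eqf : f \o shift y = cst (f y) + LL +o_ (0 : 'rV[R]_n) id.
  apply/eqaddoP => e e0.
  have := C1_expansion df cf e0; apply: filterS => h.
  rewrite /= opprD addrA -DE.
  by rewrite -![(_ - _ : _ -> _) _]/(_ - _) /=.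
have dE := diff_unique cL eqf.
split; last by move=> v; rewrite dE -DE.
by apply/diff_locallyP; rewrite dE; split.
Qed.

End calculus.

(** * A smooth step function *)

Section smooth_step.
Context {R : realType}.
Implicit Types (p : {poly R}) (t u : R).

(** The family of all [p (1/t) * exp (-1/t)], extended by zero, is closed under
differentiation; treating it as a whole makes smoothness of [exp (-1/t)] at the
origin a one-line induction. *)
Definition flat p t : R := if t <= 0 then 0 else p.[t^-1] * expR (- t^-1).

(** From [1 + v <= exp v] with [v = u / (k + 1)], since [exp u] is the [(k + 1)]-st
power of [exp v]. *)
Lemma exprn_expR_bound k u : 0 <= u -> u ^+ k * expR (- u) <= k.+1%:R ^+ k.
Proof.
move=> u0; pose v := u / k.+1%:R.
have v0 : 0 <= v by rewrite divr_ge0.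
have uv : u = k.+1%:R * v by rewrite /v mulrC divfK.
rewrite expRN ler_pdivrMr ?expR_gt0// uv exprMn ler_wpM2l ?exprn_ge0//.
rewrite expRM_natl exprS.
have ev := expR_ge1Dx v.
apply: (@le_trans _ _ (expR v ^+ k)).
  by rewrite lerXn2r ?nnegrE ?expR_ge0// (le_trans _ ev)// lerDr.
rewrite ler_peMl ?exprn_ge0 ?expR_ge0//.
by rewrite (le_trans _ ev)// lerDl.
Qed.

Lemma poly_expR_bound p : exists2 C : R, 0 <= C &
  forall u, 0 <= u -> `|p.[u]| * expR (- u) <= C.
Proof.
exists (\sum_(i < size p) `|p`_i| * i.+1%:R ^+ i).
  by apply: sumr_ge0 => i _; rewrite mulr_ge0// exprn_ge0.
move=> u u0; rewrite horner_coef.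
rewrite (le_trans (ler_wpM2r (expR_ge0 _) (ler_norm_sum _ _ _)))//.
rewrite mulr_suml; apply: ler_sum => i _.
rewrite normrM normrX (ger0_norm u0) -mulrA ler_wpM2l//.
exact: exprn_expR_bound.
Qed.

Lemma flat_bound p : exists2 C : R, 0 <= C & forall t, `|flat p t| <= C.
Proof.
have [C C0 HC] := poly_expR_bound p; exists C => // t.
rewrite /flat; have [t0|t0] := leP t 0; first by rewrite normr0.
by rewrite normrM (ger0_norm (expR_ge0 _)); apply: HC; rewrite invr_ge0 ltW.
Qed.

(** At [t > 0] this is the product and chain rule.  At the origin the difference
quotient of [flat p] is [h] times a member of the same bounded family, which is
also why the derivative there is zero. *)
Lemma is_derive_flat p t :
  is_derive t 1 (flat p) (flat ('X^2 * (p - p^`())) t).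
Proof.
have [t0|t0|->] := ltgtP t 0.
- rewrite [flat _ t]/flat (ltW t0).
  apply: (@near_eq_is_derive _ _ _ (cst (0 : R))).
  near=> s; rewrite /flat /= ifT// ltW//.
  by near: s; exact: lt_nbhsl.
- rewrite [flat _ t]/flat (leNgt t) t0 /=.
  suff H : is_derive t 1 (fun s : R => p.[s^-1] * expR (- s^-1))
      (('X^2 * (p - p^`())).[t^-1] * expR (- t^-1)).
    apply: near_eq_is_derive H.
    near=> s; rewrite /flat leNgt ifF//; apply/negbF.
    by near: s; exact: lt_nbhsr.
  have tn0 : t != 0 by rewrite gt_eqF.
  have di : is_derive t 1 (fun s : R => s^-1) (- t ^- 2).
    apply: is_derive_eq; first exact: (@is_deriveV _ id t 1 1 tn0).
    by rewrite [_ *: 1]mulr1.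
  have dg : is_derive (t^-1) 1 (fun u => p.[u] * expR (- u))
      ((p^`() - p).[t^-1] * expR (- t^-1)).
    have dp := is_derive_poly p t^-1.
    have de : is_derive (t^-1) (1 : R) (expR \o -%R) (expR (- t^-1) * -1).
      exact: is_derive1_comp.
    rewrite (_ : (fun u => p.[u] * expR (- u)) = horner p * (expR \o -%R))//.
    have H := is_deriveM dp de; apply: (is_derive_eq H).
    rewrite /= -![_ *: _]/(_ * _) hornerD hornerN; ring.
  have H := is_derive1_comp dg di; apply: (is_derive_eq H).
  rewrite !(hornerM, hornerD, hornerN, hornerX); field; exact: tn0.
- rewrite [flat ('X^2 * _) 0]/flat lexx.
  have [C C0 HC] := flat_bound ('X^2 * p).
  have key : (fun h : R => h^-1 *: ((flat p \o shift 0) (h *: 1) - flat p 0))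
      @ (0 : R)^' --> (0 : R).
    have C1 : 0 < C + 1 by rewrite ltr_wpDl.
    apply/cvgr0Pnorm_le => e e0; near=> h.
    have h0 : h != 0 by near: h; exact: nbhs_dnbhs_neq.
    rewrite /= addr0 [h%:A]mulr1 {2}/flat lexx subr0.
    have -> : h^-1 *: flat p h = h * flat ('X^2 * p) h.
      rewrite /flat; case: ifP => _; first by rewrite scaler0 mulr0.
      rewrite !hornerM !hornerX -[_ *: _]/(_ * _); field; exact: h0.
    rewrite normrM (@le_trans _ _ (`|h| * C))// ?ler_wpM2l//.
    rewrite (@le_trans _ _ (`|h| * (C + 1)))// ?ler_wpM2l// ?lerDl//.
    rewrite -ler_pdivlMr//; apply/ltW; near: h.
    by apply: pseudometric_normed_Zmodule.dnbhs0_lt; rewrite divr_gt0.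
  have D0 : derivable (flat p) 0 1 by apply/cvg_ex; exists (0 : R).
  have E0 : 'D_1 (flat p) 0 = 0 by exact/cvg_lim.
  exact: (DeriveDef D0 E0).
Unshelve. all: by end_near. Qed.

Lemma smooth1_flat p : smooth1 (flat p).
Proof.
move=> k; elim: k p => [|k IH] p x; first by have [] := is_derive_flat p x.
rewrite derive1Sn (_ : derive1 (flat p) = flat ('X^2 * (p - p^`()))); first exact: IH.
by apply/funext => t; rewrite derive1E; have [] := is_derive_flat p t.
Qed.

(** The function [exp (-1/t)] for [t > 0]. *)
Definition bexp t := flat 1 t.

Lemma bexpE t : bexp t = if t <= 0 then 0 else expR (- t^-1).
Proof. by rewrite /bexp /flat hornerC mul1r. Qed.

Lemma bexp_nd s t : s <= t -> bexp s <= bexp t.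
Proof.
move=> st; rewrite !bexpE; have [s0|s0] := leP s 0.
  by case: ifP => // _; exact: expR_ge0.
have t0 := lt_le_trans s0 st.
by rewrite (leNgt t) t0 /= ler_expR lerN2 lef_pV2.
Qed.

Lemma bexp_gt0 t : 0 < t -> 0 < bexp t.
Proof. by move=> t0; rewrite bexpE (leNgt t) t0 /= expR_gt0. Qed.

Lemma bexp_le0 t : t <= 0 -> bexp t = 0.
Proof. by move=> t0; rewrite bexpE t0. Qed.

Lemma bexp_ge0 t : 0 <= bexp t.
Proof. by rewrite bexpE; case: ifP => // _; exact: expR_ge0. Qed.

Lemma bexp_lip : exists2 C : R, 0 <= C & forall s t, `|bexp s - bexp t| <= C * `|s - t|.
Proof.
have [C C0 HC] := flat_bound ('X^2 * (1 - 1^`())).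
exists C => // s t; wlog st : s t / s <= t => [H|].
  by have [/H//|/ltW/H] := leP s t; rewrite distrC (distrC t).
have dE x : x \in `]s, t[ -> is_derive x 1 bexp (flat ('X^2 * (1 - 1^`())) x).
  by move=> _; exact: is_derive_flat.
have cE : {within `[s, t], continuous bexp}.
  apply: derivable_within_continuous => x _.
  by have [] := is_derive_flat 1 x.
have [c _ E] := MVT_segment st dE cE.
by rewrite distrC (distrC s) E normrM ler_wpM2r.
Qed.

(** Composing [bexp] with itself gives a step that is equal to 0 for [t <= 0] and
to 1 for [t >= 1], with a constant as denominator: smoothness needs neither
quotients of functions nor integration. *)
Definition sstep t := bexp (bexp 1 - bexp (1 - t)) / bexp (bexp 1).

Let b1 : 0 < bexp (1 : R).
Proof. exact: bexp_gt0. Qed.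

Let bb1 : 0 < bexp (bexp (1 : R)).
Proof. exact: bexp_gt0. Qed.

Lemma sstep0 t : t <= 0 -> sstep t = 0.
Proof.
move=> t0; rewrite /sstep bexp_le0 ?mul0r// subr_le0 bexp_nd//.
by rewrite lerBrDr gerDl.
Qed.

Lemma sstep1 t : 1 <= t -> sstep t = 1.
Proof.
move=> t0; rewrite /sstep (@bexp_le0 (1 - t)) ?subr_le0// subr0 divff//.
by rewrite gt_eqF.
Qed.

Lemma sstep_nd s t : s <= t -> sstep s <= sstep t.
Proof.
move=> st; rewrite ler_pM2r ?invr_gt0// bexp_nd// lerD2l lerN2 bexp_nd//.
by rewrite lerD2l lerN2.
Qed.

Lemma sstep_ge0 t : 0 <= sstep t.
Proof. by rewrite divr_ge0 ?bexp_ge0. Qed.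

Lemma sstep_le1 t : sstep t <= 1.
Proof.
have [t1|/ltW/sstep_nd] := leP 1 t; first by rewrite sstep1.
by rewrite (@sstep1 1).
Qed.

Lemma sstep_lip : exists2 C : R, 0 <= C &
  forall s t, `|sstep s - sstep t| <= C * `|s - t|.
Proof.
have [C C0 HC] := bexp_lip.
exists (C * C / bexp (bexp 1)); first by rewrite divr_ge0 ?mulr_ge0 ?bexp_ge0.
move=> s t; rewrite /sstep -mulrBl normrM normfV (gtr0_norm bb1) mulrAC.
rewrite ler_pM2r ?invr_gt0// (le_trans (HC _ _))// -mulrA ler_wpM2l//.
rewrite opprB addrC subrKA (le_trans (HC _ _))// ler_wpM2l//.
by rewrite opprB addrC subrKA.
Qed.

Lemma Ck_sstep n k (U : set 'rV[R]_n) (g : 'rV[R]_n -> R) : open U ->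
  Ck k U g -> Ck k U (fun y => sstep (g y)).
Proof.
move=> oU Cg; have Cc (a : R) : Ck k U (cst a) by exact: Ck_cst.
have N (f : 'rV[R]_n -> R) (a : R) : Ck k U f -> Ck k U (fun y => a - f y).
  move=> Cf; have := CkD oU (Cc a) (CkM oU (Cc (-1)) Cf).
  by congr (Ck _ _ _); apply/funext => y; rewrite -[LHS]/(a + -1 * f y) mulN1r.
have B (f : 'rV[R]_n -> R) : Ck k U f -> Ck k U (fun y => bexp (f y)).
  by move=> Cf; exact: (Ck_comp1 oU (@smooth1_flat 1) Cf).
exact: (CkM oU (B _ (N _ _ (B _ (N _ _ Cg)))) (Cc _)).
Qed.

End smooth_step.

(** * Smoothing in R^n by lattice averages *)

Section sup_norm.
Context {R : realType} {n : nat}.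
Implicit Types z w : 'rV[R]_n.

Lemma ler_coord_norm z i : `|z 0 i| <= `|z|.
Proof. by rewrite [leRHS]/Num.Def.normr/= mx_normrE (le_bigmax _ _ (0, i)). Qed.

Lemma rV_norm_le z (c : R) : 0 <= c -> (forall i, `|z 0 i| <= c) -> `|z| <= c.
Proof.
move=> c0 H; rewrite /Num.Def.normr/= mx_normrE (bigmax_le _ c0)//= => -[a i] _ /=.
by rewrite ord1.
Qed.

Lemma rV_norm_lt z (c : R) : 0 < c -> (forall i, `|z 0 i| < c) -> `|z| < c.
Proof.
move=> c0 H; rewrite /Num.Def.normr/= mx_normrE (bigmax_lt _ c0)//= => -[a i] _ /=.
by rewrite ord1.
Qed.

End sup_norm.

Section lattice.
Context {R : realType}.

(** Replace the factors one by one: factors in [0, 1] do not amplify the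
differences. *)
Lemma prod_lip (I : Type) (r : seq I) (a b : I -> R) :
  (forall i, 0 <= a i <= 1) -> (forall i, 0 <= b i <= 1) ->
  `|\prod_(i <- r) a i - \prod_(i <- r) b i| <= \sum_(i <- r) `|a i - b i|.
Proof.
move=> a01 b01; elim: r => [|i r IH]; first by rewrite !big_nil subrr normr0.
rewrite !big_cons.
have /andP[ai0 ai1] := a01 i; have /andP[bi0 bi1] := b01 i.
set A := \prod_(j <- r) a j; set B := \prod_(j <- r) b j.
have B0 : 0 <= B by apply: prodr_ge0 => j _; have /andP[] := b01 j.
have B1 : B <= 1 by apply: prodr_ile1 => j _; exact: b01.
have -> : a i * A - b i * B = (a i - b i) * B + a i * (A - B) by ring.
rewrite (le_trans (ler_normD _ _))// lerD//.
  by rewrite normrM (ger0_norm B0) ler_piMr.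
by rewrite normrM (ger0_norm ai0) (le_trans _ IH)// ler_piMl.
Qed.

(** Differences of consecutive translates of the step: they telescope, so the
integer translates of [hat] form a partition of unity ([hat_sum]). *)
Definition hat (t : R) := sstep (t + 1) - sstep t.

Lemma hat_ge0 t : 0 <= hat t.
Proof. by rewrite subr_ge0 sstep_nd// lerDl. Qed.

Lemma hat_le1 t : hat t <= 1.
Proof. by rewrite lerBlDr (le_trans (sstep_le1 _))// lerDl sstep_ge0. Qed.

Lemma hat_out t : 1 <= `|t| -> hat t = 0.
Proof.
rewrite ler_normr => /orP[t1|t1]; rewrite /hat.
  by rewrite !sstep1 ?subrr//; lra.
by rewrite !sstep0 ?subrr//; lra.
Qed.

Lemma hat_sum (m : nat) t : 0 <= t <= m%:R -> \sum_(j < m.+1) hat (t - j%:R) = 1.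
Proof.
move=> /andP[t0 tm].
rewrite -(big_mkord xpredT (fun j => hat (t - j%:R))).
under eq_bigr do rewrite -[hat _]opprK.
rewrite sumrN (telescope_sumr_eq (fun j => sstep (t - j%:R + 1)))//.
  rewrite subr0 sstep0 ?sstep1 ?sub0r ?opprK//; first by lra.
  by rewrite -natr1; lra.
by move=> j _; rewrite /hat opprB -natr1 opprD addrA subrK.
Qed.

Lemma hat_lip : exists2 C : R, 0 <= C & forall s t, `|hat s - hat t| <= C * `|s - t|.
Proof.
have [C C0 HC] := @sstep_lip R; exists (2 * C); first by rewrite mulr_ge0.
move=> s t.
have -> : hat s - hat t = (sstep (s + 1) - sstep (t + 1)) - (sstep s - sstep t).
  rewrite /hat.
  by move: (sstep (s + 1)) (sstep s) (sstep (t + 1)) (sstep t) => a b c e; ring.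
rewrite (le_trans (ler_normB _ _))// -mulrA mulr_natl mulr2n lerD//.
by rewrite (le_trans (HC _ _))// opprD addrACA subrr addr0.
Qed.

(** Integers at distance at most 2 from [t] lie in an interval of length 4.  The
count is a sum of indicators, the form in which it occurs in [lpt_count]. *)
Lemma near_count (m : nat) (t : R) :
  \sum_(j < m) (`|j%:R - t| <= 2)%R%:R <= 5 :> R.
Proof.
rewrite -natr_sum ler_nat -big_mkcond /= sum1_card.
case: (pickP (fun j : 'I_m => `|(j%:R : R) - t| <= 2)) => [j0 j0P|none]; last first.
  by rewrite eq_card0// => j; exact: none.
case: (@arg_minnP _ j0 (fun j : 'I_m => `|j%:R - t| <= 2) (fun j => nat_of_ord j) j0P) => j1 j1P j1min.
rewrite cardE -(size_map val); rewrite -[X in (_ <= X)%N](size_iota j1).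
apply: uniq_leq_size; first by rewrite (map_inj_uniq val_inj) enum_uniq.
move=> _ /mapP[j + ->]; rewrite mem_enum => jP.
have {}jP : `|j%:R - t| <= 2 := jP.
rewrite mem_iota j1min//=.
have : (j%:R : R) <= (j1 + 4)%N%:R.
  move: jP j1P; rewrite !ler_norml natrD => /andP[_ ?] /andP[? _]; lra.
by rewrite ler_nat (addnS j1 4) ltnS.
Qed.

Section scheme.
Variables (n : nat) (s : R) (N : nat).
Hypotheses (s0 : 0 < s) (N0 : (0 < N)%N).
Let eps := s / N%:R.
Let m := (6 * N)%N.
Let NR0 : 0 < N%:R :> R. Proof. by rewrite ltr0n. Qed.
Let eps0 : 0 < eps. Proof. by rewrite divr_gt0. Qed.

(** The lattice of mesh [s / N] in the cube of radius [3 s]; the multi-index [k]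
has [6 N + 1] values per coordinate so that both ends are included. *)
Definition lpt (k : {ffun 'I_n -> 'I_m.+1}) : 'rV[R]_n :=
  \row_i (eps * (k i)%:R - 3 * s).

(** The weight of the lattice point [lpt k]: by [lhat_far] it is supported within
one mesh of this point, and by [lhat_sum] the weights sum to 1 on the cube. *)
Definition lhat (k : {ffun 'I_n -> 'I_m.+1}) (z : 'rV[R]_n) :=
  \prod_i hat ((z 0 i + 3 * s) / eps - (k i)%:R).

Let meps : m%:R * eps = 6 * s.
Proof. by rewrite /m natrM /eps -mulrA; congr (_ * _); rewrite mulrC divfK// gt_eqF. Qed.

Lemma lpt_cube k : `|lpt k| <= 3 * s.
Proof.
apply: rV_norm_le => [|i]; first by rewrite mulr_ge0// ltW.
rewrite mxE ler_norml.
have k0 : 0 <= eps * (k i)%:R by rewrite mulr_ge0// ltW.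
have : eps * (k i)%:R <= 6 * s.
  by rewrite -meps mulrC ler_pM2r// ler_nat -ltnS.
by move=> ?; apply/andP; split; lra.
Qed.

Lemma lhat_ge0 k z : 0 <= lhat k z.
Proof. by apply: prodr_ge0 => i _; exact: hat_ge0. Qed.

Lemma lhat_sum z : `|z| <= 3 * s -> \sum_k lhat k z = 1.
Proof.
move=> zs; rewrite /lhat -(bigA_distr_bigA (fun i (j : 'I_m.+1) =>
   hat ((z 0 i + 3 * s) / eps - j%:R))).
apply: big1 => i _; apply: hat_sum.
have := le_trans (ler_coord_norm z i) zs; rewrite ler_norml => /andP[z1 z2].
rewrite divr_ge0 ?(ltW eps0)//=; last by lra.
by rewrite ler_pdivrMr// meps; lra.
Qed.

Lemma lpt_dist k z i : (lpt k - z) 0 i =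
  - eps * ((z 0 i + 3 * s) / eps - (k i)%:R).
Proof. by rewrite !mxE; field; rewrite gt_eqF. Qed.

Lemma lhat_far k z : lhat k z != 0 -> `|lpt k - z| <= eps.
Proof.
move=> kz; apply: rV_norm_le => [|i]; first exact: ltW.
rewrite lpt_dist normrM normrN (gtr0_norm eps0) ler_piMr ?(ltW eps0)//.
rewrite leNgt; apply/negP => /ltW/hat_out h0.
by move: kz; rewrite /lhat (bigD1 i)//= h0 mul0r eqxx.
Qed.

Lemma lhat_lip (C : R) : 0 <= C -> (forall a b : R, `|hat a - hat b| <= C * `|a - b|) ->
  forall k z w, `|lhat k z - lhat k w| <= n%:R * (C / eps) * `|z - w|.
Proof.
move=> C0 HC k z w; rewrite (le_trans (prod_lip _ _ _))//.
1,2: by move=> i; rewrite hat_ge0 hat_le1.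
rewrite (@le_trans _ _ (\sum_(i < n) C / eps * `|z - w|))//; last first.
  by rewrite sumr_const card_ord -[leRHS]mulrA mulr_natl.
apply: ler_sum => i _; rewrite (le_trans (HC _ _))// -mulrA ler_wpM2l//.
rewrite opprD addrACA opprK addNr addr0 -mulrBl normrM normfV (gtr0_norm eps0).
rewrite mulrC ler_pM2l ?invr_gt0// opprD addrACA subrr addr0.
by have := ler_coord_norm (z - w) i; rewrite !mxE.
Qed.

(** At most 5 indices per coordinate; the sum over multi-indices of a product is
the product of the sums. *)
Lemma lpt_count z : \sum_k (`|lpt k - z| <= 2 * eps)%R%:R <= 5 ^+ n :> R.
Proof.
rewrite (@le_trans _ _ (\sum_k \prod_i
    (`|((k : {ffun 'I_n -> 'I_m.+1}) i)%:R - (z 0 i + 3 * s) / eps| <= 2)%R%:R))//.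
  apply: ler_sum => k _; case: (leP `|lpt k - z|) => //= kz; last first.
    by apply: prodr_ge0 => i _; rewrite ler0n.
  rewrite big1// => i _.
  have := le_trans (ler_coord_norm _ i) kz.
  by rewrite lpt_dist normrM normrN (gtr0_norm eps0) mulrC ler_pM2r// distrC => ->.
rewrite -(bigA_distr_bigA (fun i (j : 'I_m.+1) =>
   (`|(j%:R : R) - (z 0 i + 3 * s) / eps| <= 2)%R%:R)).
have -> : 5 ^+ n = \prod_(i < n) (5 : R) by rewrite prodr_const card_ord.
apply: ler_prod => i _.
by rewrite near_count sumr_ge0.
Qed.

Section averaged.
Variables (L : R) (F : 'rV[R]_n -> R).
Hypotheses (L0 : 0 <= L)
  (FL : forall z w : 'rV[R]_n, `|z| <= 3 * s -> `|w| <= 3 * s -> `|F z - F w| <= L * `|z - w|).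

Definition lavg (z : 'rV[R]_n) := \sum_k F (lpt k) * lhat k z.

Lemma lavg_ge0 z : (forall w, `|w| <= 3 * s -> 0 <= F w) -> 0 <= lavg z.
Proof.
by move=> F0; apply: sumr_ge0 => k _; rewrite mulr_ge0 ?lhat_ge0// F0 ?lpt_cube.
Qed.

Lemma lavg_close z : `|z| <= 3 * s -> `|lavg z - F z| <= L * eps.
Proof.
move=> zs; have -> : lavg z - F z = \sum_k (F (lpt k) - F z) * lhat k z.
  under eq_bigr do rewrite mulrBl.
  by rewrite big_split/= sumrN -mulr_sumr lhat_sum// mulr1.
rewrite (le_trans (ler_norm_sum _ _ _))//.
rewrite (@le_trans _ _ (\sum_k L * eps * lhat k z))//; last first.
  by rewrite -mulr_sumr lhat_sum// mulr1.
apply: ler_sum => k _; rewrite normrM (ger0_norm (lhat_ge0 _ _)).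
have [->|k0] := eqVneq (lhat k z) 0; first by rewrite !mulr0.
rewrite ler_wpM2r ?lhat_ge0// (le_trans (FL _ _))// ?lpt_cube//.
by rewrite ler_wpM2l// lhat_far.
Qed.

(** Since the weights sum to 1, subtracting the constant [F z] from the values
changes nothing, so that each term is a product of [|F (lpt k) - F z|], of the
order of [L * eps], by a difference of weights, of the order of
[|z - w| / eps]: the mesh [eps] cancels.  Only the boundedly many lattice points
within [2 eps] of [z] contribute. *)
Lemma lavg_lip (C : R) : 0 <= C -> (forall a b : R, `|hat a - hat b| <= C * `|a - b|) ->
  forall z w, `|z| <= 3 * s -> `|w| <= 3 * s -> `|z - w| <= eps ->
  `|lavg z - lavg w| <= (5 ^+ n * 2 * n%:R * C) * L * `|z - w|.
Proof.
move=> C0 HC z w zs ws zw.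
have -> : lavg z - lavg w =
    \sum_k (F (lpt k) - F z) * (lhat k z - lhat k w).
  under [RHS]eq_bigr do rewrite mulrBl.
  (* The weights sum to 1 at z and at w, so the constant F z can be subtracted. *)
  have H : \sum_k (lhat k z - lhat k w) = 0.
    by rewrite sumrB (lhat_sum zs) (lhat_sum ws) addrN.
  rewrite sumrB -mulr_sumr H mulr0 subr0.
  by under [RHS]eq_bigr do rewrite mulrBr; rewrite sumrB.
rewrite (le_trans (ler_norm_sum _ _ _))//.
pose B : R := L * (2 * eps) * (n%:R * (C / eps) * `|z - w|).
have B0 : 0 <= B by rewrite /B !(mulr_ge0, invr_ge0)// ltW.
rewrite (@le_trans _ _ (\sum_k (`|lpt k - z| <= 2 * eps)%R%:R * B))//.
  apply: ler_sum => k _; case: (leP `|lpt k - z|) => [kz|kz] /=.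
    rewrite mul1r normrM ler_pM//; last exact: lhat_lip.
    by rewrite (le_trans (FL _ _))// ?lpt_cube// ler_wpM2l.
  have -> : lhat k z = 0.
    apply/eqP/negPn/negP => /lhat_far H; move: kz; apply/negP; rewrite -leNgt.
    by rewrite (le_trans H)// ler_peMl ?(ltW eps0)// ler1n.
  have -> : lhat k w = 0.
    apply/eqP/negPn/negP => /lhat_far H; move: kz; apply/negP; rewrite -leNgt.
    rewrite -(subrKA w) (le_trans (ler_normD _ _))// mulr_natl mulr2n lerD//.
    by rewrite distrC.
  by rewrite subrr mulr0 normr0 mul0r.
rewrite -mulr_suml (le_trans (ler_wpM2r B0 (lpt_count _)))//.
rewrite le_eqVlt; apply/orP; left; apply/eqP; rewrite /B.
by field; rewrite gt_eqF.
Qed.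

Lemma Ck_lavg m' k (U : set 'rV[R]_m') (g : 'I_n -> 'rV[R]_m' -> R) : open U ->
  (forall i, Ck k U (g i)) -> Ck k U (fun y => lavg (\row_i g i y)).
Proof.
move=> oU Cg; apply: Ck_sum => // j; apply: (CkM oU (Ck_cst _ _ (F (lpt j)))).
apply: Ck_prod => // i.
rewrite (_ : (fun y => _) = (fun y => sstep (g i y * eps^-1 + (3 * s / eps - (j i)%:R + 1))
    + - sstep (g i y * eps^-1 + (3 * s / eps - (j i)%:R)))); last first.
  apply/funext => y; rewrite mxE /hat.
  have -> : (g i y + 3 * s) / eps - (j i)%:R =
      g i y * eps^-1 + (3 * s / eps - (j i)%:R) by rewrite mulrDl addrA.
  by rewrite -!addrA.
have A (a : R) : Ck k U (fun y => sstep (g i y * eps^-1 + a)).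
  apply: Ck_sstep => //; apply: (CkD oU _ (Ck_cst _ _ a)).
  exact: (CkM oU (Cg i) (Ck_cst _ _ eps^-1)).
apply: (CkD oU (A _)).
rewrite (_ : (fun y => _) = (fun y => (-1) * sstep (g i y * eps^-1 + (3 * s / eps - (j i)%:R)))).
  exact: (CkM oU (Ck_cst _ _ (-1)) (A _)).
by apply/funext => y; rewrite mulN1r.
Qed.

End averaged.
End scheme.

(** Smoothness in the form that is stable under changes of charts: [S] composed
with C^k coordinate functions, of any number of variables, is C^k.  It avoids a
chain rule for C^k maps between row vectors. *)
Definition smooth_of_coords n (S : 'rV[R]_n -> R) :=
  forall m k (U : set 'rV[R]_m) (g : 'I_n -> 'rV[R]_m -> R), open U ->
  (forall i, Ck k U (g i)) -> Ck k U (fun y => S (\row_i g i y)).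

(** The constant [C] depends on the dimension only; closeness [d] is obtained by
refining the mesh, at no cost on the slope.  The slope bound is local, at scale
[e], because the estimate of [lavg_lip] compares points within one mesh. *)
Lemma lattice_smoothing n : exists2 C : R, 0 <= C &
  forall (s L d : R) (F : 'rV[R]_n -> R), 0 < s -> 0 <= L -> 0 < d ->
  (forall z w : 'rV[R]_n, `|z| <= 3 * s -> `|w| <= 3 * s -> `|F z - F w| <= L * `|z - w|) ->
  (forall z : 'rV[R]_n, `|z| <= 3 * s -> 0 <= F z) ->
  exists S : 'rV[R]_n -> R, [/\ smooth_of_coords S, forall z, 0 <= S z,
    forall z : 'rV[R]_n, `|z| <= 3 * s -> `|S z - F z| <= d &
    exists2 e : R, 0 < e & forall z w : 'rV[R]_n, `|z| <= 3 * s -> `|w| <= 3 * s ->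
      `|z - w| <= e -> `|S z - S w| <= C * L * `|z - w|].
Proof.
have [C C0 HC] := hat_lip.
exists (5 ^+ n * 2 * n%:R * C); first by rewrite !mulr_ge0.
move=> s L d F s0 L0 d0 FL F0.
have [N /andP[N0 Nd]] : exists N, (0 < N)%N && (L * (s / N%:R) <= d).
  (* The mesh is at most d / L, without dividing by L, which may be zero. *)
  exists (Num.truncn (L * s / d)).+1; rewrite /= mulrA ler_pdivrMr//.
  rewrite (mulrC d) -ler_pdivrMr// ltW//.
  by have /andP[] := truncn_itv (divr_ge0 (mulr_ge0 L0 (ltW s0)) (ltW d0)).
exists (lavg s N F); split.
- by move=> m k U g oU Cg; exact: Ck_lavg.
- by move=> z; exact: lavg_ge0.
- by move=> z zs; apply: le_trans Nd; exact: lavg_close.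
- exists (s / N%:R); first by rewrite divr_gt0// ltr0n.
  by move=> z w zs ws zw; exact: lavg_lip.
Qed.

Definition tent (t : R) := sstep (2 - t) * sstep (2 + t).

Lemma tent01 t : 0 <= tent t <= 1.
Proof. by rewrite mulr_ge0 ?sstep_ge0//= mulr_ile1 ?sstep_ge0 ?sstep_le1. Qed.

Lemma tent_in t : `|t| <= 1 -> tent t = 1.
Proof. by rewrite ler_norml /tent => /andP[? ?]; rewrite !sstep1 ?mulr1//; lra. Qed.

Lemma tent_out t : 2 <= `|t| -> tent t = 0.
Proof.
rewrite ler_normr /tent => /orP[?|?].
  by rewrite (@sstep0 _ (2 - t)) ?mul0r//; lra.
by rewrite (@sstep0 _ (2 + t)) ?mulr0//; lra.
Qed.

Lemma tent_lip : exists2 C : R, 0 <= C & forall s t, `|tent s - tent t| <= C * `|s - t|.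
Proof.
have [C C0 HC] := @sstep_lip R; exists (2 * C); first by rewrite mulr_ge0.
move=> s t; rewrite /tent.
have -> : sstep (2 - s) * sstep (2 + s) - sstep (2 - t) * sstep (2 + t) =
  (sstep (2 - s) - sstep (2 - t)) * sstep (2 + s) + 
  (sstep (2 + s) - sstep (2 + t)) * sstep (2 - t).
  by move: (sstep (2 - s)) (sstep (2 + s)) (sstep _) (sstep _) => a b c e; ring.
rewrite (le_trans (ler_normD _ _))// -mulrA mulr_natl mulr2n lerD//;
  rewrite normrM (ger0_norm (sstep_ge0 _)) (le_trans (ler_piMr _ (sstep_le1 _)))//;
  rewrite (le_trans (HC _ _))//.
  by rewrite opprD addrACA subrr add0r opprK addrC distrC.
by rewrite opprD addrACA subrr add0r.
Qed.

(** A product over the coordinates, hence adapted to the cubes that are the balls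
of the sup norm on row vectors. *)
Definition cutoff n (s : R) (z : 'rV[R]_n) := \prod_i tent (z 0 i / s).

Lemma cutoff01 n s (z : 'rV[R]_n) : 0 <= cutoff s z <= 1.
Proof.
rewrite /cutoff prodr_ge0 /=; last by move=> i _; have /andP[] := tent01 (z 0 i / s).
by apply: prodr_ile1 => i _; exact: tent01.
Qed.

Lemma cutoff_in n s (z : 'rV[R]_n) : 0 < s -> `|z| <= s -> cutoff s z = 1.
Proof.
move=> s0 zs; rewrite /cutoff big1// => i _; apply: tent_in.
rewrite normrM normfV (gtr0_norm s0) ler_pdivrMr// mul1r.
exact: le_trans (ler_coord_norm _ _) zs.
Qed.

Lemma cutoff_out n s (z : 'rV[R]_n) : 0 < s -> 2 * s <= `|z| -> cutoff s z = 0.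
Proof.
move=> s0 zs; have [i iz] : exists i, 2 * s <= `|z 0 i|.
  apply: contrapT => /forallNP H.
  have : `|z| < 2 * s.
    by apply: rV_norm_lt => [|i]; [rewrite mulr_gt0|rewrite ltNge; exact/negP/H].
  by rewrite ltNge zs.
rewrite /cutoff (bigD1 i)//= tent_out ?mul0r//.
by rewrite normrM normfV (gtr0_norm s0) ler_pdivlMr.
Qed.

Lemma cutoff_lip n s : 0 < s -> exists2 C : R, 0 <= C &
  forall z w : 'rV[R]_n, `|cutoff s z - cutoff s w| <= C * `|z - w|.
Proof.
move=> s0; have [C C0 HC] := tent_lip.
exists (n%:R * (C / s)); first by rewrite mulr_ge0// divr_ge0// ltW.
move=> z w; rewrite (le_trans (prod_lip _ _ _))//.
1,2: by move=> i; exact: tent01.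
rewrite (@le_trans _ _ (\sum_(i < n) C / s * `|z - w|))//; last first.
  by rewrite sumr_const card_ord -[leRHS]mulrA mulr_natl.
apply: ler_sum => i _; rewrite (le_trans (HC _ _))// -mulrA ler_wpM2l//.
rewrite -mulrBl normrM normfV (gtr0_norm s0) mulrC ler_pM2l ?invr_gt0//.
by have := ler_coord_norm (z - w) i; rewrite !mxE.
Qed.

Lemma smooth_cutoff n s : smooth_of_coords (@cutoff n s).
Proof.
move=> m k U g oU Cg; apply: Ck_prod => // i.
rewrite (_ : (fun y => _) = (fun y => sstep (2 + g i y * - s^-1) * sstep (2 + g i y * s^-1))).
  have A (a : R) : Ck k U (fun y => sstep (2 + g i y * a)).
    apply: Ck_sstep => //; apply: (CkD oU (Ck_cst _ _ 2)).
    exact: (CkM oU (Cg i) (Ck_cst _ _ a)).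
  exact: (CkM oU (A _) (A _)).
by apply/funext => y; rewrite mxE /tent mulrN.
Qed.

End lattice.

(** * Quadratic forms *)

Section quadratic_forms.
Context {R : realType}.

Definition qform n (G : 'M[R]_n) (u : 'rV[R]_n) : R := (u *m G *m u^T) 0 0.

Lemma qformE n (G : 'M[R]_n) u : qform G u = \sum_i \sum_j u 0 i * G i j * u 0 j.
Proof.
rewrite /qform mxE exchange_big /=; apply: eq_bigr => j _.
by rewrite !mxE mulr_suml.
Qed.

Lemma qform1 n (u : 'rV[R]_n) : qform 1%:M u = \sum_i u 0 i ^+ 2.
Proof.
by rewrite /qform mulmx1 mxE; apply: eq_bigr => i _; rewrite mxE expr2.
Qed.

Lemma qform_congr n (P : 'M[R]_n) G u : qform (P *m G *m P^T) u = qform G (u *m P).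
Proof. by rewrite /qform trmx_mul !mulmxA. Qed.

Lemma qform_gram n (P : 'M[R]_n) u : qform (P *m P^T) u = qform 1%:M (u *m P).
Proof. by rewrite -qform_congr mulmx1. Qed.

Lemma qformD n (G H : 'M[R]_n) u : qform (G + H) u = qform G u + qform H u.
Proof. by rewrite /qform mulmxDr mulmxDl mxE. Qed.

(** Induction on the size, on the Schur complement of the upper left entry: it is
symmetric, and it is positive definite because its value at [u] is the value of
[G] at a suitable vector with lower part [u]. *)
Lemma cholesky n (G : 'M[R]_n) : G^T = G -> (forall u, u != 0 -> 0 < qform G u) ->
  exists2 P : 'M[R]_n, P \in unitmx & G = P *m P^T.
Proof.
suff H : forall G : 'M[R]_n, G^T = G -> (forall u, u != 0 -> 0 < qform G u) ->
    exists P : 'M[R]_n, G = P *m P^T.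
  move=> Gs Gp; have [P GP] := H _ Gs Gp; exists P => //.
  rewrite -row_free_unit -kermx_eq0; apply/eqP/row_matrixP => i; rewrite row0.
  apply/eqP/negPn/negP => /Gp.
  rewrite GP qform_gram.
  have -> : row i (kermx P) *m P = 0 by rewrite -row_mul mulmx_ker row0.
  by rewrite /qform !mul0mx mxE ltxx.
elim: n {G} => [|n IH] G Gs Gp; first by exists 0; apply/matrixP => -[].
pose G' : 'M[R]_(1 + n) := G.
pose a := G 0 0; pose b : 'rV[R]_n := @ursubmx R 1 n 1 n G'.
pose D : 'M[R]_n := @drsubmx R 1 n 1 n G'.
have a0 : 0 < a.
  have e0 : delta_mx 0 0 != 0 :> 'rV[R]_n.+1.
    by apply/negP => /eqP/rowP/(_ 0)/eqP; rewrite !mxE/= oner_eq0.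
  have := Gp _ e0; rewrite qformE (bigD1 0)//= (bigD1 0)//= big1; last first.
    by move=> j j0; rewrite !mxE (negbTE j0) mulr0.
  rewrite big1 ?addr0; first by rewrite !mxE/= mul1r mulr1.
  move=> i i0; rewrite big1// => j _.
  by rewrite !mxE (negbTE i0)/= !mul0r.
have GE : G' = block_mx a%:M b b^T D.
  rewrite -[LHS]submxK; congr block_mx.
    rewrite [LHS]mx11_scalar; congr (_%:M); rewrite !mxE.
    by rewrite /a /G'; congr (G _ _); apply: val_inj.
  by apply/matrixP => i j; rewrite /b /G' !mxE -[in LHS]Gs mxE.
have DS : D^T = D.
  by apply/matrixP => i j; rewrite /D /G' !mxE -[in LHS]Gs mxE.
pose S := D - a^-1 *: (b^T *m b).
have SS : S^T = S.
  by rewrite /S linearB/= linearZ/= trmx_mul trmxK DS.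
have Sp u : u != 0 -> 0 < qform S u.
  (* The first coordinate minimises the form of G given the lower part u. *)
  move=> u0; pose w : 'rV[R]_(1 + n) := row_mx (- (a^-1 *: (u *m b^T))) u.
  have w0 : (w : 'rV[R]_n.+1) != 0.
    apply: contra u0 => /eqP H; rewrite -(row_mxKr (- (a^-1 *: (u *m b^T))) u).
    by rewrite -/w H; apply/eqP/rowP => i; rewrite !mxE.
  suff -> : qform S u = qform G w by exact: Gp.
  rewrite -[qform G w]/((w *m G' *m w^T) 0 0) GE /w mul_row_block tr_row_mx mul_row_col.
  rewrite mul_mx_scalar scalerN scalerA divff ?gt_eqF// scale1r addNr mul0mx add0r.
  rewrite mulNmx -scalemxAl addrC /qform /S mulmxBr -scalemxAr.
  by rewrite mulmxA.
have [P SP] := IH _ SS Sp.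
pose sa := Num.sqrt a.
have sa0 : sa != 0 by rewrite sqrtr_eq0 -ltNge.
have saa : sa * sa = a by rewrite -expr2 sqr_sqrtr// ltW.
pose Q : 'M[R]_(1 + n) := block_mx sa%:M 0 (sa^-1 *: b^T) P.
suff QE : G' = Q *m Q^T by exists Q.
rewrite GE /Q tr_block_mx mulmx_block !tr_scalar_mx trmx0 !mulmx0 !mul0mx !addr0.
rewrite linearZ/= trmxK -SP; congr block_mx.
- by rewrite -scalar_mxM saa.
- by rewrite mul_scalar_mx scalerA divff// scale1r.
- by rewrite mul_mx_scalar scalerA divff// scale1r.
- rewrite -scalemxAl -scalemxAr scalerA -invfM saa /S; by rewrite addrC subrK.
Qed.

Lemma qform_bound n (D : 'M[R]_n) (u : 'rV[R]_n) (e : R) :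
  (forall i j, `|D i j| <= e) -> `|qform D u| <= n%:R * n%:R * e * `|u| ^+ 2.
Proof.
move=> De; rewrite qformE (le_trans (ler_norm_sum _ _ _))//.
rewrite (@le_trans _ _ (\sum_(i < n) \sum_(j < n) e * `|u| ^+ 2))//; last first.
  by rewrite !sumr_const !card_ord -mulrnA -[leLHS]mulr_natl natrM mulrA.
apply: ler_sum => i _; rewrite (le_trans (ler_norm_sum _ _ _))//.
apply: ler_sum => j _; rewrite !normrM mulrAC mulrC expr2.
by rewrite ler_pM// ler_pM// ler_coord_norm.
Qed.

Lemma qform1_lower n (z : 'rV[R]_n) : `|z| ^+ 2 <= qform 1%:M z.
Proof.
have q0 : 0 <= qform 1%:M z by rewrite qform1 sumr_ge0// => i _; exact: sqr_ge0.
rewrite -(sqr_sqrtr q0) lerXn2r ?nnegrE ?sqrtr_ge0//.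
apply: rV_norm_le => [|i]; first exact: sqrtr_ge0.
rewrite -sqrtr_sqr ler_wsqrtr// qform1 (bigD1 i)//= lerDl sumr_ge0// => j _.
exact: sqr_ge0.
Qed.

(** With [G y0 = P *m P^T], the form of [G y0] at [u] is the sum of the squares of
the coordinates of [u *m P], and the form of [G y] differs from it by a small
multiple of [|u *m P| ^ 2].  The comparison is with the sup norm, which costs
dimensional factors only. *)
Lemma metric_nbhd (T : topologicalType) n (G : T -> 'M[R]_n) (y0 : T) :
  (G y0)^T = G y0 -> (forall u, u != 0 -> 0 < qform (G y0) u) ->
  (forall i j, {for y0, continuous (fun y => G y i j)}) ->
  exists2 P : 'M[R]_n, P \in unitmx & \forall y \near y0, forall u : 'rV[R]_n,
    `|u *m P : 'rV[R]_n| <= 2 * Num.sqrt (qform (G y) u) /\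
    Num.sqrt (qform (G y) u) <= n.+1%:R * `|u *m P|.
Proof.
move=> Gs Gp Gc; have [P Pu GP] := cholesky Gs Gp; exists P => //.
(* A bound for |u| in terms of |u *m P|. *)
pose B := \sum_i \sum_j `|invmx P i j|.
have B0 : 0 <= B by apply: sumr_ge0 => i _; apply: sumr_ge0.
have uB (u : 'rV[R]_n) : `|u| <= B * `|u *m P|.
  have {1}-> : u = (u *m P) *m invmx P by rewrite mulmxK.
  set z := u *m P; apply: rV_norm_le => [|i]; first by rewrite mulr_ge0.
  rewrite mxE (le_trans (ler_norm_sum _ _ _))// /B mulr_suml; apply: ler_sum => k _.
  rewrite normrM mulrC ler_pM ?ler_coord_norm//.
  by rewrite (bigD1 i)//= lerDl sumr_ge0.
pose C := n%:R * n%:R * B ^+ 2 + 1.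
have C0 : 0 < C by rewrite ltr_wpDl// !mulr_ge0.
pose e := (2 * C)^-1.
have e0 : 0 < e by rewrite invr_gt0 mulr_gt0.
have Ge : \forall y \near y0, forall ij : 'I_n * 'I_n,
    `|G y ij.1 ij.2 - G y0 ij.1 ij.2| <= e.
  apply: (@filter_forall _ ('I_n * 'I_n)%type (fun ij y =>
     `|G y ij.1 ij.2 - G y0 ij.1 ij.2| <= e) (nbhs y0) (nbhs_filter y0)) => -[i j] /=.
  have /cvgrPdist_le/(_ _ e0) := Gc i j.
  by apply: filterS => y; rewrite distrC.
apply: filterS Ge => y Ge u.
set z := u *m P.
have qE : qform (G y) u = qform 1%:M z + qform (G y - G y0) u.
  by rewrite -qform_gram -GP -qformD addrC subrK.
have q2 : `|qform (G y - G y0) u| <= 2^-1 * `|z| ^+ 2.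
  have H : forall i j, `|(G y - G y0) i j| <= e.
    by move=> i j; rewrite !mxE; exact: (Ge (i, j)).
  rewrite (le_trans (qform_bound _ H))//.
  rewrite (@le_trans _ _ (n%:R * n%:R * e * (B * `|z|) ^+ 2))//.
    by rewrite ler_wpM2l ?mulr_ge0 ?(ltW e0)// lerXn2r ?nnegrE ?mulr_ge0.
  rewrite exprMn mulrA ler_wpM2r ?exprn_ge0// mulrAC /e invfM mulrCA.
  rewrite ler_piMr// ?invr_ge0// ler_pdivrMr// mul1r /C.
  by rewrite lerDl.
have q1 := qform1_lower z.
have q3 : qform 1%:M z <= n%:R * `|z| ^+ 2.
  rewrite qform1 (@le_trans _ _ (\sum_(i < n) `|z| ^+ 2))//; last first.
    by rewrite sumr_const card_ord mulr_natl.
  by apply: ler_sum => i _; rewrite -(real_normK (num_real (z 0 i))) lerXn2r ?nnegrE// ler_coord_norm.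
move: q2; rewrite ler_norml => /andP[q2 q4].
have z0 : 0 <= `|z| ^+ 2 by exact: exprn_ge0.
split.
  rewrite -[leLHS]ger0_norm// -sqrtr_sqr.
  have -> : 2 = Num.sqrt (2 ^+ 2) :> R by rewrite sqrtr_sqr ger0_norm.
  rewrite -sqrtrM ?exprn_ge0// ler_wsqrtr// qE.
  by rewrite -[2 ^+ 2]/(2 * 2); lra.
rewrite -[leRHS]ger0_norm ?mulr_ge0// -sqrtr_sqr ler_wsqrtr// qE exprMn.
have : (n%:R + 1) * `|z| ^+ 2 <= n.+1%:R ^+ 2 * `|z| ^+ 2.
  by rewrite ler_wpM2r// natr1 expr2 ler_peMl// ler1n.
by rewrite mulrDl; lra.
Qed.

End quadratic_forms.

(** * Charts, changes of coordinates and the speed of curves *)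

Section chart_facts.
Context {R : realType} {n : nat} {T : topologicalType}.
Implicit Types (c d : chart R n T).

Lemma cfun_img c x : cdom c x -> cimg c (cfun c x).
Proof. by exists x. Qed.

Lemma cinv_dom c y : cimg c y -> cdom c (cinv c y).
Proof. by move=> [x cx <-]; rewrite cfunK. Qed.

Lemma cinvK c y : cimg c y -> cfun c (cinv c y) = y.
Proof. by move=> [x cx <-]; rewrite cfunK. Qed.

Lemma near_dom c x : cdom c x -> \forall y \near x, cdom c y.
Proof. by move=> cx; apply: open_nbhs_nbhs; split => //; exact: cdom_open. Qed.

Lemma near_img c y : cimg c y -> \forall z \near y, cimg c z.
Proof. by move=> cy; apply: open_nbhs_nbhs; split => //; exact: cimg_open. Qed.

Lemma cfun_image_open c (O : set T) : open O -> open (cfun c @` (cdom c `&` O)).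
Proof.
move=> oO; rewrite openE => _ [x [cx Ox] <-].
have cy := cfun_img cx.
have cO : \forall z \near cfun c x, O (cinv c z).
  apply: (cinv_continuous cy); rewrite cfunK//.
  exact: open_nbhs_nbhs.
apply: filterS2 (near_img cy) cO => z cz Oz.
by exists (cinv c z); [split => //; exact: cinv_dom|exact: cinvK].
Qed.

Lemma transition_cfun c d x : cdom c x -> transition c d (cfun c x) = cfun d x.
Proof. by move=> cx; rewrite /transition /= cfunK. Qed.

Lemma overlap_open c d : open (overlap c d).
Proof. exact/cfun_image_open/cdom_open. Qed.

Lemma overlap_cfun c d x : cdom c x -> cdom d x -> overlap c d (cfun c x).
Proof. by move=> cx dx; exists x. Qed.

End chart_facts.

Lemma differentiable_rV (R : realType) (V : normedModType R) n (f : V -> 'rV[R]_n) x :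
  (forall j, differentiable (fun y => f y 0 j) x) -> differentiable f x.
Proof.
move=> df; have -> : f = \sum_j (fun y => f y 0 j *: delta_mx 0 j).
  by apply/funext => y; rewrite fct_sumE [LHS]row_sum_delta.
by apply: differentiable_sum => j; exact: differentiableZl.
Qed.

Lemma smooth_diff (R : realType) n (U : set 'rV[R]_n) f y : open U -> smooth U f -> U y ->
  differentiable f y /\ forall v, 'd f y v = \sum_i v 0 i * partial i f y.
Proof.
move=> oU sf Uy; apply: C1_diff => i; have [_ /(_ i)[di [ci _]]] := sf 1%N.
  by apply: filterS (open_nbhs_nbhs (conj oU Uy)); exact: di.
exact: ci.
Qed.

Section manifold.
Context {R : realType} {n : nat} (M : riemannian_manifold R n).
Implicit Types (c d : chart R n M) (gamma : R -> M).

Lemma transition_diff c d y : atlas c -> atlas d -> overlap c d y ->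
  differentiable (transition c d) y.
Proof.
move=> ac ad cdy; apply: differentiable_rV => j.
by have [] := smooth_diff (@overlap_open _ _ _ c d) (atlas_smooth ac ad j) cdy.
Qed.

Lemma qform_change c d x u : atlas c -> atlas d -> cdom c x -> cdom d x ->
  qform (rmetric c (cfun c x)) u =
  qform (rmetric d (cfun d x)) (u *m 'J (transition c d) (cfun c x)).
Proof.
move=> ac ad cx dx; rewrite (rmetric_compat ac ad (overlap_cfun cx dx)).
by rewrite qform_congr transition_cfun.
Qed.

Lemma qform_ge0 c x u : atlas c -> cdom c x -> 0 <= qform (rmetric c (cfun c x)) u.
Proof.
move=> ac cx; have [->|u0] := eqVneq u 0; first by rewrite /qform !mul0mx mxE.
exact/ltW/(rmetric_pos ac (cfun_img cx)).
Qed.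

(** Chain rule for the transition map.  Differentiability in one chart around the
point gives it in all others, so a single chart is enough to compute with. *)
Lemma velocity_change c d gamma (t : R) : atlas c -> atlas d ->
  {for t, continuous gamma} -> cdom c (gamma t) -> cdom d (gamma t) ->
  derivable (cfun c \o gamma) t 1 ->
  derivable (cfun d \o gamma) t 1 /\
  velocity gamma t d = velocity gamma t c *m 'J (transition c d) (cfun c (gamma t)).
Proof.
move=> ac ad cg ct dt dc.
have E : \forall s \near t, (transition c d \o (cfun c \o gamma)) s = (cfun d \o gamma) s.
  have : \forall s \near t, cdom c (gamma s) by apply: cg; exact: near_dom.
  by apply: filterS => s cs; rewrite /= transition_cfun.
have /derivable1_diffP dcd := dc.
have dT : differentiable (transition c d) ((cfun c \o gamma) t).
  exact: transition_diff (overlap_cfun ct dt).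
have dcomp := differentiable_comp dcd dT.
split; first by apply: near_eq_derivable E _; exact/derivable1_diffP.
rewrite /velocity !derive1E -(near_eq_derive (1 : R) E) -!derive1E.
rewrite (derive1E' dcomp) (diff_comp dcd dT) (derive1E' dcd).
by rewrite /jacobian mul_rV_lin1.
Qed.

Definition speed gamma (t : R) : R := tnorm (gamma t) (velocity gamma t).

Lemma chart_atP (x : M) : atlas (chart_at x) /\ cdom (chart_at x) x.
Proof. by rewrite /chart_at; case: cid2. Qed.

(** The norm of a tangent vector is defined with a chosen chart at each point; by
compatibility of the metric any chart computes the speed, in particular one
fixed chart along a piece of curve. *)
Lemma speedE c gamma (t : R) : atlas c -> {for t, continuous gamma} ->
  cdom c (gamma t) -> derivable (cfun c \o gamma) t 1 ->
  speed gamma t = Num.sqrt (qform (rmetric c (cfun c (gamma t))) (velocity gamma t c)).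
Proof.
move=> ac cg ct dc; have [ad dt] := chart_atP (gamma t).
rewrite /speed /tnorm /inner -/(qform _ _) (qform_change _ ac ad ct dt).
by have [_ <-] := velocity_change ac ad cg ct dt dc.
Qed.

Lemma near_continuous_sum (T : topologicalType) m (F : 'I_m -> T -> R) t :
  (forall i, {for t, continuous (F i)}) ->
  {for t, continuous (fun s => \sum_i F i s)}.
Proof.
move=> cF; elim: (index_enum _) => [|i r IH].
  rewrite (_ : (fun s => _) = cst 0); first exact: cst_continuous.
  by apply/funext => s; rewrite big_nil.
rewrite (_ : (fun s => _) = F i + (fun s => \sum_(j <- r) F j s)).
  exact: continuousD (cF i) IH.
by apply/funext => s; rewrite big_cons.
Qed.

Lemma continuous_qform (T : topologicalType) (G : T -> 'M[R]_n) (u : T -> 'rV[R]_n) t :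
  (forall i j, {for t, continuous (fun s => G s i j)}) ->
  (forall i, {for t, continuous (fun s => u s 0 i)}) ->
  {for t, continuous (fun s => qform (G s) (u s))}.
Proof.
move=> cG cu.
rewrite (_ : (fun s => _) = fun s => \sum_i \sum_j u s 0 i * G s i j * u s 0 j); last first.
  by apply/funext => s; rewrite qformE.
apply: near_continuous_sum => i; apply: near_continuous_sum => j.
by apply: continuousM; [apply: continuousM|]; [exact: cu|exact: cG|exact: cu].
Qed.

Lemma rmetric_continuous c y i j : atlas c -> cimg c y ->
  {for y, continuous (fun z => rmetric c z i j)}.
Proof. by move=> ac cy; have [+ _] := rmetric_smooth ac i j 0%N; exact. Qed.

Lemma speed_continuous gamma (I : set R) (t : R) : open I -> I t -> C1_curve I gamma ->
  {for t, continuous (speed gamma)}.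
Proof.
move=> oI It C1; pose c := chart_at (gamma t).
have [ac ct] := chart_atP (gamma t); rewrite -/c in ac ct.
have [cg /(_ c ac ct)[dc cv]] := C1 t It.
apply: (@near_continuous _ _ (fun s => Num.sqrt (qform (rmetric c (cfun c (gamma s)))
   (velocity gamma s c)))).
  have cd : \forall s \near t, cdom c (gamma s) by apply: cg; exact: near_dom.
  apply: filterS2 cd (open_nbhs_nbhs (conj oI It)) => s cs Is.
  by have [cgs /(_ c ac cs)[dcs _]] := C1 s Is; rewrite (speedE ac cgs cs dcs).
apply: continuous_comp; last exact: sqrt_continuous.
apply: continuous_qform => [i j|i].
  apply: (@continuous_comp _ _ _ (cfun c \o gamma) (fun z => rmetric c z i j)).
    by apply: continuous_comp; [exact: cg|exact: cfun_continuous].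
  exact: rmetric_continuous (cfun_img ct).
apply: (@continuous_comp _ _ _ (fun s => velocity gamma s c) (fun v : 'rV[R]_n => v 0 i)).
  exact: cv.
exact: coord_continuous.
Qed.

End manifold.

(** * Mean value inequalities on the line *)

Section real_lemmas.
Context {R : realType}.

(** The supremum of the points up to which [G] stays below [G a] is [b]. *)
Lemma locally_nonincreasing (G : R -> R) (a b : R) : a <= b ->
  (forall t, a <= t <= b -> \forall s \near t,
     (t <= s -> G s <= G t) /\ (s <= t -> G t <= G s)) ->
  G b <= G a.
Proof.
move=> ab Gt.
pose A := [set t | a <= t <= b /\ G t <= G a].
have Aa : A a by rewrite /A /= !lexx ab.
have supA : has_sup A.
  by split; [exists a|exists b => t [/andP[]]].
set c := sup A.
have ac : a <= c by apply: ub_le_sup => //; case: supA.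
have cb : c <= b by apply: ge_sup; [exists a|move=> t [/andP[]]].
have cab : a <= c <= b by rewrite ac.
have /nbhs_ballP[e /= e0 He] := Gt c cab.
have Ac : G c <= G a.
  have [t [/andP[at_ tb] tA] ct] := sup_adherent e0 supA.
  have tc : t <= c by apply: ub_le_sup => //; [case: supA|split => //; rewrite at_].
  have [|_ /(_ tc)] := He t; last by move=> H; exact: le_trans tA.
  by rewrite /ball /= ger0_norm ?subr_ge0// ltrBlDr -ltrBlDl.
have [<-//|cltb] := eqVneq c b.
have {}cltb : c < b by rewrite lt_neqAle cltb.
pose s := Num.min b (c + e / 2).
have cs : c < s by rewrite lt_min cltb ltrDl divr_gt0.
have [|/(_ (ltW cs)) Gs _] := He s.
  rewrite /ball /= distrC ger0_norm ?subr_ge0 ?(ltW cs)// ltrBlDl.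
  by rewrite (@le_lt_trans _ _ (c + e / 2)) ?ge_min ?lexx ?orbT// ltrD2l gtr_pMr// invf_lt1// ltr1n.
have : s <= c.
  apply: ub_le_sup; first by case: supA.
  split; last exact: le_trans Gs Ac.
  by rewrite (le_trans ac (ltW cs))/= ge_min lexx.
by rewrite leNgt cs.
Qed.

(** A mean value inequality in which the derivative of [F] bounds the slope of
[v], itself not assumed differentiable.  Apply [locally_nonincreasing] to
[v - K F - e t] for small [e]. *)
Lemma slope_le (v F f : R -> R) (K a b : R) : a <= b -> 0 <= K ->
  (forall t, a <= t <= b -> is_derive t 1 F (f t)) ->
  (forall t, a <= t <= b -> forall e, 0 < e -> \forall s \near t,
     `|v s - v t| <= (K * f t + e) * `|s - t|) ->
  v b - v a <= K * (F b - F a).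
Proof.
move=> ab K0 dF dv; apply/ler_addgt0Pr => e0 e0_gt0.
pose e := e0 / (b - a + 1).
have ba1 : 0 < b - a + 1 by rewrite ltr_wpDl// subr_ge0.
have e_gt0 : 0 < e by rewrite divr_gt0.
pose G t := v t - K * F t - e * t.
suff : G b <= G a.
  rewrite /G => H; have : e * (b - a) <= e0.
    by rewrite /e mulrAC ler_pdivrMr// ler_pM2l//; lra.
  by move: H; move: (v a) (v b) (F a) (F b) => va vb Fa Fb; lra.
apply: locally_nonincreasing => // t tab.
have e1 : 0 < e / (2 * (K + 1)) by rewrite divr_gt0// mulr_gt0// ltr_wpDl.
have e2 : 0 < e / 2 by rewrite divr_gt0.
have dFt : \forall s \near t, `|F s - F t - (s - t) * f t| <= e / (2 * (K + 1)) * `|s - t|.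
  have /is_derive1_caratheodory[g [gE gc gt]] := dF t tab.
  have /cvgrPdist_le/(_ _ e1) := gc; apply: filterS => s Hs.
  rewrite gE -gt mulrC -mulrBr normrM mulrC ler_wpM2r//.
  by rewrite distrC.
have := dv t tab _ e2; apply: filterS2 dFt => s.
have K1 : K * (e / (2 * (K + 1))) <= e / 2.
  rewrite mulrA ler_pdivrMr ?mulr_gt0 ?ltr_wpDl//.
  have -> : e / 2 * (2 * (K + 1)) = K * e + e by field.
  by rewrite lerDl ltW.
rewrite !ler_norml => /andP[F1 F2] /andP[v1 v2].
have F1K := ler_wpM2l K0 F1; have F2K := ler_wpM2l K0 F2.
rewrite /G.
move: v1 v2 F1K F2K; move: (v s) (v t) (F s) (F t) (f t) => vs vt Fs Ft ft v1 v2 F1K F2K.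
split=> st.
  rewrite ger0_norm ?subr_ge0// in v1 v2 F1K F2K.
  have K2 := ler_wpM2r (_ : 0 <= s - t) K1; rewrite subr_ge0 in K2.
  by have := K2 st; nra.
rewrite ler0_norm ?subr_le0// in v1 v2 F1K F2K.
have K2 := ler_wpM2r (_ : 0 <= t - s) K1; rewrite subr_ge0 in K2.
by have := K2 st; nra.
Qed.

Lemma affine_derive (V : normedModType R) (g : R -> V) (al be t : R) :
  derivable g (al * t + be) 1 ->
  is_derive t 1 (fun s => g (al * s + be)) (al *: derive1 g (al * t + be)).
Proof.
move=> dg; pose h (s : R) := al * s + be.
have dh : is_derive t 1 h al.
  rewrite (_ : h = (al *: id) + cst be)//.
  have H := is_deriveD (is_deriveZ al (is_derive_id t (1 : R))) (is_derive_cst be t (1 : R)).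
  by apply: (is_derive_eq H); rewrite addr0 [_ *: _]mulr1.
have [/derivable1_diffP dfh hE] := dh.
have /derivable1_diffP dfg : derivable g (h t) 1 by [].
have dc := differentiable_comp dfh dfg.
apply: DeriveDef; first exact/derivable1_diffP.
rewrite -derive1E (derive1E' dc) (diff_comp dfh dfg) /= -(derive1E' dfh) derive1E hE.
by rewrite (derive1E' dfg) -linearZ /= [_ *: 1]mulr1.
Qed.

End real_lemmas.

(** * Length of piecewise C^1 curves and the geodesic distance *)

Section curves.
Context {R : realType} {n : nat} (M : riemannian_manifold R n).
Implicit Types (c d : chart R n M) (gamma delta : R -> M).
Notation mu := (@lebesgue_measure R).
Notation mspeed A g := (measurable_fun A (EFin \o speed g)).

Definition piece gamma (a b : R) := exists2 e : R, 0 < e & exists2 delta : R -> M,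
  C1_curve `]a - e, b + e[ delta & {in `[a, b], gamma =1 delta}.

(** The curve [gamma] is piecewise C^1 on [[a, b]] and has length [l].  An
inductive description is easier to cut, reverse and concatenate than a
partition, and measuring a piece by an antiderivative [F] of the speed keeps
integrals out of these operations; [pcarc_integral] relates [l] to the
integral. *)
Inductive pcarc gamma : R -> R -> R -> Prop :=
| pcarc_piece a b e delta F : a < b -> 0 < e -> C1_curve `]a - e, b + e[ delta ->
    {in `[a, b], gamma =1 delta} ->
    (forall t, a - e < t < b + e -> is_derive t 1 F (speed delta t)) ->
    pcarc gamma a b (F b - F a)
| pcarc_cat a (c : R) b l1 l2 : pcarc gamma a c l1 -> pcarc gamma c b l2 ->
    pcarc gamma a b (l1 + l2).

Lemma pcarc_lt gamma a b l : pcarc gamma a b l -> a < b.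
Proof. by elim=> // ? ? ? ? ? _ ac _; exact: lt_trans. Qed.

Lemma speed_ge0 gamma t : 0 <= speed gamma t.
Proof. exact: sqrtr_ge0. Qed.

Lemma pcarc_ge0 gamma a b l : pcarc gamma a b l -> 0 <= l.
Proof.
elim=> [{}a {}b e delta F ab e0 _ _ dF|*]; last exact: addr_ge0.
rewrite -[F b - F a]mul1r -[leLHS](subrr (0 : R)).
apply: (@slope_le _ (fun=> 0) F (speed delta) 1 a b (ltW ab) ler01) => t /andP[at_ tb].
  by apply: dF; apply/andP; split; lra.
move=> e1 e10; near=> s; rewrite subrr normr0 mulr_ge0// mul1r.
by rewrite addr_ge0 ?speed_ge0// ltW.
Unshelve. all: by end_near. Qed.

Lemma pcarc_ext gamma gamma' a b l : {in `[a, b], gamma =1 gamma'} ->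
  pcarc gamma a b l -> pcarc gamma' a b l.
Proof.
move=> gg' g; elim: g gg' => [{}a {}b e delta F ab e0 C1 gd dF gg'|].
  by apply: (pcarc_piece ab e0 C1 _ dF) => t tab; rewrite -gg'// gd.
move=> {}a c {}b l1 l2 g1 IH1 g2 IH2 gg'.
have ac := pcarc_lt g1; have cb := pcarc_lt g2.
apply: (@pcarc_cat _ a c b); [apply: IH1|apply: IH2] => t; rewrite in_itv /= => /andP[t1 t2];
  apply: gg'; rewrite in_itv /=; apply/andP; split=> //.
- exact: le_trans t2 (ltW cb).
- exact: le_trans (ltW ac) t1.
Qed.

Lemma speed_near gamma delta (t : R) : (\forall s \near t, gamma s = delta s) ->
  speed gamma t = speed delta t.
Proof.
move=> gd; rewrite /speed (nbhs_singleton gd) /tnorm /inner.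
have -> // : velocity gamma t = velocity delta t.
apply/funext => c; rewrite /velocity !derive1E; apply: near_eq_derive.
by apply: filterS gd => s /= ->.
Qed.

Lemma itv_oo_near (a b t : R) : a < t < b -> \forall s \near t, a < s < b.
Proof.
move=> tab; have : open_nbhs t `]a, b[ by split; [exact: interval_open|rewrite /= in_itv].
by move/open_nbhs_nbhs; apply: filterS => s /=; rewrite in_itv.
Qed.

Lemma speed_itv_continuous (a b : R) delta t : C1_curve `]a, b[ delta -> a < t < b ->
  {for t, continuous (speed delta)}.
Proof.
move=> C1 tab; apply: speed_continuous C1; first exact: interval_open.
by rewrite /= in_itv.
Qed.

Lemma pcarc_integral gamma a b l : pcarc gamma a b l ->
  mspeed (`[a, b]%classic) gamma /\
  (\int[mu]_(t in `[a, b]) (speed gamma t)%:E = l%:E)%E.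
Proof.
elim=> [{}a {}b e delta F ab e0 C1 gd dF|{}a c {}b l1 l2 g1 [m1 I1] g2 [m2 I2]].
  have gs t : t \in `]a, b[ -> speed gamma t = speed delta t.
    rewrite in_itv /= => tab; apply: speed_near.
    apply: filterS (itv_oo_near tab) => s /andP[/ltW sa /ltW sb].
    by apply: gd; rewrite in_itv /= sa.
  have inn t : a <= t <= b -> a - e < t < b + e.
    by move=> /andP[? ?]; apply/andP; split; lra.
  have cd : {within `[a, b], continuous (speed delta)}.
    apply: continuous_in_subspaceT => t; rewrite inE /= in_itv /= => /inn.
    exact: speed_itv_continuous.
  have id : mu.-integrable `[a, b] (EFin \o speed delta).
    by apply: continuous_compact_integrable => //; exact: segment_compact.
  have md := measurable_int mu id.
  have mdo : mspeed (`]a, b[%classic) delta.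
    by apply: measurable_funS md => //; exact: subset_itv_oo_cc.
  have mg : mspeed (`]a, b[%classic) gamma.
    have E : {in `]a, b[%classic, EFin \o speed delta =1 EFin \o speed gamma}.
      by move=> t; rewrite inE => tab; rewrite /= gs.
    exact: (eq_measurable_fun _ E mdo).
  split; first exact: emeasurable_fun_itv_cc mg.
  rewrite (integral_itv_bndoo true false mg).
  have <- : (\int[mu]_(t in `]a, b[) (speed delta t)%:E =
    \int[mu]_(t in `]a, b[) (speed gamma t)%:E)%E.
    by apply: eq_integral => t; rewrite inE => tab; rewrite gs.
  have cF t : a <= t <= b -> {for t, continuous F}.
    by move=> /inn/dF[/derivable1_diffP/differentiable_continuous].
  have FTC : (\int[mu]_(t in `[a, b]) (speed delta t)%:E = (F b)%:E - (F a)%:E)%E.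
    apply: continuous_FTC2 => //.
      split=> [t||].
      + rewrite in_itv /= => /andP[/ltW ta /ltW tb].
        by have [] := dF t (inn t _); rewrite ?ta.
      + by apply: cvg_at_right_filter; apply: cF; rewrite lexx ltW.
      + by apply: cvg_at_left_filter; apply: cF; rewrite lexx ltW.
    move=> t; rewrite in_itv /= => /andP[/ltW ta /ltW tb].
    by have [|_ <-] := dF t (inn t _); [rewrite ta|rewrite derive1E].
  by rewrite EFinB -FTC; exact/esym/(integral_itv_bndoo true false mdo).
have ac := pcarc_lt g1; have cb := pcarc_lt g2.
have U : (`[a, b] = `[a, c] `|` `]c, b])%classic.
  by rewrite -itv_bndbnd_setU ?bnd_simp ?ltW.
have m2' : mspeed (`]c, b]%classic) gamma.
  by apply: measurable_funS m2 => //; exact: subset_itv_oc_cc.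
have mU : mspeed (`[a, c]%classic `|` `]c, b]%classic) gamma.
  by apply/measurable_funU => //; split.
rewrite U; split=> //.
rewrite ge0_integral_setU//=.
- rewrite I1 (_ : integral _ _ _ = l2%:E) ?EFinD// -I2.
  exact: (integral_itv_obnd_cbnd m2').
- by move=> t _; rewrite lee_fin speed_ge0.
- apply/disj_setPS => t /= []; rewrite !in_itv /= => /andP[_ tc] /andP[ct _].
  by move: (lt_le_trans ct tc); rewrite ltxx.
Qed.

(** The speed is continuous, so its integral is an antiderivative; it is taken
from [a - e/2], as the derivative is wanted on both sides of [a]. *)
Lemma piece_arc gamma a b : a < b -> piece gamma a b -> exists l, pcarc gamma a b l.
Proof.
move=> ab [e e0 [delta C1 gd]].
pose a' := a - e / 2; pose b' := b + e / 2.
have e2 : e / 2 < e by rewrite gtr_pMr// invf_lt1// ltr1n.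
have e20 : 0 < e / 2 by rewrite divr_gt0.
pose F x := (\int[mu]_(t in `[a', x]) speed delta t)%R.
have cont t : a' <= t <= b' -> {for t, continuous (speed delta)}.
  move=> /andP[t1 t2]; apply: (speed_itv_continuous C1).
  by rewrite /a' /b' in t1 t2; apply/andP; split; lra.
have ia : mu.-integrable `[a', b'] (EFin \o speed delta).
  apply: continuous_compact_integrable; first exact: segment_compact.
  by apply: continuous_in_subspaceT => t; rewrite inE /= in_itv /= => /cont.
exists (F b - F a); apply: (@pcarc_piece _ _ _ (e / 2) delta F ab e20 _ gd).
  move=> t /=; rewrite in_itv /= => /andP[t1 t2]; apply: C1; rewrite /= in_itv /=.
  by apply/andP; split; lra.
move=> t /andP[t1 t2].
have [|dF FE] := @continuous_FTC1_closed _ (speed delta) a' t b' t2 ia t1.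
  by apply: cont; rewrite /a' /b' (ltW t1) (ltW t2).
by split; [exact: dF|rewrite -derive1E; exact: FE].
Qed.

Fixpoint pieces gamma a (s : seq R) : Prop :=
  if s is x :: s' then piece gamma a x /\ pieces gamma x s' else True.

Lemma pieces_nth gamma a s : pieces gamma a s <->
  forall i, (i < size s)%N -> piece gamma (nth 1 (a :: s) i) (nth 1 (a :: s) i.+1).
Proof.
elim: s a => [|x s IH] a /=; first by split.
rewrite IH; split=> [[ax H] [|i]//|H].
  by rewrite ltnS => /H.
by split=> [|i si]; [exact: (H 0%N)|exact: (H i.+1)].
Qed.

Lemma pieces_arc gamma a s : path <%R a s -> s != [::] -> pieces gamma a s ->
  exists l, pcarc gamma a (last a s) l.
Proof.
elim: s a => // x [|y s] IH a /= /andP[ax xs] _ [pax H].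
  exact: piece_arc.
have [l1 A1] := piece_arc ax pax.
have [l2 A2] := IH x xs isT H.
by exists (l1 + l2); exact: pcarc_cat A1 A2.
Qed.

Lemma pieces_cat gamma a s1 s2 : pieces gamma a s1 -> pieces gamma (last a s1) s2 ->
  pieces gamma a (s1 ++ s2).
Proof. by elim: s1 a => //= x s IH a [? ?] ?; split => //; exact: IH. Qed.

Lemma pcarc_pieces gamma a b l : pcarc gamma a b l ->
  exists2 s, itv_partition a b s & pieces gamma a s.
Proof.
elim=> [{}a {}b e delta F ab e0 C1 gd _|{}a c {}b l1 l2 _ [s1 p1 H1] _ [s2 p2 H2]].
  by exists [:: b]; [exact: itv_partition1|split=> //; exists e => //; exists delta].
exists (s1 ++ s2); first exact: itv_partition_cat p1 p2.
by apply: pieces_cat => //; case: p1 => _ /eqP ->.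
Qed.

Lemma piecewise_C1_arc gamma : piecewise_C1 gamma ->
  exists2 l, pcarc gamma 0 1 l & curve_length gamma = l%:E.
Proof.
move=> [s [ps /eqP ls] H].
have s0 : s != [::] by apply/eqP => s0; move: ls; rewrite s0 /= => /eqP; rewrite eq_sym oner_eq0.
have [l A] := pieces_arc ps s0 ((pieces_nth gamma 0 s).2 H).
rewrite ls in A; exists l => //.
by have [_] := pcarc_integral A.
Qed.

Lemma pcarc_piecewise_C1 gamma l : pcarc gamma 0 1 l ->
  piecewise_C1 gamma /\ curve_length gamma = l%:E.
Proof.
move=> A; split; last by have [_] := pcarc_integral A.
have [s ps H] := pcarc_pieces A; exists s => //.
exact/pieces_nth.
Qed.

Lemma affine_C1 (I J : set R) delta (al be : R) :
  open J -> (forall t, J t -> I (al * t + be)) ->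
  C1_curve I delta -> C1_curve J (fun t => delta (al * t + be)) /\
  forall t, J t -> speed (fun t => delta (al * t + be)) t =
     `|al| * speed delta (al * t + be).
Proof.
move=> oJ JI C1; pose h (t : R) := al * t + be.
have ch : continuous h.
  by move=> t; apply: continuousD; [apply: continuousM; [exact: cst_continuous|exact: cvg_id]|exact: cst_continuous].
have vE t c : J t -> atlas c -> cdom c (delta (h t)) ->
    derivable (cfun c \o (delta \o h)) t 1 /\
    velocity (delta \o h) t c = al *: velocity delta (h t) c.
  move=> Jt ac ct; have [_ /(_ c ac ct)[dc _]] := C1 _ (JI _ Jt).
  have [d1 d2] := affine_derive dc.
  by split; [exact: d1|rewrite /velocity derive1E; exact: d2].
have cdh t : J t -> {for t, continuous (delta \o h)}.
  move=> Jt; have [cd _] := C1 _ (JI _ Jt).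
  by apply: continuous_comp => //; exact: ch.
split=> [t Jt|t Jt].
  split; first exact: cdh.
  move=> c ac ct; have [dc _] := vE t c Jt ac ct; split; first exact: dc.
  have [_ /(_ c ac ct)[_ cv]] := C1 _ (JI _ Jt).
  apply: (@near_continuous _ _ (fun s => al *: velocity delta (h s) c)).
    have nc : \forall s \near t, cdom c (delta (h s)) by apply: (cdh t Jt); exact: near_dom.
    apply: filterS2 nc (open_nbhs_nbhs (conj oJ Jt)) => s cs Js.
    by have [_ ->] := vE s c Js ac cs.
  apply: continuousZr.
  by apply: (@continuous_comp _ _ _ h (fun s => velocity delta s c)) => //; exact: ch.
have [ac ct] := chart_atP (delta (h t)).
rewrite /speed /tnorm /inner.
have [_ ->] := vE t _ Jt ac ct.
rewrite -sqrtr_sqr -sqrtrM ?sqr_ge0//; congr Num.sqrt.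
by rewrite linearZ/= -!scalemxAl -scalemxAr scalerA [LHS]mxE expr2.
Qed.

Lemma pcarc_affine gamma a b l (al be : R) : 0 < al -> pcarc gamma a b l ->
  pcarc (fun t => gamma (al * t + be)) ((a - be) / al) ((b - be) / al) l.
Proof.
move=> al0; have aln0 : al != 0 by rewrite gt_eqF.
have hK (x : R) : al * ((x - be) / al) + be = x by field.
elim=> [{}a {}b e delta F ab e0 C1 gd dF|? c ? ? ? _ A1 _ A2]; last first.
  exact: (pcarc_cat A1 A2).
pose J := `](a - be) / al - e / al, (b - be) / al + e / al[%classic.
have JI t : J t -> `]a - e, b + e[%classic (al * t + be).
  rewrite /J /= !in_itv /= -mulrBl -mulrDl ltr_pdivrMr// ltr_pdivlMr// => /andP[? ?].
  by apply/andP; split; lra.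
have oJ : open J by exact: interval_open.
have [C1' sE] := affine_C1 oJ JI C1.
have -> : F b - F a = (fun t => F (al * t + be)) ((b - be) / al) -
   (fun t => F (al * t + be)) ((a - be) / al) by rewrite !hK.
have ab' : (a - be) / al < (b - be) / al by rewrite ltr_pM2r ?invr_gt0// ltrD2r.
have e0' : 0 < e / al by rewrite divr_gt0.
apply: (@pcarc_piece _ _ _ _ _ (fun t => F (al * t + be)) ab' e0' C1').
  move=> t; rewrite in_itv /= ler_pdivrMr// ler_pdivlMr// => /andP[? ?].
  by apply: gd; rewrite in_itv /=; apply/andP; split; lra.
move=> t Jt; have Jt' : J t by rewrite /J /= in_itv.
rewrite (sE t Jt') gtr0_norm//.
have [d1 d2] := dF _ (JI t Jt').
have [d3 d4] := affine_derive d1.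
by split; [exact: d3|rewrite d4 derive1E d2].
Qed.

Lemma pcarc_rev gamma a b l : pcarc gamma a b l -> pcarc (fun t => gamma (- t)) (- b) (- a) l.
Proof.
elim=> [{}a {}b e delta F ab e0 C1 gd dF|]; last first.
  by move=> ? c ? ? ? _ A1 _ A2; rewrite addrC; exact: (pcarc_cat A2 A1).
pose J := `](- b) - e, (- a) + e[%classic.
have JI t : J t -> `]a - e, b + e[%classic (-1 * t + 0).
  rewrite /J /= !in_itv /= => /andP[? ?].
  by apply/andP; split; lra.
have oJ : open J by exact: interval_open.
have [C1' sE] := affine_C1 oJ JI C1.
have -> : F b - F a = (fun t => - F (-1 * t + 0)) (- a) -
   (fun t => - F (-1 * t + 0)) (- b) by rewrite /= !mulN1r !addr0 !opprK addrC.
have ab' : - b < - a by rewrite ltrN2.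
have gd' : {in `[- b, - a], (fun t => gamma (- t)) =1 (fun t => delta (-1 * t + 0))}.
  move=> t; rewrite in_itv /= => /andP[? ?].
  by rewrite mulN1r addr0; apply: gd; rewrite in_itv /=; apply/andP; split; lra.
apply: (@pcarc_piece _ _ _ _ _ (fun t => - F (-1 * t + 0)) ab' e0 C1' gd') => t Jt.
have Jt' : J t by rewrite /J /= in_itv.
rewrite (sE t Jt') normrN1 mul1r.
have [d1 d2] := dF _ (JI t Jt').
have [d3 d4] := affine_derive d1.
have H := is_deriveN (DeriveDef d3 d4); apply: (is_derive_eq H).
by rewrite derive1E d2 -scalerN scaleN1r opprK.
Qed.

Lemma dist_arc gamma a b l : pcarc gamma a b l ->
  (geodesic_dist (gamma a) (gamma b) <= l%:E)%E.
Proof.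
move=> A; have ab := pcarc_lt A; have ba : 0 < b - a by rewrite subr_gt0.
have := pcarc_affine a ba A; rewrite subrr mul0r divff ?gt_eqF// => A'.
have [pc lE] := pcarc_piecewise_C1 A'.
apply: ereal_inf_lbound; exists (fun t => gamma ((b - a) * t + a)) => //.
by split => //; rewrite ?mulr0 ?add0r// mulr1 subrK.
Qed.

(** The infimum is only ever used through strict upper bounds, realised by actual
arcs. *)
Lemma dist_ltP (x y : M) (r : R) : (geodesic_dist x y < r%:E)%E <->
  exists gamma l, [/\ pcarc gamma 0 1 l, gamma 0 = x, gamma 1 = y & l < r].
Proof.
split=> [/ereal_inf_lt[_ [gamma [pc g0 g1] <-]]|[gamma [l [A <- <- lr]]]]; last first.
  by apply: le_lt_trans (dist_arc A) _; rewrite lte_fin.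
have [l A ->] := piecewise_C1_arc pc; rewrite lte_fin => lr.
by exists gamma, l.
Qed.

Lemma dist_ge0 (x y : M) : (0 <= geodesic_dist x y)%E.
Proof.
apply: le_ereal_inf_tmp => _ [gamma [pc _ _] <-].
by have [l A ->] := piecewise_C1_arc pc; rewrite lee_fin (pcarc_ge0 A).
Qed.

Lemma dist_sym_lt (x y : M) (r : R) : (geodesic_dist x y < r%:E)%E ->
  (geodesic_dist y x < r%:E)%E.
Proof.
move=> /dist_ltP[gamma [l [A <- <- lr]]].
apply: le_lt_trans (_ : l%:E < r%:E)%E; last by rewrite lte_fin.
have := dist_arc (pcarc_rev A).
by rewrite !opprK.
Qed.

(** Concatenate the two arcs on [[0, 2]]. *)
Lemma dist_triangle_lt (x y z : M) (r1 r2 : R) : (geodesic_dist x y < r1%:E)%E ->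
  (geodesic_dist y z < r2%:E)%E -> (geodesic_dist x z < (r1 + r2)%:E)%E.
Proof.
move=> /dist_ltP[g1 [l1 [A1 <- g1y lr1]]] /dist_ltP[g2 [l2 [A2 g2y <- lr2]]].
pose g t := if t <= 1 then g1 t else g2 (t - 1).
have B1 : pcarc g 0 1 l1.
  by apply: pcarc_ext A1 => t; rewrite in_itv /= /g => /andP[_ ->].
have B2 : pcarc g 1 2 l2.
  have := pcarc_affine (-1) ltr01 A2; rewrite !divr1 sub0r opprK => A2'.
  apply: pcarc_ext A2' => t; rewrite in_itv /= /g mul1r => /andP[t1 _].
  case: ifP => // t2; have -> : t = 1 by apply/eqP; rewrite eq_le t1 t2.
  by rewrite subrr g1y g2y.
have := dist_arc (pcarc_cat B1 B2).
rewrite /g ler01 ifF; last by apply/negbTE; rewrite -ltNge ltr1n.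
rewrite (_ : 2 - 1 = 1 :> R); last by ring.
by move=> H; apply: le_lt_trans H _; rewrite lte_fin ltrD.
Qed.

(** Intermediate value theorem for the length along the arc, piece by piece.  Only
the distances are recorded: this is the convexity of the metric used in the
Hopf-Rinow theorem. *)
Lemma pcarc_split gamma a b l (v : R) : pcarc gamma a b l -> 0 < v < l ->
  exists c : R, (geodesic_dist (gamma a) (gamma c) <= v%:E)%E /\
            (geodesic_dist (gamma c) (gamma b) <= (l - v)%:E)%E.
Proof.
move=> A; elim: A v => [{}a {}b e delta F ab e0 C1 gd dF v /andP[v0 vl]|].
  have cF : {within `[a, b], continuous F}.
    apply: derivable_within_continuous => t; rewrite in_itv /= => /andP[? ?].
    by have [] := dF t; [apply/andP; split; lra|].
  have [|c] := IVT (ltW ab) cF (_ : _ <= F a + v <= _).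
    have Fab : F a < F b by lra.
    rewrite /Num.min /Num.max Fab; apply/andP; split; lra.
  rewrite in_itv /= => /andP[ac cb] Fc.
  have {}ac : a < c.
    by rewrite lt_neqAle ac andbT; apply/eqP => acE; move: Fc; rewrite -acE; lra.
  have {}cb : c < b.
    by rewrite lt_neqAle cb andbT; apply/eqP => acE; move: Fc; rewrite acE; lra.
  exists c; split.
    have -> : v = F c - F a by lra.
    apply: dist_arc; apply: (pcarc_piece ac e0 (delta := delta)).
    + move=> t; rewrite /= in_itv /= => /andP[? ?]; apply: C1; rewrite /= in_itv /=.
      by apply/andP; split; lra.
    + move=> t; rewrite /= in_itv /= => /andP[? ?]; apply: gd; rewrite in_itv /=.
      by apply/andP; split; lra.
    + by move=> t /andP[? ?]; apply: dF; apply/andP; split; lra.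
  have -> : F b - F a - v = F b - F c by lra.
  apply: dist_arc; apply: (pcarc_piece cb e0 (delta := delta)).
  + move=> t; rewrite /= in_itv /= => /andP[? ?]; apply: C1; rewrite /= in_itv /=.
    by apply/andP; split; lra.
  + move=> t; rewrite /= in_itv /= => /andP[? ?]; apply: gd; rewrite in_itv /=.
    by apply/andP; split; lra.
  + by move=> t /andP[? ?]; apply: dF; apply/andP; split; lra.
move=> {}a c {}b l1 l2 A1 IH1 A2 IH2 v /andP[v0 vl].
have D1 := dist_arc A1; have D2 := dist_arc A2.
have tri (x y z : M) (r1 r2 : R) : (geodesic_dist x y <= r1%:E)%E ->
    (geodesic_dist y z <= r2%:E)%E -> (geodesic_dist x z <= (r1 + r2)%:E)%E.
  move=> H1 H2; apply/lee_addgt0Pr => e e0.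
  have e2 : 0 < e / 2 by rewrite divr_gt0.
  rewrite -EFinD (_ : r1 + r2 + e = (r1 + e / 2) + (r2 + e / 2)); last by field.
  apply/ltW/(@dist_triangle_lt _ y).
    by apply: le_lt_trans H1 _; rewrite lte_fin ltrDl.
  by apply: le_lt_trans H2 _; rewrite lte_fin ltrDl.
have [v1|v1|v1] := ltgtP v l1.
- have [|t [H1 H2]] := IH1 v; first by rewrite v0.
  exists t; split=> //; have -> : l1 + l2 - v = (l1 - v) + l2 by ring.
  exact: tri H2 D2.
- have [|t [H1 H2]] := IH2 (v - l1); first by rewrite subr_gt0 v1 /=; lra.
  exists t; split.
    have -> : v = l1 + (v - l1) by ring.
    exact: tri D1 H1.
  by have -> : l1 + l2 - v = l2 - (v - l1) by ring.
- exists c; rewrite v1; split => //.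
  by have -> : l1 + l2 - l1 = l2 by ring.
Qed.

End curves.

(** * Lipschitz functions along curves; normalised coordinates *)

Section lipschitz_along_curves.
Context {R : realType} {n : nat} (M : riemannian_manifold R n).

Lemma derivable_norm_le (g : R -> 'rV[R]_n) (t : R) : derivable g t 1 ->
  forall e : R, 0 < e -> \forall s \near t,
    `|g s - g t| <= (`|derive1 g t| + e) * `|s - t|.
Proof.
move=> dg e e0; rewrite derive1E.
have /cvgrPdist_le/(_ e e0) := dg.
rewrite near_withinE => /nbhs_ballP[d /= d0 Hd].
apply/nbhs_ballP; exists d => //= s ts.
have [->|st] := eqVneq s t; first by rewrite !subrr !normr0 mulr0.
have st0 : s - t != 0 by rewrite subr_eq0.
have := Hd (s - t); rewrite /ball /= sub0r normrN distrC => /(_ ts st0).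
rewrite /= [(s - t)%:A]mulr1 subrK => H.
have -> : g s - g t = (s - t) *: ((s - t)^-1 *: (g s - g t)).
  by rewrite scalerA divff// scale1r.
rewrite normrZ [leLHS]mulrC (distrC t) ler_wpM2r//.
rewrite -[X in `|X| <= _](subrK ('D_1 g t)) (le_trans (ler_normD _ _))// addrC lerD2l.
by rewrite distrC.
Qed.

(** The local form of [K]-Lipschitz continuity along curves.  The error [e] absorbs
the remainder in the definition of the derivative of the curve. *)
Definition slope_along (u : M -> R) (K : R) := forall (I : set R) (delta : R -> M) (t : R),
  open I -> I t -> C1_curve I delta -> forall e : R, 0 < e ->
  \forall s \near t, `|u (delta s) - u (delta t)| <= (K * speed delta t + e) * `|s - t|.

(** Along each piece the slope of [u] is at most [K] times the derivative of the
length, so [slope_le] bounds the variation of [u] by [K] times the length. *)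
Lemma slope_along_lip u K : 0 <= K -> slope_along u K ->
  forall (x y : M) (r : R), (geodesic_dist x y < r%:E)%E -> `|u y - u x| <= K * r.
Proof.
move=> K0 uK x y r /dist_ltP[gamma [l [A <- <- lr]]].
apply: le_trans (_ : K * l <= _); last by rewrite ler_wpM2l// ltW.
elim: A => [a b e delta F ab e0 C1 gd dF|a c b l1 l2 _ IH1 _ IH2]; last first.
  by rewrite -(subrKA (u (gamma c))) addrC (le_trans (ler_normD _ _))// mulrDr lerD// addrC.
have oI : open `]a - e, b + e[%classic by exact: interval_open.
have inn t : a <= t <= b -> `]a - e, b + e[%classic t.
  by move=> /andP[? ?]; rewrite /= in_itv /=; apply/andP; split; lra.
rewrite !gd ?in_itv /= ?lexx ?(ltW ab)//.
have dF' t : a <= t <= b -> is_derive t 1 F (speed delta t).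
  by move=> /inn /=; rewrite in_itv /= => /dF.
have H1 : u (delta b) - u (delta a) <= K * (F b - F a).
  apply: (@slope_le _ (u \o delta) F (speed delta)) => //; first exact: ltW.
  by move=> t /inn It e1 e10; exact: (uK _ _ _ oI It C1).
have H2 : - u (delta b) - - u (delta a) <= K * (F b - F a).
  apply: (@slope_le _ (fun s => - u (delta s)) F (speed delta)) => //; first exact: ltW.
  move=> t /inn It e1 e10; apply: filterS (uK _ _ _ oI It C1 e1 e10) => s.
  by rewrite -opprD normrN.
rewrite ler_norml; apply/andP; split; last exact: H1.
by rewrite lerNl opprB; move: H2; rewrite opprK addrC.
Qed.

End lipschitz_along_curves.

Section normal_chart.
Context {R : realType} {n : nat} (M : riemannian_manifold R n).
Variables (c : chart R n M) (y0 : 'rV[R]_n) (P : 'M[R]_n) (s : R).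

Definition nfun (x : M) : 'rV[R]_n := (cfun c x - y0) *m P.
Definition ninv (z : 'rV[R]_n) : M := cinv c (y0 + z *m invmx P).

(** Coordinates [z = (y - y0) *m P] in which the metric is comparable to the flat
one, on the cube of radius [4 s]. *)
Definition normal_chart := [/\ atlas c, P \in unitmx, 0 < s &
  forall z : 'rV[R]_n, `|z| <= 4 * s -> cimg c (y0 + z *m invmx P) /\
    forall u : 'rV[R]_n,
    `|u *m P| <= 2 * Num.sqrt (qform (rmetric c (y0 + z *m invmx P)) u) /\
    Num.sqrt (qform (rmetric c (y0 + z *m invmx P)) u) <= n.+1%:R * `|u *m P|].

Definition ncube (r : R) : set M := [set x | cdom c x /\ `|nfun x| < r].

Hypothesis nc : normal_chart.

Let ac : atlas c. Proof. by case: nc. Qed.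
Let Pu : P \in unitmx. Proof. by case: nc. Qed.
Let s0 : 0 < s. Proof. by case: nc. Qed.
Let nimg (z : 'rV[R]_n) : `|z| <= 4 * s -> cimg c (y0 + z *m invmx P).
Proof. by case: nc => _ _ _ H /H[]. Qed.

Lemma ninv_dom (z : 'rV[R]_n) : `|z| <= 4 * s -> cdom c (ninv z).
Proof. by move=> /nimg; exact: cinv_dom. Qed.

Lemma ninvK (z : 'rV[R]_n) : `|z| <= 4 * s -> nfun (ninv z) = z.
Proof. by move=> /nimg zi; rewrite /nfun /ninv cinvK// addrC addKr mulmxKV. Qed.

Lemma nfunK x : cdom c x -> ninv (nfun x) = x.
Proof. by move=> cx; rewrite /ninv /nfun mulmxK// addrC subrK cfunK. Qed.

Lemma mulmxr_continuous (Q : 'M[R]_n) : continuous (fun u : 'rV[R]_n => u *m Q).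
Proof.
move=> u; apply/differentiable_continuous/differentiable_rV => j.
rewrite (_ : (fun y => _) = \sum_i (fun y : 'rV[R]_n => y 0 i * Q i j)); last first.
  by apply/funext => y; rewrite fct_sumE mxE.
apply: differentiable_sum => i; apply: differentiableM => //.
exact: differentiable_coord.
Qed.

Lemma nfun_continuous x : cdom c x -> {for x, continuous nfun}.
Proof.
move=> cx; apply: (@continuous_comp _ _ _ (fun x => cfun c x - y0) (fun u => u *m P)).
  by apply: continuousB; [exact: cfun_continuous|exact: cst_continuous].
exact: mulmxr_continuous.
Qed.

Lemma ninv_continuous (z : 'rV[R]_n) : `|z| <= 4 * s -> {for z, continuous ninv}.
Proof.
move=> zs; apply: (@continuous_comp _ _ _ (fun z : 'rV[R]_n => y0 + z *m invmx P) (cinv c : _ -> M)).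
  by apply: continuousD; [exact: cst_continuous|exact: mulmxr_continuous].
exact/cinv_continuous/nimg.
Qed.

Lemma ncube_open r : open (ncube r).
Proof.
rewrite openE => x [cx xr].
apply: filterS2 (near_dom cx) (_ : \forall y \near x, `|nfun y| < r) => //.
have cn : {for x, continuous (fun y => `|nfun y|)}.
  by apply: continuous_comp; [exact: nfun_continuous|exact: norm_continuous].
exact: (cn [set a : R | a < r] (lt_nbhsl xr)).
Qed.

Lemma closed_ncube_compact r : r <= 4 * s ->
  compact [set x | cdom c x /\ `|nfun x| <= r].
Proof.
move=> rs.
have -> : [set x | cdom c x /\ `|nfun x| <= r] =
    ninv @` [set z : 'rV[R]_n | `|z| <= r].
  apply/seteqP; split=> [x [cx xr]|_ [z zr <-]] /=.
    by exists (nfun x) => //; exact: nfunK.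
  have zs := le_trans zr rs.
  by split; [exact: ninv_dom|rewrite ninvK].
apply: continuous_compact.
  apply: continuous_in_subspaceT => z; rewrite inE /= => zr.
  exact/ninv_continuous/(le_trans zr).
apply: bounded_closed_compact.
  by exists r; split; [exact: num_real|move=> a ra z /= zr; exact: (le_trans zr (ltW ra))].
apply: (@closed_comp _ _ (fun z : 'rV[R]_n => `|z|) [set a | a <= r]).
  by move=> z _; exact: norm_continuous.
exact: closed_le.
Qed.

Lemma closed_ncube_closed r : r <= 4 * s ->
  closed [set x | cdom c x /\ `|nfun x| <= r].
Proof.
by move=> rs; apply: compact_closed; [exact: rm_hausdorff|exact: closed_ncube_compact].
Qed.

(** A function of the normalised coordinates, extended by a constant outside the
cube of radius [4 s]. *)
Definition nextend (h : 'rV[R]_n -> R) (h0 : R) (x : M) : R :=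
  if asbool (cdom c x /\ `|nfun x| < 4 * s) then h (nfun x) else h0.

Lemma nextendE h h0 x : cdom c x -> `|nfun x| < 4 * s -> nextend h h0 x = h (nfun x).
Proof. by move=> cx xs; rewrite /nextend asboolT. Qed.

Lemma nextend_out h h0 x : (forall z : 'rV[R]_n, 3 * s <= `|z| -> h z = h0) ->
  ~ (cdom c x /\ `|nfun x| <= 3 * s) -> nextend h h0 x = h0.
Proof.
move=> hz nx; rewrite /nextend; case: asboolP => // -[cx xs].
by apply: hz; rewrite leNgt; apply/negP => H; apply: nx; split => //; exact: ltW.
Qed.

(** A curve is either in the cube of radius [4 s], where the metric controls the
velocity of its coordinates, or off the closed cube of radius [3 s], where the
extension is constant.  These two sets are open: the second one because the
closed cube is compact in a Hausdorff space, and this is what keeps a curve that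
leaves the chart from jumping. *)
Lemma nextend_slope h h0 K : 0 <= K -> (forall z w : 'rV[R]_n, `|h z - h w| <= K * `|z - w|) ->
  (forall z : 'rV[R]_n, 3 * s <= `|z| -> h z = h0) -> slope_along (nextend h h0) (2 * K).
Proof.
move=> K0 hK hz I delta t oI It C1 e e0.
have [cd Cd] := C1 t It.
have [tin|tout] := pselect (ncube (4 * s) (delta t)); last first.
  have Kc := closed_ncube_closed (_ : 3 * s <= 4 * s).
  have s34 : 3 * s <= 4 * s by rewrite ler_pM2r// ler_nat.
  have nt : ~ (cdom c (delta t) /\ `|nfun (delta t)| <= 3 * s).
    by move=> [ct ts]; apply: tout; split => //; rewrite (le_lt_trans ts)// ltr_pM2r// ltr_nat.
  have oC : \forall x \near delta t, ~ (cdom c x /\ `|nfun x| <= 3 * s).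
    by apply: open_nbhs_nbhs; split; [exact: closed_openC (Kc s34)|exact: nt].
  near=> s'.
  rewrite !(nextend_out hz)//; last by near: s'; exact: cd oC.
  by rewrite subrr normr0 mulr_ge0// addr_ge0 ?(ltW e0)// !mulr_ge0// sqrtr_ge0.
have [ct ts] := tin.
have [dc _] := Cd c ac ct.
have cont : \forall s' \near t, ncube (4 * s) (delta s').
  by apply: cd; apply: open_nbhs_nbhs; split => //; exact: ncube_open.
have dn : is_derive t 1 (nfun \o delta) (velocity delta t c *m P).
  have dcf : differentiable (cfun c \o delta) t by exact/derivable1_diffP.
  pose L : {linear 'rV[R]_n -> 'rV[R]_n} := mulmxr P.
  have cL : continuous L := @mulmxr_continuous P.
  have dL : differentiable L ((cfun c \o delta) t) by apply: linear_differentiable.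
  have dLc := differentiable_comp dcf dL.
  have H : is_derive t (1 : R) (L \o (cfun c \o delta)) (velocity delta t c *m P).
    split; first exact/derivable1_diffP.
    rewrite -derive1E (derive1E' dLc) (diff_comp dcf dL) (diff_lin _ cL) /=.
    by rewrite -(derive1E' dcf).
  rewrite (_ : nfun \o delta = (L \o (cfun c \o delta)) + cst (- (y0 *m P))).
    have H2 := is_deriveD H (is_derive_cst (- (y0 *m P)) t (1 : R)).
    by apply: (is_derive_eq H2); rewrite addr0.
  by apply/funext => z; rewrite /= /nfun mulmxBl.
have [dnd dnE] := dn.
have K1 : 0 < K + 1 by rewrite ltr_wpDl.
have e1 : 0 < e / (K + 1) by rewrite divr_gt0.
have Hn := derivable_norm_le dnd e1.
apply: filterS2 cont Hn => s' [cs' ss'] Hn.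
rewrite !nextendE// (le_trans (hK _ _))//.
rewrite (le_trans (ler_wpM2l K0 Hn))// mulrA ler_wpM2r// mulrDr lerD//.
  rewrite derive1E dnE -mulrA mulrCA ler_wpM2l//.
  rewrite (speedE ac cd ct dc).
  case: nc => _ _ _ /(_ (nfun (delta t)) (ltW ts))[_ /(_ (velocity delta t c))[+ _]].
  by rewrite /nfun mulmxK// addrC subrK.
by rewrite mulrCA ler_piMr ?(ltW e0)// ler_pdivrMr// mul1r lerDl.
Unshelve. all: by end_near. Qed.

End normal_chart.

(** * Distance versus normalised coordinates *)

Section normal_chart_distance.
Context {R : realType} {n : nat} (M : riemannian_manifold R n).
Implicit Types (c d : chart R n M) (x y p : M) (P : 'M[R]_n).

Lemma rV_continuous (T : topologicalType) (f : T -> 'rV[R]_n) t :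
  (forall j, {for t, continuous (fun s => f s 0 j)}) -> {for t, continuous f}.
Proof.
move=> cf; apply/cvgrPdist_le => e e0.
have H : \forall s \near t, forall j : 'I_n, `|f t 0 j - f s 0 j| <= e.
  apply: (@filter_forall _ 'I_n (fun j s => `|f t 0 j - f s 0 j| <= e) (nbhs t)
    (nbhs_filter t)) => j.
  by have /cvgrPdist_le/(_ e e0) := cf j.
apply: filterS H => s Hs; apply: rV_norm_le => [|j]; first exact: ltW.
by rewrite !mxE.
Qed.

(** The function equal to [min |z - w| s] in the chart and to [s] elsewhere has
slope at most 2 along curves, so it is 2-Lipschitz for the distance.  A point at
distance less than [s / 2] is therefore still in the chart. *)
Lemma dist_lower c (y0 : 'rV[R]_n) P s x y (r : R) : normal_chart c y0 P s -> cdom c x ->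
  `|nfun c y0 P x| <= s -> (geodesic_dist x y < r%:E)%E -> 2 * r < s ->
  [/\ cdom c y, `|nfun c y0 P y| < 4 * s & `|nfun c y0 P y - nfun c y0 P x| <= 2 * r].
Proof.
move=> nc cx xs dxy rs; have [_ _ s0 _] := nc.
set w := nfun c y0 P x in xs *.
(* Truncated at s so as to be constant off the cube of radius 3 s. *)
pose h (z : 'rV[R]_n) := Num.min `|z - w| s.
have h1 (z z' : 'rV[R]_n) : `|h z - h z'| <= 1 * `|z - z'|.
  have A : `|(`|z - w| - `|z' - w|)| <= `|z - z'|.
    by rewrite (le_trans (ler_dist_dist _ _))// opprB addrA subrK.
  rewrite mul1r /h /Num.min; move: A; case: ltP => zs; case: ltP => zs';
    rewrite ?subrr ?normr0// !ler_norml => /andP[? ?]; apply/andP; split; lra.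
have hs (z : 'rV[R]_n) : 3 * s <= `|z| -> h z = s.
  move=> zs; rewrite /h min_r//.
  have := ler_normB (z - w) (- w); rewrite opprK subrK normrN => H.
  by move: xs zs H; move: `|w| `|z| `|z - w| => a b e; lra.
have sl := nextend_slope nc ler01 h1 hs.
have K2 : 0 <= 2 * 1 :> R by rewrite mulr1.
have := slope_along_lip K2 sl dxy.
rewrite mulr1 (@nextendE _ _ _ _ _ _ _ _ _ x)//; last first.
  by rewrite (le_lt_trans xs)// ltr_pMl// ltr1n.
rewrite -/w {2}/h subrr normr0 min_l ?(ltW s0)// subr0.
rewrite /nextend; case: asboolP => [[cy ys]|_]; last first.
  by rewrite gtr0_norm// leNgt rs.
rewrite /h /Num.min; case: ltP => ls; last by rewrite gtr0_norm// leNgt rs.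
by rewrite normr_id => H; split.
Qed.

(** The straight segment in normalised coordinates has speed at most
[(n + 1) |w - z|].  It is defined slightly beyond its endpoints, which is why
the chart extends to [4 s] while the points are within [3 s]. *)
Lemma dist_upper c (y0 : 'rV[R]_n) P s (z w : 'rV[R]_n) : normal_chart c y0 P s ->
  `|z| <= 3 * s -> `|w| <= 3 * s ->
  (geodesic_dist (ninv c y0 P z) (ninv c y0 P w) <= (n.+1%:R * `|w - z|)%:E)%E.
Proof.
move=> nc zs ws; have [ac Pu s0 Hc] := nc.
pose lz t := z + t *: (w - z).
pose V := (w - z) *m invmx P; pose A := y0 + z *m invmx P.
pose delta t := ninv c y0 P (lz t).
have lzE t : y0 + lz t *m invmx P = A + t *: V.
  by rewrite /lz mulmxDl -scalemxAl addrA.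
(* On I one has |1 - t| + |t| <= 5/4, and 5/4 * 3 s <= 4 s. *)
pose I := `]0 - 8^-1, 1 + 8^-1[%classic : set R.
have lI t : I t -> `|lz t| <= 4 * s.
  rewrite /I /= in_itv /= sub0r => /andP[t1 t2].
  have -> : lz t = (1 - t) *: z + t *: w.
    by rewrite /lz scalerBr scalerBl scale1r (addrC (t *: w)) addrA.
  rewrite (le_trans (ler_normD _ _))// !normrZ.
  have a1 : `|1 - t| + `|t| <= 5/4.
    have [t0|t0] := leP 0 t; have [t3|t3] := leP t 1.
    - by rewrite !ger0_norm ?subr_ge0//; lra.
    - by rewrite (ger0_norm t0) ltr0_norm ?subr_lt0//; lra.
    - by rewrite (ltr0_norm t0) ger0_norm ?subr_ge0//; lra.
    - lra.
  have b1 := ler_wpM2l (normr_ge0 (1 - t)) zs; have b2 := ler_wpM2l (normr_ge0 t) ws.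
  have b3 : (`|1 - t| + `|t|) * (3 * s) <= 5/4 * (3 * s) by rewrite ler_wpM2r// mulr_ge0// ltW.
  by move: b1 b2 b3; rewrite mulrDl; lra.
have dcd t : I t -> cdom c (delta t) by move=> /lI; exact: ninv_dom.
have cfd t : I t -> cfun c (delta t) = A + t *: V.
  by move=> /lI/Hc[ci _]; rewrite /delta /ninv cinvK// lzE.
have oI : open I by exact: interval_open.
have clz : continuous lz.
  by move=> t; apply: cvgD; [exact: cvg_cst|apply: cvgZr_tmp; exact: cvg_id].
have cdelta t : I t -> {for t, continuous delta}.
  move=> It; apply: (@continuous_comp _ _ _ lz (ninv c y0 P)); first exact: clz.
  by apply: (ninv_continuous nc); exact: lI.
have loc d t : atlas d -> I t -> cdom d (delta t) ->
    derivable (cfun d \o delta) t 1 /\ forall j,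
    velocity delta t d 0 j = \sum_i V 0 i * partial i (fun v => transition c d v 0 j) (A + t *: V).
  move=> ad It dt.
  have ov : overlap c d (A + t *: V) by rewrite -cfd//; apply: overlap_cfun => //; exact: dcd.
  have E : \forall s' \near t, transition c d (A + s' *: V) = (cfun d \o delta) s'.
    apply: filterS (open_nbhs_nbhs (conj oI It)) => s' Is.
    by rewrite -cfd// transition_cfun//; exact: dcd.
  have sm j := smooth_diff (@overlap_open _ _ _ c d) (atlas_smooth ac ad j) ov.
  have dj j : derivable (fun s' : R => transition c d (A + s' *: V) 0 j) t 1.
    have [df _] := sm j.
    have [H _] := @derivable_line R n (fun v => transition c d v 0 j) A V t.
    by apply: H; exact: diff_derivable.
  have dT : derivable (fun s' : R => transition c d (A + s' *: V)) t 1.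
    by apply/derivable_mxP => i j; rewrite ord1; exact: dj.
  split; first exact: near_eq_derivable E dT.
  move=> j; rewrite /velocity derive1E -(near_eq_derive (1 : R) E) (derive_mx dT) mxE.
  have [df dfE] := sm j.
  by rewrite -dfE -deriveE// -(derive_line (fun v => transition c d v 0 j)).
have C1 : C1_curve I delta.
  move=> t It; split; first exact: cdelta.
  move=> d ad dt; have [dd dv] := loc d t ad It dt; split; first exact: dd.
  have ov : overlap c d (A + t *: V) by rewrite -cfd//; apply: overlap_cfun => //; exact: dcd.
  pose vv s' : 'rV[R]_n := \row_j \sum_i V 0 i * partial i (fun v => transition c d v 0 j) (A + s' *: V).
  apply: (@near_continuous _ _ vv).
    have nd : \forall s' \near t, cdom d (delta s') by apply: (cdelta t It); exact: near_dom.
    apply: filterS2 nd (open_nbhs_nbhs (conj oI It)) => s' ds Is.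
    by apply/rowP => j; rewrite mxE; have [_ ->] := loc d s' ad Is ds.
  have cl : {for t, continuous (fun s' : R => A + s' *: V)}.
    by apply: cvgD; [exact: cvg_cst|apply: cvgZr_tmp; exact: cvg_id].
  apply: rV_continuous => j.
  rewrite (_ : (fun s' => _) = (fun s' => \sum_i V 0 i *
      partial i (fun v => transition c d v 0 j) (A + s' *: V))); last first.
    by apply/funext => s'; rewrite mxE.
  apply: near_continuous_sum => i.
  apply: continuousM; first exact: cst_continuous.
  apply: (@continuous_comp _ _ _ (fun s' : R => A + s' *: V)
    (partial i (fun v => transition c d v 0 j))); first exact: cl.
  have [_ /(_ i)[_ [+ _]]] := atlas_smooth ac ad j 1%N; exact.
have spd t : I t -> speed delta t <= n.+1%:R * `|w - z|.
  move=> It; have ct := dcd t It.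
  have [dc _] := loc c t ac It ct.
  rewrite (speedE ac (cdelta t It) ct dc) cfd//.
  have E : \forall s' \near t, A + s' *: V = (cfun c \o delta) s'.
    by apply: filterS (open_nbhs_nbhs (conj oI It)) => s' Is; rewrite /= cfd.
  have did : differentiable (fun s' : R => s') t by [].
  have dZ : differentiable (fun s' : R => s' *: V) t by exact: differentiableZl.
  have -> : velocity delta t c = V.
    rewrite /velocity derive1E -(near_eq_derive (1 : R) E).
    have /derivable1_diffP dZ' := dZ.
    have H := is_deriveD (is_derive_cst A t (1 : R)) (derivableP dZ').
    have -> : 'D_1 (fun s' : R => A + s' *: V) t = 0 + 'D_1 (fun s' : R => s' *: V) t.
      by have [_] := H.
    rewrite add0r -derive1E (derive1E' dZ) (diffZl V did) /=.
    by rewrite diff_val scale1r.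
  have [_ /(_ V)[_]] := Hc _ (lI t It).
  by rewrite lzE /V mulmxKV.
have [l Al] : exists l, pcarc delta 0 1 l.
  by apply: piece_arc => //; exists (8^-1 : R) => //; exists delta.
have D := dist_arc Al.
rewrite /delta /lz in D; rewrite scale0r addr0 scale1r addrC subrK in D.
apply: (le_trans D); rewrite lee_fin.
have [ml Il] := pcarc_integral Al.
rewrite -lee_fin -Il.
apply: (@le_trans _ _ (\int[lebesgue_measure]_(t in `[0%R, 1%R]) (n.+1%:R * `|w - z|)%:E)%E).
  apply: ge0_le_integral => //=.
  - by move=> t _; rewrite lee_fin speed_ge0.
  - move=> t; rewrite in_itv /= => /andP[t0 t1]; rewrite lee_fin; apply: spd.
    by rewrite /I /= in_itv /=; apply/andP; split; lra.
rewrite integral_cst//= lebesgue_measure_itv/= lte_fin ltr01.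
by rewrite -EFinD subr0 mule1.
Qed.

(** The chart can be taken inside any given neighbourhood [O] of [p]. *)
Lemma normal_chart_exists p (O : set M) : open O -> O p ->
  exists P s, [/\ normal_chart (chart_at p) (cfun (chart_at p) p) P s &
    forall x, cdom (chart_at p) x ->
      `|nfun (chart_at p) (cfun (chart_at p) p) P x| <= 4 * s -> O x].
Proof.
move=> oO Op; set c := chart_at p; have [ac cp] := chart_atP p; rewrite -/c in ac cp.
set y0 := cfun c p.
have cy0 : cimg c y0 by exact: cfun_img.
have [|||P Pu HP] := @metric_nbhd R _ n (rmetric c) y0.
- exact: rmetric_sym.
- by move=> u u0; exact: rmetric_pos.
- by move=> i j; exact: rmetric_continuous.
have nO : \forall y \near y0, O (cinv c y).
  by apply: (cinv_continuous cy0); rewrite cfunK//; exact: open_nbhs_nbhs.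
pose W : set 'rV[R]_n := [set y | [/\ (forall u : 'rV[R]_n,
    `|u *m P| <= 2 * Num.sqrt (qform (rmetric c y) u) /\
    Num.sqrt (qform (rmetric c y) u) <= n.+1%:R * `|u *m P|), cimg c y & O (cinv c y)]].
have nW : nbhs y0 W by apply: filterS3 HP (near_img cy0) nO => y ? ? ?; split.
have cz : {for (0 : 'rV[R]_n), continuous (fun z : 'rV[R]_n => y0 + z *m invmx P)}.
  by apply: continuousD; [exact: cst_continuous|exact: mulmxr_continuous].
have y0E : y0 + (0 : 'rV[R]_n) *m invmx P = y0 by rewrite mul0mx addr0.
have nW0 : nbhs (y0 + (0 : 'rV[R]_n) *m invmx P) W by rewrite y0E.
have /nbhs_norm0P[e /= e0 He] := cz _ nW0.
have nc : normal_chart c y0 P (e / 8).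
  split=> //; first by rewrite divr_gt0.
  move=> z zs; have [|H1 H2 _] := He z; last by split.
  by rewrite /= (le_lt_trans zs)//; lra.
exists P, (e / 8); split; first exact: nc.
move=> x cx xs; have [|_ _] := He (nfun c y0 P x).
  by rewrite /= (le_lt_trans xs)//; lra.
by rewrite -/(ninv c y0 P _) (nfunK nc).
Qed.

End normal_chart_distance.

(** * The metric space of a Riemannian manifold; the Hopf-Rinow theorem *)

Lemma compact_seq_cover (T : ptopologicalType) (K : set T) (f : T -> set T) : compact K ->
  (forall p, K p -> open (f p) /\ f p p) ->
  exists s : seq T, (forall p, p \in s -> K p) /\
    forall y, K y -> exists2 p, p \in s & f p y.
Proof.
rewrite compact_cover => cK fK.
have [|y Ky|D DK KD] := cK T K f; first by move=> p /fK[].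
  by exists y => //; have [] := fK y Ky.
exists (finmap.enum_fset D); split=> [p pD|y /KD[p /= pD fpy]].
  by have /set_mem := DK p pD.
by exists p.
Qed.

Lemma seq_min (R : realType) (T : eqType) (f : T -> R) (s : seq T) :
  (forall p, p \in s -> 0 < f p) -> exists2 d : R, 0 < d & forall p, p \in s -> d <= f p.
Proof.
elim: s => [|a s IH] fs; first by exists 1.
have [|d d0 ds] := IH; first by move=> p ps; apply: fs; rewrite inE ps orbT.
exists (Num.min d (f a)); first by rewrite lt_min d0 fs// inE eqxx.
by move=> p; rewrite inE => /predU1P[->|/ds dp]; rewrite ge_min ?lexx ?orbT// dp.
Qed.

Section distance.
Context {R : realType} {n : nat} (M : riemannian_manifold R n).
Implicit Types (x y z p : M) (r : R).

(** The geodesic distance as a real number: it is finite by connectedness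
([dist_finite]). *)
Definition rho x y : R := fine (geodesic_dist x y).

Lemma nfun_center p (P : 'M[R]_n) :
  nfun (chart_at p) (cfun (chart_at p) p) P p = 0.
Proof. by rewrite /nfun subrr mul0mx. Qed.

Lemma ninv_center p P s : normal_chart (chart_at p) (cfun (chart_at p) p) P s ->
  ninv (chart_at p) (cfun (chart_at p) p) P 0 = p.
Proof.
by move=> nc; rewrite -(nfun_center p P) (nfunK nc)//; have [] := chart_atP p.
Qed.

Lemma dist_near p r : 0 < r -> \forall y \near p, (geodesic_dist p y < r%:E)%E.
Proof.
move=> r0; have [P [s [nc _]]] := normal_chart_exists openT (I : [set: M] p).
have [_ _ s0 _] := nc; have [_ cp] := chart_atP p.
set c := chart_at p in nc cp; set y0 := cfun c p in nc.
pose e := Num.min s (r / n.+1%:R).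
have e0 : 0 < e by rewrite lt_min s0 divr_gt0.
have : ncube c y0 P e p by split => //; rewrite nfun_center normr0.
move=> pe; have : nbhs p (ncube c y0 P e).
  by apply: open_nbhs_nbhs; split => //; exact: ncube_open.
apply: filterS => y [cy].
rewrite lt_min => /andP[ys yr].
have := @dist_upper _ _ _ _ _ _ _ 0 (nfun c y0 P y) nc.
rewrite (nfunK nc cy) (ninv_center nc) normr0 subr0 mulr_ge0 ?(ltW s0)// => /(_ isT) H.
apply: (le_lt_trans (H _)); first by rewrite (le_trans (ltW ys))// ler_peMl ?(ltW s0)// ler1n.
by rewrite lte_fin mulrC -ltr_pdivlMr.
Qed.

Lemma dist_self_lt p r : 0 < r -> (geodesic_dist p p < r%:E)%E.
Proof. by move=> /(@dist_near p)/nbhs_singleton. Qed.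

(** The topology defined by the distance is the given one; the other half is
[dist_near]. *)
Lemma dist_basis p (O : set M) : open O -> O p ->
  exists2 e : R, 0 < e & forall y, (geodesic_dist p y < e%:E)%E -> O y.
Proof.
move=> oO Op; have [P [s [nc sO]]] := normal_chart_exists oO Op.
have [_ _ s0 _] := nc; have [_ cp] := chart_atP p.
exists (s / 4); first by rewrite divr_gt0.
move=> y dy; have [|//|cy ys _] := dist_lower nc cp _ dy.
- by rewrite nfun_center normr0 ltW.
- by rewrite mulrCA gtr_pMr// ltr_pdivrMr// mul1r ltr_nat.
- by apply: sO => //; exact: ltW.
Qed.

Lemma gball_open x r : open (gball x r).
Proof.
rewrite openE => y; rewrite /gball /= => /dist_ltP[g [l [A gx gy lr]]].
have d0 : 0 < (r - l) / 2 by rewrite divr_gt0// subr_gt0.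
apply: filterS (dist_near y d0) => z dyz.
have xl : (geodesic_dist x y < (l + (r - l) / 2)%:E)%E.
  by apply/dist_ltP; exists g, l; split => //; rewrite ltrDl.
have := dist_triangle_lt xl dyz.
by have -> : l + (r - l) / 2 + (r - l) / 2 = r by field.
Qed.

(** The points at finite distance from [x] form a nonempty set that is open and
closed. *)
Lemma dist_finite x y : exists r, (geodesic_dist x y < r%:E)%E.
Proof.
pose A := [set y | exists r, (geodesic_dist x y < r%:E)%E].
have oA : open A.
  rewrite openE => z [r xz]; apply: filterS (dist_near z ltr01) => w zw.
  by exists (r + 1); exact: dist_triangle_lt xz zw.
have cA : closed A.
  rewrite -[A]setCK; apply: open_closedC; rewrite openE => z nAz.
  apply: filterS (dist_near z ltr01) => w zw [r xw]; apply: nAz.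
  by exists (r + 1); apply: dist_triangle_lt xw _; exact: dist_sym_lt.
suff AT : A = [set: M] by have : A y by rewrite AT.
apply: (@rm_connected _ _ M).
- by exists x, 1; exact: dist_self_lt.
- by exists A => //; rewrite setTI.
- by exists A => //; rewrite setTI.
Qed.

Lemma rhoE x y : geodesic_dist x y = (rho x y)%:E.
Proof.
rewrite /rho fineK// ge0_fin_numE ?dist_ge0//.
have [r xr] := dist_finite x y; exact: lt_trans xr (ltry _).
Qed.

Lemma gballE x r y : gball x r y <-> rho x y < r.
Proof. by rewrite /gball /= rhoE lte_fin. Qed.

Lemma rho_ge0 x y : 0 <= rho x y.
Proof. by rewrite -lee_fin -rhoE dist_ge0. Qed.

Lemma rho_self x : rho x x = 0.
Proof.
apply/eqP; rewrite eq_le rho_ge0 andbT; apply/ler_addgt0Pr => e e0.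
by rewrite add0r ltW// -lte_fin -rhoE dist_self_lt.
Qed.

Lemma rho_sym_le x y : rho x y <= rho y x.
Proof.
apply/ler_addgt0Pr => e e0; rewrite ltW// -lte_fin -rhoE dist_sym_lt//.
by rewrite rhoE lte_fin ltrDl.
Qed.

Lemma rho_sym x y : rho x y = rho y x.
Proof. by apply/eqP; rewrite eq_le !rho_sym_le. Qed.

Lemma rho_triangle y x z : rho x z <= rho x y + rho y z.
Proof.
apply/ler_addgt0Pr => e e0.
have -> : rho x y + rho y z + e = (rho x y + e / 2) + (rho y z + e / 2) by field.
rewrite ltW// -lte_fin -rhoE.
by apply: (@dist_triangle_lt _ _ _ _ y); rewrite rhoE lte_fin ltrDl divr_gt0.
Qed.

Lemma rho_lip x y z : `|rho x y - rho x z| <= rho y z.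
Proof.
have H1 := rho_triangle z x y; have H2 := rho_triangle y x z.
rewrite (rho_sym z y) in H1.
by rewrite ler_norml; apply/andP; split; lra.
Qed.

Lemma rho_near x r : 0 < r -> \forall y \near x, rho x y < r.
Proof. by move=> r0; apply: filterS (dist_near x r0) => y; rewrite rhoE lte_fin. Qed.

Lemma rho_continuous x : continuous (rho x).
Proof.
move=> y; apply/cvgrPdist_lt => e e0; apply: filterS (rho_near y e0) => z.
exact: le_lt_trans (rho_lip _ _ _).
Qed.

Lemma rho_basis p (O : set M) : open O -> O p ->
  exists2 e : R, 0 < e & forall y, rho p y < e -> O y.
Proof.
move=> oO Op; have [e e0 H] := dist_basis oO Op; exists e => // y pe.
by apply: H; rewrite rhoE lte_fin.
Qed.

(** A point at distance less than [r1 + r2] from [x] is at distance less than [r2]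
from the closed ball of radius [r1].  The strict inequality leaves the slack
needed because the infimum of lengths need not be attained. *)
Lemma rho_split x y r1 r2 : 0 < r1 -> 0 < r2 -> rho x y < r1 + r2 ->
  exists z, rho x z <= r1 /\ rho z y < r2.
Proof.
move=> r10 r20; rewrite -lte_fin -rhoE => /dist_ltP[g [l [A <- <- lr]]].
have := dist_arc A; rewrite rhoE lee_fin => gl.
have [lr1|lr1] := ltP l r1.
  by exists (g 1); rewrite rho_self; split => //; exact: le_trans gl (ltW lr1).
(* The midpoint of l - r2 and r1, at which to cut the arc of length l. *)
pose v := (l - r2 + r1) / 2.
have [v0|v0] := leP v 0.
  exists (g 0); rewrite rho_self; split; first exact: ltW.
  by apply: (le_lt_trans gl); rewrite /v in v0; lra.
have [|t] := pcarc_split A (v := v).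
  by rewrite v0 /= /v; lra.
rewrite !rhoE !lee_fin => -[H1 H2]; exists (g t); split.
  by apply: (le_trans H1); rewrite /v; lra.
by apply: (le_lt_trans H2); rewrite /v; lra.
Qed.

Definition cball x r := [set y | rho x y <= r].

Lemma cball_closed x r : closed (cball x r).
Proof.
apply: (@closed_comp _ _ (rho x) [set a | a <= r]); last exact: closed_le.
by move=> y _; exact: rho_continuous.
Qed.

Lemma cball_sub_compact x r r' : r <= r' -> compact (cball x r') -> compact (cball x r).
Proof.
move=> rr' c'; apply: (subclosed_compact (@cball_closed _ _) c') => y /= H.
exact: le_trans H rr'.
Qed.

Lemma cball_locally_compact p : exists2 e : R, 0 < e & compact (cball p e).
Proof.
have [P [s [nc _]]] := normal_chart_exists openT (I : [set: M] p).
have [_ _ s0 _] := nc; have [_ cp] := chart_atP p.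
exists (s / 8); first by rewrite divr_gt0.
apply: (subclosed_compact (@cball_closed _ _) (closed_ncube_compact nc (lexx (4 * s)))).
move=> y /= ys; have dy : (geodesic_dist p y < (s / 4)%:E)%E.
  by rewrite rhoE lte_fin (le_lt_trans ys)// ltr_pM2l// ltf_pV2 ?posrE// ltr_nat.
have [|//|cy y4 _] := dist_lower nc cp _ dy.
- by rewrite nfun_center normr0 ltW.
- by rewrite mulrCA gtr_pMr// ltr_pdivrMr// mul1r ltr_nat.
- by split => //; exact: ltW.
Qed.

(** An ultrafilter on the closed ball of radius [R0] contains arbitrarily small
balls: the ball of radius [r], slightly less than [R0], is compact and so
covered by finitely many small balls, and every point of the larger ball is
close to it by [rho_split]; an ultrafilter containing a finite union contains
one of its members.  The centres then form a Cauchy sequence, whose limit is a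
limit of the ultrafilter. *)
Lemma cball_limit_compact x R0 : complete_manifold M -> 0 < R0 ->
  (forall r, r < R0 -> compact (cball x r)) -> compact (cball x R0).
Proof.
move=> cM R00 cr; rewrite compact_ultra => F FU FR.
have FF : ProperFilter F by exact: ultra_proper.
have small e : 0 < e -> exists z, F (gball z e).
  move=> e0; apply: contrapT => /forallNP nF.
  (* The maximum keeps the radius positive when e is large. *)
  pose r := Num.max (R0 - e / 4) (R0 / 2).
  have rR : r < R0.
    by rewrite /r gt_max ltrBlDr ltrDl divr_gt0//= gtr_pMr// invf_lt1// ltr1n.
  have r0 : 0 < r by rewrite /r lt_max (divr_gt0 R00)// orbT.
  have rR4 : R0 - e / 4 <= r by rewrite /r le_max lexx.
  have e2 : 0 < e / 2 by rewrite divr_gt0.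
  have [|s [_ sK]] := @compact_seq_cover _ (cball x r) (fun z => gball z (e / 2)) (cr r rR).
    by move=> z _; split; [exact: gball_open|apply/gballE; rewrite rho_self].
  have : F (cball x R0 `&` [set y | forall z, z \in s -> ~ gball z e y]).
    apply: filterI => //; elim: (s) => [|a s' IH].
      by apply: filterS filterT => y _.
    have Fa : F (~` gball a e) by have [/nF|] := in_ultra_setVsetC (gball a e) FU.
    apply: filterS2 IH Fa => y H na z; rewrite inE => /predU1P[->//|]; exact: H.
  move=> /filter_ex[y [yR ny]].
  have [|z [xz zy]] := @rho_split x y r (e / 2) r0 e2.
    by apply: (le_lt_trans yR); lra.
  have [w ws /gballE wz] := sK z xz; apply: (ny w ws); apply/gballE.
  by have := rho_triangle z w y; lra.
have k0 k : 0 < k.+1%:R^-1 :> R by rewrite invr_gt0.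
have [u uF] := choice (fun k : nat => small _ (k0 k)).
have uu i j : rho (u i) (u j) < i.+1%:R^-1 + j.+1%:R^-1.
  have : F (gball (u i) i.+1%:R^-1 `&` gball (u j) j.+1%:R^-1) by apply: filterI; exact: uF.
  move=> /filter_ex[y [/gballE iy /gballE jy]].
  by apply: (le_lt_trans (rho_triangle y _ _)); rewrite (rho_sym y) ltrD.
have arch e : 0 < e -> exists N, forall i, (N <= i)%N -> i.+1%:R^-1 < e :> R.
  move=> e0; have [N _ HN] := near_infty_natSinv_lt (PosNum e0).
  by exists N => i Ni; exact: HN.
have [|l ul] := cM u.
  move=> e e0; have e2 : 0 < e / 2 by rewrite divr_gt0.
  have [N HN] := arch _ e2; exists N => i j Ni Nj; rewrite rhoE lte_fin.
  by apply: (lt_trans (uu i j)); rewrite (splitr e) ltrD// HN.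
have Fl : F --> l.
  move=> O; rewrite nbhsE => -[Q [oQ Ql] QO].
  have [e e0 He] := rho_basis oQ Ql.
  have e2 : 0 < e / 2 by rewrite divr_gt0.
  have [N HN] := arch _ e2; have [N' HN'] := ul _ e2.
  apply: filterS (uF (maxn N N')) => y /gballE uy; apply/QO/He.
  have u1 := lt_trans uy (HN _ (leq_maxl N N')).
  have := HN' _ (leq_maxr N N'); rewrite rhoE lte_fin => u2.
  by apply: (le_lt_trans (rho_triangle (u (maxn N N')) l y)); rewrite (splitr e) ltrD.
exists l; split => //; apply: cball_closed => B /Fl FB.
have : F (cball x R0 `&` B) by apply: filterI.
exact: filter_ex.
Qed.

(** Finitely many compact balls whose halves cover the ball of radius [R0] still
cover a slightly larger ball, again by [rho_split]. *)
Lemma cball_extend_compact x R0 : 0 < R0 -> compact (cball x R0) ->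
  exists2 d : R, 0 < d & compact (cball x (R0 + d)).
Proof.
move=> R00 cR.
have H p : exists e : R, 0 < e /\ compact (cball p e).
  by have [e e0 ce] := cball_locally_compact p; exists e.
have [f fc] := choice H.
have f2 p : 0 < f p / 2 by rewrite divr_gt0//; have [] := fc p.
have [|s [_ sK]] := @compact_seq_cover _ _ (fun p => gball p (f p / 2)) cR.
  by move=> p _; split; [exact: gball_open|apply/gballE; rewrite rho_self].
have [d d0 ds] := @seq_min R M (fun p => f p / 2) s (fun p _ => f2 p).
exists (d / 2); first by rewrite divr_gt0.
apply: (subclosed_compact (@cball_closed _ _)
  (@bigsetU_compact _ M (fun p => cball p (f p)) s xpredT (fun p _ => (fc p).2))).
move=> y yR.
have [|z [xz zy]] := @rho_split x y R0 d R00 d0.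
  by apply: (le_lt_trans yR); rewrite ltrD2l gtr_pMr// invf_lt1// ltr1n.
have [p ps /gballE pz] := sK z xz.
rewrite -bigcup_seq; exists p => //=; rewrite /cball /=.
have := rho_triangle z p y; have := ds p ps; lra.
Qed.

(** The radii of compact balls have no finite supremum: it would be attained by
[cball_limit_compact], and exceeded by [cball_extend_compact]. *)
Theorem hopf_rinow x r : complete_manifold M -> compact (cball x r).
Proof.
move=> cM; apply: contrapT => nc.
pose S := [set a | 0 < a /\ compact (cball x a)].
have [e e0 ce] := cball_locally_compact x.
have Se : S e by [].
have Sr a : S a -> a <= r.
  move=> [_ ca]; rewrite leNgt; apply/negP => ra; apply: nc.
  exact: cball_sub_compact (ltW ra) ca.
have supS : has_sup S by split; [exists e|exists r => a /Sr].
pose R0 := sup S.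
have eR : e <= R0 by apply: ub_le_sup => //; case: supS.
have R00 : 0 < R0 by exact: lt_le_trans eR.
have cR0 : compact (cball x R0).
  apply: cball_limit_compact => // a aR.
  have d0 : 0 < R0 - a by rewrite subr_gt0.
  have [b [_ cb] ab] := sup_adherent d0 supS.
  by apply: cball_sub_compact cb; apply: ltW; move: ab; rewrite -/R0; lra.
have [d d0 cd] := cball_extend_compact R00 cR0.
have : R0 + d <= R0.
  by apply: ub_le_sup; [case: supS|split => //; rewrite addr_gt0].
by rewrite gerDl leNgt d0.
Qed.

End distance.

(** * Smoothing Lipschitz functions on a manifold *)

Section smooth_on.
Context {R : realType} {n : nat} (M : riemannian_manifold R n).
Implicit Types (c d : chart R n M) (O U : set M) (psi phi : M -> R).

Definition smooth_on O psi := forall c, atlas c ->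
  smooth (cfun c @` (cdom c `&` O)) (psi \o cinv c).

Lemma smooth_onT psi : smooth_on setT psi -> smooth_fun psi.
Proof. by move=> H c ac k; have := H c ac k; rewrite setIT. Qed.

Lemma smooth_onU O U psi : smooth_on O psi -> smooth_on U psi -> smooth_on (O `|` U) psi.
Proof.
move=> HO HU c ac k; apply: Ck_pointwise => _ [x [cx [Ox|Ux]] <-].
  by apply: CkS (HO c ac k) => _ ->; exists x.
by apply: CkS (HU c ac k) => _ ->; exists x.
Qed.

Lemma smooth_onS O U psi : U `<=` O -> smooth_on O psi -> smooth_on U psi.
Proof.
move=> UO H c ac k; apply: CkS (H c ac k) => _ [x [cx Ux] <-].
by exists x => //; split => //; exact: UO.
Qed.

Lemma smooth_on_eq O psi phi : open O -> (forall x, O x -> phi x = psi x) ->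
  smooth_on O phi -> smooth_on O psi.
Proof.
move=> oO E H c ac k; apply: Ck_near (H c ac k) => y Uy.
have oI : nbhs y (cfun c @` (cdom c `&` O)).
  by apply: open_nbhs_nbhs; split => //; exact: cfun_image_open.
by apply: filterS oI => _ [x [cx Ox] <-] /=; rewrite cfunK// E.
Qed.

Lemma smooth_on_cst O (a : R) : smooth_on O (cst a).
Proof. by move=> c _ k; exact: Ck_cst. Qed.

Lemma smooth_onD O psi phi : open O -> smooth_on O psi -> smooth_on O phi ->
  smooth_on O (psi + phi).
Proof.
by move=> oO H1 H2 c ac k; exact: CkD (cfun_image_open oO) (H1 c ac k) (H2 c ac k).
Qed.

Lemma smooth_onM O psi phi : open O -> smooth_on O psi -> smooth_on O phi ->
  smooth_on O (psi * phi).
Proof.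
by move=> oO H1 H2 c ac k; exact: CkM (cfun_image_open oO) (H1 c ac k) (H2 c ac k).
Qed.

(** In any other chart, [nfun] is an affine function of the transition map. *)
Lemma smooth_on_coords c (y0 : 'rV[R]_n) (P : 'M[R]_n) S : atlas c -> smooth_of_coords S ->
  smooth_on (cdom c) (fun x => S (nfun c y0 P x)).
Proof.
move=> ac sS d ad k.
pose g i (y : 'rV[R]_n) : R := \sum_j (transition d c y 0 j + - y0 0 j) * P j i.
have oU : open (overlap d c) by exact: overlap_open.
have Cg i : Ck k (overlap d c) (g i).
  apply: Ck_sum => // j; apply: (CkM oU _ (Ck_cst _ _ (P j i))).
  exact: (CkD oU (atlas_smooth ad ac j k) (Ck_cst _ _ (- y0 0 j))).
rewrite (_ : _ \o _ = fun y => S (\row_i g i y)); first exact: sS.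
apply/funext => y /=; congr S; apply/rowP => i.
by rewrite /nfun !mxE; apply: eq_bigr => j _; rewrite !mxE.
Qed.

End smooth_on.

Section smoothing.
Context {R : realType} {n : nat} (M : riemannian_manifold R n).
Implicit Types (c d : chart R n M) (O U W : set M) (psi phi : M -> R) (x y p : M).

Definition rho_lipschitz (L : R) psi := forall x y, `|psi x - psi y| <= L * rho x y.

(** A local Lipschitz bound at the point [x] only.  It is what the gradient at [x]
depends on, and it is stable under gluing. *)
Definition local_slope (L : R) psi x := \forall y \near x, `|psi y - psi x| <= L * rho x y.

(** Passage to the limit in [dist_lower], from strict upper bounds of the distance
to the distance. *)
Lemma rho_lower c (y0 : 'rV[R]_n) P s x y : normal_chart c y0 P s -> cdom c x ->
  `|nfun c y0 P x| <= s -> 2 * rho x y < s ->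
  [/\ cdom c y, `|nfun c y0 P y| < 4 * s &
      `|nfun c y0 P y - nfun c y0 P x| <= 2 * rho x y].
Proof.
move=> nc cx xs rs.
have H e : 0 < e -> 2 * (rho x y + e) < s -> [/\ cdom c y, `|nfun c y0 P y| < 4 * s &
      `|nfun c y0 P y - nfun c y0 P x| <= 2 * (rho x y + e)].
  by move=> e0; apply: dist_lower => //; rewrite rhoE lte_fin ltrDl.
have [||cy ys _] := H ((s - 2 * rho x y) / 4); try lra.
split => //; apply/ler_addgt0Pr => e e0.
pose e' := Num.min (e / 2) ((s - 2 * rho x y) / 4).
have e'0 : 0 < e' by rewrite lt_min divr_gt0//= divr_gt0// subr_gt0.
have e'1 : e' <= e / 2 by rewrite ge_min lexx.
have e'2 : e' <= (s - 2 * rho x y) / 4 by rewrite ge_min lexx orbT.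
have [||_ _ H1] := H e'; [lra|lra|].
by apply: (le_trans H1); lra.
Qed.

(** Everything the smoothing in one chart around [p] provides: a neighbourhood [W]
of [p], a cutoff [b] equal to 1 on [W] and supported in a closed [Kb] inside
[O], and for each Lipschitz [psi] its smoothings [S] on [Kb].  What matters is
the order of the quantifiers: [W], [b] and its Lipschitz constant [B] come
before the accuracy [dl], so that [dl * B] can be made small. *)
Definition patch (C0 : R) O p (B : R) W := [/\ open W, W p, 0 <= B &
  exists b : M -> R, exists Kb U : set M,
  [/\ [/\ closed Kb, open U, Kb `<=` U, W `<=` Kb & Kb `<=` O],
      [/\ forall x, 0 <= b x <= 1, forall x, W x -> b x = 1,
          forall x, ~ Kb x -> b x = 0, rho_lipschitz B b & smooth_on U b] &
      forall psi (L dl : R), (forall x, 0 <= psi x) -> rho_lipschitz L psi -> 0 <= L ->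
        0 < dl -> exists S : M -> R, [/\ smooth_on U S, forall x, Kb x -> 0 <= S x,
          forall x, Kb x -> `|S x - psi x| <= dl &
          forall x, Kb x -> local_slope (C0 * L) S x]]].

(** Everything is read in one normalised chart: [b] is the cutoff of radius [s / 2]
and [S] is the lattice smoothing of [psi] there.  The factor [n + 1] bounds the
Lipschitz constant of [psi] in coordinates, by [dist_upper], and the factor 2
leads back to the distance, by [rho_lower]. *)
Lemma patch_exists : exists2 C0 : R, 1 <= C0 & forall O p, open O -> O p ->
  exists B W, patch C0 O p B W.
Proof.
have [C C_ge0 lat] := @lattice_smoothing R n.
exists (2 * (C * n.+1%:R) + 1); first by rewrite lerDr !mulr_ge0.
move=> O p oO Op.
have [P [s [nc sO]]] := normal_chart_exists oO Op.
have [ac _ s0 _] := nc; have [_ cp] := chart_atP p.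
set c := chart_at p in nc cp ac sO; set y0 := cfun c p in nc sO.
have s20 : 0 < s / 2 by rewrite divr_gt0.
have [K K0 HK] := @cutoff_lip R n (s / 2) s20.
have s34 : 3 * s <= 4 * s by rewrite ler_pM2r// ler_nat.
have s13 : s <= 3 * s by rewrite ler_peMl ?(ltW s0)// ler1n.
have s14 : s < 4 * s by rewrite ltr_pMl// ltr1n.
pose b := nextend c y0 P s (cutoff (s / 2)) 0.
have bout (z : 'rV[R]_n) : s <= `|z| -> cutoff (s / 2) z = 0.
  by move=> zs; apply: cutoff_out => //; rewrite mulrC divfK.
pose Kb : set M := [set x | cdom c x /\ `|nfun c y0 P x| <= s].
have cKb : closed Kb by apply: (closed_ncube_closed nc); exact: ltW.
exists (2 * K), (ncube c y0 P (s / 2)); split.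
- exact: ncube_open.
- by split => //; rewrite nfun_center normr0.
- by rewrite mulr_ge0.
exists b, Kb, (ncube c y0 P (4 * s)); split.
- split => //.
  + exact: ncube_open.
  + by move=> x [cx xs]; split => //; exact: le_lt_trans s14.
  + by move=> x [cx xs]; split => //; rewrite (le_trans (ltW xs))// ler_pdivrMr// ler_peMr ?(ltW s0)// ler1n.
  + by move=> x [cx xs]; apply: sO => //; rewrite (le_trans xs)// ltW.
- split.
  + move=> x; rewrite /b /nextend; case: asboolP => _; first exact: cutoff01.
    by rewrite lexx ler01.
  + move=> x [cx xs]; rewrite /b nextendE//; first by apply: cutoff_in => //; exact: ltW.
    by rewrite (lt_trans xs)// ltr_pdivrMr// (lt_le_trans s14)// ler_peMr ?mulr_ge0 ?(ltW s0)// ler1n.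
  + move=> x nK; rewrite /b /nextend; case: asboolP => // -[cx xs].
    by apply: bout; rewrite leNgt; apply/negP => /ltW H; exact: nK.
  + move=> x y; apply/ler_addgt0Pr => e e0.
    have K2 : 0 <= 2 * K by rewrite mulr_ge0.
    have bs : slope_along b (2 * K).
      by apply: nextend_slope => // z zs; apply: bout; exact: le_trans zs.
    pose e1 := e / (2 * K + 1).
    have e10 : 0 < e1 by rewrite divr_gt0// ltr_wpDl.
    have := @slope_along_lip _ _ _ b _ K2 bs y x (rho x y + e1).
    rewrite rhoE lte_fin rho_sym ltrDl => /(_ e10) H; apply: (le_trans H).
    rewrite mulrDr lerD2l /e1 mulrCA ler_piMr ?(ltW e0)// ler_pdivrMr ?ltr_wpDl//.
    by rewrite mul1r lerDl.
  + apply: (@smooth_on_eq _ _ _ _ _ (fun x => cutoff (s / 2) (nfun c y0 P x))).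
    * exact: ncube_open.
    * by move=> x [cx xs]; rewrite /b nextendE.
    * apply: (@smooth_onS _ _ _ (cdom c)); first by move=> x [].
      by apply: smooth_on_coords => //; exact: smooth_cutoff.
move=> psi L dl psi0 psiL L0 dl0.
have nL : 0 <= L * n.+1%:R by rewrite mulr_ge0.
pose F z := psi (ninv c y0 P z).
have FL (z w : 'rV[R]_n) : `|z| <= 3 * s -> `|w| <= 3 * s ->
    `|F z - F w| <= L * n.+1%:R * `|z - w|.
  move=> zs ws; rewrite (le_trans (psiL _ _))// -mulrA ler_wpM2l//.
  by rewrite -lee_fin -rhoE distrC; exact: dist_upper nc zs ws.
have F0 (z : 'rV[R]_n) : `|z| <= 3 * s -> 0 <= F z by move=> _; exact: psi0.
have [S [sS S0 Sd [e e0 Se]]] := lat s _ dl F s0 nL dl0 FL F0.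
exists (fun x => S (nfun c y0 P x)); split.
- apply: (@smooth_onS _ _ _ (cdom c)); first by move=> x [].
  exact: smooth_on_coords.
- by move=> x _; exact: S0.
- by move=> x [cx xs]; have := Sd (nfun c y0 P x) (le_trans xs s13); rewrite /F (nfunK nc).
- move=> x [cx xs].
  have m0 : 0 < Num.min (s / 4) (e / 2) by rewrite lt_min !divr_gt0.
  apply: filterS (rho_near x m0) => y; rewrite lt_min => /andP[y1 y2].
  have y3 : 2 * rho x y < s by lra.
  have [cy ys yx] := rho_lower nc cx xs y3.
  have yns : `|nfun c y0 P y| <= 3 * s.
    rewrite -(subrK (nfun c y0 P x) (nfun c y0 P y)) (le_trans (ler_normD _ _))//.
    by apply: (le_trans (lerD yx xs)); lra.
  have xns := le_trans xs s13.
  rewrite (le_trans (Se _ _ yns xns _))//; first by apply: (le_trans yx); lra.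
  have q0 : 0 <= C * (L * n.+1%:R) by rewrite mulr_ge0.
  apply: (le_trans (ler_wpM2l q0 yx)).
  have r0 := rho_ge0 x y.
  have -> : (2 * (C * n.+1%:R) + 1) * L * rho x y =
     C * (L * n.+1%:R) * (2 * rho x y) + L * rho x y by ring.
  by rewrite lerDl mulr_ge0.
Qed.

(** The new function [phi' = phi + b * (S - phi)] is smooth on [W], where it is
[S], and remains smooth on [U].  It is a convex combination of [phi] and [S],
so sign and accuracy are preserved, and its slope exceeds those of [phi] and [S]
by at most [B * |S - phi| <= 2 * dl * B]. *)
Lemma patch_step C0 O p B W psi (L dl L1 : R) U phi : patch C0 O p B W ->
  (forall x, 0 <= psi x) -> rho_lipschitz L psi -> 0 <= L -> 0 < dl -> C0 * L <= L1 ->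
  open U -> smooth_on U phi -> (forall x, 0 <= phi x) -> (forall x, `|phi x - psi x| <= dl) ->
  (forall x, ~ O x -> phi x = psi x) -> (forall x, local_slope L1 phi x) ->
  exists phi', [/\ smooth_on (U `|` W) phi', forall x, 0 <= phi' x,
    forall x, `|phi' x - psi x| <= dl, forall x, ~ O x -> phi' x = psi x &
    forall x, local_slope (L1 + 2 * dl * B) phi' x].
Proof.
move=> [oW Wp B0 [b [Kb [V [[cK oV KV WK KO] [b01 b1 b0 bL bS] HS]]]]] psi0 psiL L0 dl0 CL
  oU sphi phi0 phid phiO phisl.
have [S [sS S0 Sd Ssl]] := HS psi L dl psi0 psiL L0 dl0.
pose phi' x := phi x + b x * (S x - phi x).
have E x : phi' x = (1 - b x) * phi x + b x * S x by rewrite /phi'; ring.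
have off x : ~ Kb x -> phi' x = phi x by move=> nK; rewrite /phi' b0// mul0r addr0.
have oC : open (~` Kb) by exact: closed_openC.
exists phi'; split.
(* The set U is covered by U :&: V, where all of phi, b and S are smooth, and by
   U minus Kb, where phi' is phi. *)
- have s1 : smooth_on (U `&` V) phi'.
    have oUV : open (U `&` V) by exact: openI.
    have sp : smooth_on (U `&` V) phi by apply: smooth_onS sphi => x [].
    have sb : smooth_on (U `&` V) b by apply: smooth_onS bS => x [].
    have ss : smooth_on (U `&` V) S by apply: smooth_onS sS => x [].
    apply: (@smooth_on_eq _ _ _ _ _ (phi + b * (S + cst (-1) * phi))) => //.
      by move=> x _; rewrite /phi' -[LHS]/(phi x + b x * (S x + (-1) * phi x)) mulN1r.
    apply: smooth_onD => //; apply: smooth_onM => //; apply: smooth_onD => //.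
    by apply: smooth_onM => //; exact: smooth_on_cst.
  have s2 : smooth_on (U `&` ~` Kb) phi'.
    apply: (@smooth_on_eq _ _ _ _ _ phi) => //; first exact: openI.
      by move=> x [_ nK]; rewrite off.
    by apply: smooth_onS sphi => x [].
  have s3 : smooth_on W phi'.
    apply: (@smooth_on_eq _ _ _ _ _ S) => //.
      by move=> x Wx; rewrite E b1// subrr mul0r add0r mul1r.
    by apply: smooth_onS sS => x /WK/KV.
  apply: smooth_onS (smooth_onU (smooth_onU s1 s2) s3) => x [Ux|Wx]; last by right.
  left; have [Kx|nK] := pselect (Kb x); first by left; split => //; exact: KV.
  by right.
- move=> x; have [Kx|nK] := pselect (Kb x); last by rewrite off.
  have /andP[bx0 bx1] := b01 x.
  by rewrite E addr_ge0// mulr_ge0// ?subr_ge0// S0.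
- move=> x; have [Kx|nK] := pselect (Kb x); last by rewrite off.
  have /andP[bx0 bx1] := b01 x.
  have -> : phi' x - psi x = (1 - b x) * (phi x - psi x) + b x * (S x - psi x).
    by rewrite E; ring.
  rewrite (le_trans (ler_normD _ _))// !normrM (ger0_norm bx0) ger0_norm ?subr_ge0//.
  have H1 : (1 - b x) * `|phi x - psi x| <= (1 - b x) * dl by rewrite ler_wpM2l// subr_ge0.
  have H2 : b x * `|S x - psi x| <= b x * dl by rewrite ler_wpM2l// Sd.
  by apply: (le_trans (lerD H1 H2)); rewrite -mulrDl subrK mul1r.
- by move=> x nO; rewrite off ?phiO// => /KO.
- move=> x; have dB : 0 <= 2 * dl * B by rewrite !mulr_ge0// ltW.
  have [Kx|nK] := pselect (Kb x); last first.
    have nC : nbhs x (~` Kb) by apply: open_nbhs_nbhs.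
    apply: filterS2 nC (phisl x) => y nKy H; rewrite !off// (le_trans H)//.
    by rewrite ler_wpM2r ?rho_ge0// lerDl.
  apply: filterS2 (phisl x) (Ssl x Kx) => y H1 H2.
  have /andP[by0 by1] := b01 y.
  have -> : phi' y - phi' x = (1 - b y) * (phi y - phi x) + b y * (S y - S x) +
     (b y - b x) * (S x - phi x) by rewrite /phi'; ring.
  have r0 := rho_ge0 x y.
  have H2' : `|S y - S x| <= L1 * rho x y by rewrite (le_trans H2)// ler_wpM2r.
  have H3 : `|b y - b x| <= B * rho x y by rewrite rho_sym.
  have H4 : `|S x - phi x| <= 2 * dl.
    have := ler_distD (psi x) (S x) (phi x); rewrite (distrC (psi x)).
    by have := Sd x Kx; have := phid x; lra.
  rewrite (le_trans (ler_normD _ _))// [leRHS]mulrDl lerD//.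
    rewrite (le_trans (ler_normD _ _))// !normrM (ger0_norm by0) ger0_norm ?subr_ge0//.
    have H5 : (1 - b y) * `|phi y - phi x| <= (1 - b y) * (L1 * rho x y).
      by rewrite ler_wpM2l// subr_ge0.
    have H6 : b y * `|S y - S x| <= b y * (L1 * rho x y) by rewrite ler_wpM2l.
    by apply: (le_trans (lerD H5 H6)); rewrite -mulrDl subrK mul1r.
  rewrite normrM [leLHS]mulrC -mulrA; exact: ler_pM.
Qed.

(** The support [K] of [psi] is covered by finitely many patches inside [O], and
the accuracy is chosen so that the slopes added by all the steps together remain
below [L].  Off [K] the function is zero, hence smooth from the start. *)
Theorem lipschitz_smoothing : exists2 C : R, 0 < C & forall (K O : set M) psi (L dl : R),
  compact K -> open O -> K `<=` O -> (forall x, 0 <= psi x) -> rho_lipschitz L psi ->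
  0 < L -> 0 < dl -> (forall x, ~ K x -> psi x = 0) ->
  exists phi, [/\ smooth_fun phi, forall x, 0 <= phi x, forall x, `|phi x - psi x| <= dl,
    forall x, ~ O x -> phi x = 0 & forall x, local_slope (C * L) phi x].
Proof.
have [C0 C01 HP] := patch_exists.
exists (C0 + 1); first by lra.
move=> K O psi L dl cK oO KO psi0 psiL L0 dl0 psiK.
(* Off O any value will do: choice is made over all points. *)
have ex p : exists BW : R * set M, O p -> patch C0 O p BW.1 BW.2.
  have [Op|nO] := pselect (O p); last by exists (0, set0).
  by have [B [W BW]] := HP O p oO Op; exists (B, W).
have [f fP] := choice ex.
have [|s [sK Ks]] := @compact_seq_cover _ K (fun p => (f p).2) cK.
  by move=> p /KO/fP[].
have clK : closed K by apply: compact_closed cK; exact: rm_hausdorff.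
pose SB := \sum_(p <- s) (f p).1.
have SB0 : 0 <= SB.
  by rewrite /SB big_seq; apply: sumr_ge0 => p /sK/KO/fP[].
(* With this accuracy the slopes 2 * dl' * B added by the patches sum up to at
   most L. *)
pose dl' := Num.min dl (L / (2 * (SB + 1))).
have dl'0 : 0 < dl' by rewrite lt_min dl0 divr_gt0// mulr_gt0// ltr_wpDl.
have CL : L <= C0 * L by rewrite ler_peMl// ltW.
have ind s' : (forall p, p \in s' -> O p) -> 0 <= \sum_(p <- s') 2 * dl' * (f p).1 /\
    exists phi, [/\ smooth_on (~` K `|` [set y | exists2 p, p \in s' & (f p).2 y]) phi,
     forall x, 0 <= phi x, forall x, `|phi x - psi x| <= dl', forall x, ~ O x -> phi x = psi x &
     forall x, local_slope (C0 * L + \sum_(p <- s') 2 * dl' * (f p).1) phi x].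
  elim: s' => [_|p s' IH Os'].
    rewrite big_nil; split => //; exists psi; split => //.
    - apply: (@smooth_on_eq _ _ _ _ _ (cst 0)); last exact: smooth_on_cst.
        rewrite (_ : [set y | _] = set0) ?setU0; first exact: closed_openC.
        by apply/seteqP; split => y // [].
      by move=> x [nK|[]//]; rewrite psiK.
    - by move=> x; rewrite subrr normr0 ltW.
    - move=> x; apply: filterE => y; rewrite addr0 (le_trans (psiL _ _))//.
      by rewrite rho_sym ler_wpM2r ?rho_ge0.
  have [|sum0 [phi [p1 p2 p3 p4 p5]]] := IH.
    by move=> q qs; apply: Os'; rewrite inE qs orbT.
  have Pp := fP p (Os' p (mem_head _ _)).
  have B0 : 0 <= (f p).1 by have [] := Pp.
  have q0 : 0 <= 2 * dl' * (f p).1 by rewrite !mulr_ge0// ltW.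
  rewrite big_cons; split; first exact: addr_ge0.
  have oV : open (~` K `|` [set y | exists2 p, p \in s' & (f p).2 y]).
    apply: openU; first exact: closed_openC.
    rewrite (_ : [set y | _] = \bigcup_(q in [set` s']) (f q).2); last first.
      by apply/seteqP; split => y /= -[q ? ?]; exists q.
    apply: bigcup_open => q /= qs.
    by have [] := fP q (Os' q _); rewrite // inE qs orbT.
  have CL1 : C0 * L <= C0 * L + \sum_(p <- s') 2 * dl' * (f p).1 by rewrite lerDl.
  have [phi' [q1 q2 q3 q4 q5]] :=
    patch_step Pp psi0 psiL (ltW L0) dl'0 CL1 oV p1 p2 p3 p4 p5.
  exists phi'; split => //.
    apply: smooth_onS q1 => y [nK|[q]]; first by left; left.
    rewrite inE => /predU1P[->|qs] qy; first by right.
    by left; right; exists q.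
  by move=> x; have := q5 x; rewrite -addrA [X in _ + X]addrC.
have [|_ [phi [p1 p2 p3 p4 p5]]] := ind s; first by move=> p /sK/KO.
exists phi; split => //.
- apply: smooth_onT; apply: smooth_onS p1 => y _.
  have [/Ks[p ps py]|nK] := pselect (K y); last by left.
  by right; exists p.
- by move=> x; apply: (le_trans (p3 x)); rewrite ge_min lexx.
- by move=> x nO; rewrite p4// psiK// => /KO.
- move=> x; apply: filterS (p5 x) => y H; apply: (le_trans H).
  rewrite ler_wpM2r ?rho_ge0// [leRHS]mulrDl mul1r lerD2l -mulr_sumr -/SB.
  have : dl' <= L / (2 * (SB + 1)) by rewrite ge_min lexx orbT.
  rewrite ler_pdivlMr ?mulr_gt0 ?ltr_wpDl// => H1.
  apply: le_trans H1; have -> : dl' * (2 * (SB + 1)) = 2 * dl' * SB + 2 * dl' by ring.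
  by rewrite lerDl mulr_ge0// ltW.
Qed.

End smoothing.

(** * Volume of balls *)

(** The integral of a nonnegative function is the supremum of those of the simple
functions below it, and any simple function below [f] is below [g]: this holds
for arbitrary integrands, measurable or not. *)
Lemma le_integral_nonmeas d (T : measurableType d) (R : realType)
    (mu : {measure set T -> \bar R}) (D E : set T) (f g : T -> \bar R) :
  (forall x, D x -> 0 <= f x)%E -> (forall x, E x -> 0 <= g x)%E ->
  (forall x, D x -> E x -> f x <= g x)%E -> (forall x, D x -> ~ E x -> f x = 0%E) ->
  (\int[mu]_(x in D) f x <= \int[mu]_(x in E) g x)%E.
Proof.
move=> f0 g0 fg fE.
have F0 x : (0 <= (f \_ D) x)%E.
  by rewrite patchE; case: ifPn => [|_]; [rewrite inE => /f0|exact: lexx].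
have FG x : ((f \_ D) x <= (g \_ E) x)%E.
  rewrite !patchE; case: ifPn => [|_].
    rewrite inE => Dx; have [Ex|nE] := pselect (E x); first by rewrite mem_set//; exact: fg.
    by rewrite memNset// fE//; exact: lexx.
  by case: ifPn => [|_]; [rewrite inE => /g0|exact: lexx].
rewrite (integral_mkcond D) (integral_mkcond E).
rewrite ge0_integralTE// ge0_integralTE; last by move=> x; exact: le_trans (F0 x) (FG x).
apply: le_ereal_sup => _ [h /= hf <-]; exists h => //= x.
exact: le_trans (hf x) (FG x).
Qed.

Section lebesgue_balls.
Context {R : realType}.

Lemma measurable_ball_rV n (y : 'rV[R]_n) (e : R) : 0 < e ->
  measurable (ball y e : set (borel 'rV[R]_n)).
Proof. by move=> e0; apply: sub_sigma_algebra; exact: ball_open. Qed.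

(** A ball of the sup norm is a product of intervals. *)
Lemma lebesgue_rV_ball n (y : 'rV[R]_n) (e : R) : 0 < e ->
  lebesgue_rV n (ball y e : set (borel 'rV[R]_n)) = ((e *+ 2) ^+ n)%:E.
Proof.
elim: n y => [|n IH] y e0 /=.
  rewrite diracE mem_set ?expr0//.
  by split => // i [].
rewrite /lebesgue_rVS /pushforward.
rewrite (_ : _ @^-1` _ = ball (y 0 0 : R) e `*` ball (@rsubmx R 1 1 n y) e); last first.
  apply/seteqP; split=> -[a v] /=.
    move=> [_ H]; split.
      have := H 0 0; rewrite /cons_rV /= mxE.
      by case: fintype.splitP => // j _; rewrite mxE ord1.
    split=> // i j; have := H i (rshift 1 j); rewrite !mxE.
    case: fintype.splitP => // k /=; rewrite ?add1n.
      by move=> E; have := ltn_ord k; rewrite -E.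
    by move=> /eqP; rewrite eqSS => /eqP/val_inj ->; rewrite ord1.
  move=> [ya [_ yv]]; split=> // i j; rewrite ord1 /cons_rV /= mxE.
  case: fintype.splitP => k kE.
    rewrite mxE ord1 /= (_ : j = 0); last by apply: val_inj; rewrite /= kE (ord1 k).
    exact: ya.
  have := yv 0 k; rewrite mxE (_ : rshift 1 k = j)//.
  exact: val_inj.
rewrite product_measure1E//=.
- rewrite IH// exprS EFinM; congr (_ * _)%E.
  by rewrite lebesgue_measure_ball// ltW.
- exact: measurable_realfun.measurable_ball.
- exact: measurable_ball_rV.
Qed.

End lebesgue_balls.

Section volume.
Context {R : realType} {n : nat} (M : riemannian_manifold R n).
Variable dv : {measure set (borel M) -> \bar R}.

Lemma measurable_gball (x : M) (r : R) : measurable (gball x r : set (borel M)).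
Proof. by apply: sub_sigma_algebra; exact: gball_open. Qed.

Lemma det_continuous (T : topologicalType) (G : T -> 'M[R]_n) t :
  (forall i j, {for t, continuous (fun s => G s i j)}) ->
  {for t, continuous (fun s => \det (G s))}.
Proof.
move=> cG.
have cprod (s : seq 'I_n) (sg : 'S_n) :
    {for t, continuous (fun u => \prod_(i <- s) G u i (sg i))}.
  elim: s => [|i s IH].
    rewrite (_ : (fun u => _) = cst 1); first exact: cst_continuous.
    by apply/funext => u; rewrite big_nil.
  rewrite (_ : (fun u => _) = (fun u => G u i (sg i)) * (fun u => \prod_(j <- s) G u j (sg j))).
    exact: continuousM (cG _ _) IH.
  by apply/funext => u; rewrite big_cons.
have csum (s : seq 'S_n) : {for t, continuous (fun u =>
    \sum_(sg <- s) (-1) ^+ sg * \prod_i G u i (sg i))}.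
  elim: s => [|sg s IH].
    rewrite (_ : (fun u => _) = cst 0); first exact: cst_continuous.
    by apply/funext => u; rewrite big_nil.
  rewrite (_ : (fun u => _) = (fun u => (-1) ^+ sg * \prod_i G u i (sg i)) +
      (fun u => \sum_(sg <- s) (-1) ^+ sg * \prod_i G u i (sg i))).
    apply: continuousD IH; apply: continuousM; [exact: cst_continuous|exact: cprod].
  by apply/funext => u; rewrite big_cons.
exact: csum.
Qed.

(** A small ball lies in a coordinate cube on which [sqrt (det g)] is between two
positive constants, and its image contains another cube. *)
Lemma small_gball_volume (x : M) : riemannian_volume dv ->
  exists2 r : R, 0 < r & (0 < dv (gball x r) < +oo)%E.
Proof.
move=> vol; have [ac cx] := chart_atP x; set c := chart_at x in ac cx.
pose y0 := cfun c x; have cy0 : cimg c y0 by exact: cfun_img.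
pose g y := Num.sqrt (\det (rmetric c y)).
have [P Pu GP] := cholesky (rmetric_sym ac cy0) (rmetric_pos ac cy0).
have g0 : 0 < g y0.
  rewrite sqrtr_gt0 GP det_mulmx det_tr -expr2 exprn_even_gt0//=.
  by rewrite -unitfE -unitmxE.
have cg : {for y0, continuous g}.
  apply: continuous_comp; last exact: sqrt_continuous.
  by apply: det_continuous => i j; exact: rmetric_continuous.
have ng : \forall y \near y0, g y0 / 2 <= g y <= 2 * g y0.
  have e0 : 0 < g y0 / 2 by rewrite divr_gt0.
  have /cvgrPdist_le/(_ _ e0) := cg; apply: filterS => y.
  by rewrite ler_norml => /andP[? ?]; apply/andP; split; lra.
have : \forall y \near y0, cimg c y /\ g y0 / 2 <= g y <= 2 * g y0.
  by apply: filterS2 (near_img cy0) ng.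
move=> /nbhs_ballP[e /= e0 He].
pose O : set M := [set z | cdom c z /\ ball y0 e (cfun c z)].
have oO : open O.
  rewrite openE => z [cz zb]; apply: filterS2 (near_dom cz) (_ : \forall w \near z, ball y0 e (cfun c w)) => //.
  apply: (cfun_continuous cz); apply: open_nbhs_nbhs; split => //.
  exact: ball_open.
have Ox : O x by split => //; exact: ballxx.
have [r r0 rO] := rho_basis oO Ox.
exists r => //; set A := gball x r.
have mA : measurable (A : set (borel M)) by exact: measurable_gball.
have AO : A `<=` O by move=> z /gballE/rO.
rewrite (vol c ac A mA); last by move=> z /AO[].
have imA y : (cfun c @` A) y -> ball y0 e y by move=> [z /AO[_ ?] <-].
have ge0 y : (0 <= (g y)%:E)%E by rewrite lee_fin sqrtr_ge0.
apply/andP; split.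
  have oA : open (cfun c @` (cdom c `&` A)) by apply: cfun_image_open; exact: gball_open.
  have Ay0 : (cfun c @` (cdom c `&` A)) y0.
    by exists x => //; split => //; apply/gballE; rewrite rho_self.
  have /nbhs_ballP[e1 /= e10 He1] := open_nbhs_nbhs (conj oA Ay0).
  apply: (@lt_le_trans _ _ (\int[lebesgue_rV n]_(y in (ball y0 e1 : set (borel 'rV[R]_n))) (g y0 / 2)%:E)%E).
    rewrite (@integral_cst _ _ _ (lebesgue_rV n))/=; last exact: measurable_ball_rV.
    by rewrite lebesgue_rV_ball// -EFinM lte_fin mulr_gt0 ?divr_gt0// exprn_gt0// mulrn_wgt0.
  have im1 y : ball y0 e1 y -> (cfun c @` A) y.
    by move=> /He1[z [_ Az] <-]; exists z.
  apply: le_integral_nonmeas => y.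
  - by move=> _; rewrite lee_fin divr_ge0// ltW.
  - by move=> _; exact: ge0.
  - by move=> _ /imA yb; rewrite lee_fin; have [_ /andP[+ _]] := He y yb.
  - by move=> /im1.
apply: (@le_lt_trans _ _ (\int[lebesgue_rV n]_(y in (ball y0 e : set (borel 'rV[R]_n))) (2 * g y0)%:E)%E).
  apply: le_integral_nonmeas => y.
  - by move=> _; exact: ge0.
  - by move=> _; rewrite lee_fin mulr_ge0// ltW.
  - by move=> /imA yb _; rewrite lee_fin; have [_ /andP[_ +]] := He y yb.
  - by move=> /imA.
rewrite (@integral_cst _ _ _ (lebesgue_rV n))/=; last exact: measurable_ball_rV.
by rewrite lebesgue_rV_ball// -EFinM ltry.
Qed.

Lemma gball_sub (x : M) (r s : R) : r <= s -> gball x r `<=` gball x s.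
Proof. by move=> rs y /gballE yr; apply/gballE; exact: lt_le_trans rs. Qed.

Lemma gball_volume_le (x : M) (r s : R) : r <= s -> (dv (gball x r) <= dv (gball x s))%E.
Proof.
move=> rs; apply: le_measure; rewrite ?inE; try exact: measurable_gball.
exact: gball_sub.
Qed.

(** Doubling propagates finiteness from one small ball to all balls with the same
centre. *)
Lemma gball_volume_finite (x : M) : riemannian_volume dv -> doubling dv ->
  forall r, (dv (gball x r) < +oo)%E.
Proof.
move=> vol [D D0 dbl] r; have [r0 r00 /andP[_ Vr0]] := small_gball_volume x vol.
have H k : (dv (gball x (2 ^+ k * r0)) < +oo)%E.
  elim: k => [|k IH]; first by rewrite expr0 mul1r.
  rewrite exprS -mulrA; apply: (le_lt_trans (dbl _ _ _)); first by rewrite mulr_gt0// exprn_gt0.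
  by rewrite lte_mul_pinfty// ?lee_fin ?ltW.
pose k := (Num.truncn (r / r0)).+1.
apply: le_lt_trans (H k); apply: gball_volume_le.
rewrite -ler_pdivrMr//; have [rr|rr] := leP 0 (r / r0); last first.
  by apply: (le_trans (ltW rr)); exact: exprn_ge0.
have /andP[_ H1] := truncn_itv rr; apply: (le_trans (ltW H1)).
by rewrite -natrX ler_nat -/k ltnW// ltn_expl.
Qed.

End volume.

(** * Gradients of locally Lipschitz functions *)

Section gradient.
Context {R : realType} {n : nat} (M : riemannian_manifold R n).

Lemma derive_norm_le (f : 'rV[R]_n -> R) (y v : 'rV[R]_n) (B : R) : derivable f y v ->
  (\forall h \near (0 : R), `|f (y + h *: v) - f y| <= B * `|h|) -> `|'D_v f y| <= B.
Proof.
move=> df HB; apply/ler_addgt0Pr => e e0.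
have /cvgrPdist_le/(_ e e0) H1 := df.
have H2 : \forall h \near (0 : R)^', h != 0 by exact: nbhs_dnbhs_neq.
have H3 : \forall h \near (0 : R)^', `|f (y + h *: v) - f y| <= B * `|h|.
  by apply: cvg_within; exact: HB.
have : \forall h \near (0 : R)^', [/\ h != 0, `|f (y + h *: v) - f y| <= B * `|h| &
    `|'D_v f y - h^-1 *: ((f \o shift y) (h *: v) - f y)| <= e].
  by apply: filterS3 H1 H2 H3 => h ? ? ?; split.
move=> /filter_ex[h [h2 h3 h1]].
rewrite -[X in `|X|](subrK (h^-1 *: ((f \o shift y) (h *: v) - f y))).
rewrite (le_trans (ler_normD _ _))// addrC lerD//.
rewrite normrZ normfV mulrC ler_pdivrMr ?normr_gt0//= (addrC (h *: v)).
exact: h3.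
Qed.

(** Positivity of the form at [u + w / S] and at [u - w / S]; the bound [S] is
first enlarged to be positive. *)
Lemma cauchy_schwarz_qform (G : 'M[R]_n) (u w : 'rV[R]_n) (S : R) : G^T = G ->
  (forall v, 0 <= qform G v) -> 0 <= S -> qform G u <= 1 -> qform G w <= S ^+ 2 ->
  `|(u *m G *m w^T) 0 0| <= S.
Proof.
move=> Gs Gp S0 u1 wS; set B := (u *m G *m w^T) 0 0.
have BT : (w *m G *m u^T) 0 0 = B.
  have -> : w *m G *m u^T = (u *m G *m w^T)^T by rewrite !trmx_mul trmxK Gs mulmxA.
  by rewrite mxE.
have qE t : qform G (u + t *: w) = qform G u + 2 * t * B + t ^+ 2 * qform G w.
  have mD (X Y : 'M[R]_1) : (X + Y) 0 0 = X 0 0 + Y 0 0 by rewrite mxE.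
  have mZ a (X : 'M[R]_1) : (a *: X) 0 0 = a * X 0 0 by rewrite mxE.
  rewrite /qform linearD linearZ /= !mulmxDl !mulmxDr -!scalemxAl -!scalemxAr.
  by rewrite !(mD, mZ) BT -/B; ring.
have key S' : 0 < S' -> S <= S' -> `|B| <= S'.
  move=> S'0 SS.
  have w1 : (S'^-1) ^+ 2 * qform G w <= 1.
    rewrite exprVn mulrC ler_pdivrMr ?exprn_gt0// mul1r (le_trans wS)//.
    by rewrite lerXn2r ?nnegrE// ltW.
  have H1 := Gp (u + S'^-1 *: w); have H2 := Gp (u + (- S'^-1) *: w).
  rewrite qE in H1; rewrite qE sqrrN in H2.
  have B1 : `|S'^-1 * B| <= 1.
    by rewrite ler_norml; apply/andP; split; lra.
  by move: B1; rewrite normrM gtr0_norm ?invr_gt0// mulrC ler_pdivrMr// mul1r.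
by apply/ler_addgt0Pr => e e0; apply: key; [rewrite ltr_wpDl|rewrite lerDl ltW].
Qed.

(** The derivative of [phi] in the direction [v] of its own gradient is [|v| ^ 2].
It is at most [L] times the rate at which the straight segment of direction [v]
moves away from [x], which is at most [2 (n + 1) |v|] by [dist_upper] and the
comparison of the metric with the flat one. *)
Lemma grad_norm_le (phi : M -> R) (x : M) (L : R) : 0 <= L -> smooth_fun phi ->
  local_slope L phi x -> tnorm x (grad phi x) <= 2 * n.+1%:R * L.
Proof.
move=> L0 sphi slope; have [ac cx] := chart_atP x.
have [P [s [nc _]]] := normal_chart_exists openT (I : [set: M] x).
rewrite /tnorm /inner; set c := chart_at x in ac cx nc *.
set y := cfun c x in nc *.
have cy : cimg c y by exact: cfun_img.
set G := rmetric c y; set v := grad phi x c; set q := (_ *m _ *m _) 0 0.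
have qG : q = qform G v by [].
have [df dfE] := smooth_diff (@cimg_open _ _ _ c) (sphi c ac) cy.
have Gs : G^T = G by exact: rmetric_sym.
have Gp := rmetric_pos ac cy.
have Gu : G \in unitmx.
  by have [Q Qu ->] := cholesky Gs Gp; rewrite unitmx_mul unitmx_tr Qu.
have q0 : 0 <= q by exact: (qform_ge0 _ ac cx).
have dq : 'D_v (phi \o cinv c) y = q.
  rewrite deriveE// dfE /q -/G.
  have -> : v *m G = differential phi x c by rewrite /v /grad mulmxKV.
  rewrite mxE; apply: eq_bigr => i _; rewrite !mxE mulrC; congr (_ * _).
have [_ Pu s0 Hc] := nc.
have z4 : `|(0 : 'rV[R]_n)| <= 4 * s by rewrite normr0 mulr_ge0// ltW.
have [_ /(_ v)[vP _]] := Hc 0 z4.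
rewrite mul0mx addr0 -/G -qG in vP.
have D : `|'D_v (phi \o cinv c) y| <= L * (n.+1%:R * `|v *m P|).
  apply: derive_norm_le; first exact: diff_derivable.
  have yv (h : R) : cinv c (y + h *: v) = ninv c y P (h *: (v *m P)).
    by rewrite /ninv -scalemxAl mulmxK.
  have cl : {for (0 : R), continuous (fun h : R => h *: (v *m P))}.
    by apply: cvgZr_tmp; exact: cvg_id.
  have l0 : (0 : R) *: (v *m P) = 0 by rewrite scale0r.
  have cn : {for (0 : R), continuous (fun h : R => ninv c y P (h *: (v *m P)))}.
    apply: (@continuous_comp _ _ _ (fun h : R => h *: (v *m P)) (ninv c y P)) => //.
    by rewrite l0; exact: (ninv_continuous nc).
  have n0 : ninv c y P (0 *: (v *m P)) = x by rewrite l0 (ninv_center nc).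
  have H1 : \forall h \near (0 : R), `|phi (ninv c y P (h *: (v *m P))) - phi x| <=
      L * rho x (ninv c y P (h *: (v *m P))).
    have H : nbhs (ninv c y P ((0 : R) *: (v *m P)))
        [set z | `|phi z - phi x| <= L * rho x z] by rewrite n0; exact: slope.
    exact: cn _ H.
  have H2 : \forall h \near (0 : R), `|h *: (v *m P)| < 3 * s.
    have H : nbhs ((0 : R) *: (v *m P)) [set z : 'rV[R]_n | `|z| < 3 * s].
      by rewrite l0; apply: near0_norm_lt; rewrite mulr_gt0.
    exact: cl _ H.
  apply: filterS2 H1 H2 => h h1 h2.
  rewrite /= yv -/y (cfunK cx) (le_trans h1)// -mulrA ler_wpM2l//.
  rewrite -lee_fin -rhoE -{1}(ninv_center nc).
  have z3 : `|(0 : 'rV[R]_n)| <= 3 * s by rewrite normr0 mulr_ge0// ltW.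
  apply: (le_trans (dist_upper nc z3 (ltW h2))).
  by rewrite lee_fin subr0 normrZ -mulrA ler_wpM2l// mulrC.
rewrite dq ger0_norm// in D.
set t := Num.sqrt q in vP *.
have tq : q = t * t by rewrite -expr2 sqr_sqrtr.
have t0 : 0 <= t := sqrtr_ge0 _.
have D2 : t * t <= 2 * n.+1%:R * L * t.
  rewrite -tq (le_trans D)//.
  have -> : 2 * n.+1%:R * L * t = L * (n.+1%:R * (2 * t)) by ring.
  by rewrite ler_wpM2l// ler_wpM2l.
have [t00|tn0] := eqVneq t 0; first by rewrite t00 !mulr_ge0.
by rewrite -(ler_pM2r (_ : 0 < t)) // lt_neqAle eq_sym tn0.
Qed.

End gradient.

(** * The energy estimate *)

Section energy_estimate.
Context {R : realType} {n : nat} (M : riemannian_manifold R n).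
Variable dv : {measure set (borel M) -> \bar R}.

(** The exceptional null set [N] is removed from [A], so that the pointwise bound
holds on all of the remaining domain. *)
Lemma integral_lower_bound (A N : set M) (a : R) (g : M -> R) :
  measurable (A : set (borel M)) -> measurable (N : set (borel M)) -> dv N = 0%E ->
  0 <= a -> (forall x, 0 <= g x) -> (forall x, A x -> ~ N x -> a <= g x) ->
  (a%:E * dv A <= \int[dv]_x (g x)%:E)%E.
Proof.
move=> mA mN N0 a0 g0 ag.
have mAN : measurable (A `\` N : set (borel M)) by exact: measurableD.
have AN : (dv A <= dv (A `\` N))%E.
  have -> : dv (A `\` N) = dv (A `\` N) + dv N by rewrite N0 adde0.
  apply: (@le_trans _ _ (dv ((A `\` N) `|` N))).
    apply: le_measure; rewrite ?inE//; first exact: measurableU.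
    by move=> x Ax; have [Nx|nN] := pselect (N x); [right|left].
  exact: measureU2.
apply: (@le_trans _ _ (\int[dv]_(x in (A `\` N : set (borel M))) a%:E)%E).
  by rewrite (@integral_cst _ _ _ dv)//; apply: lee_wpmul2l => //; rewrite lee_fin.
apply: le_integral_nonmeas => x.
- by rewrite lee_fin.
- by move=> _; rewrite lee_fin.
- by move=> [Ax nN] _; rewrite lee_fin ag.
- by move=> _ [].
Qed.

(** The function [w] need not be integrable.  Its integral is a difference of two
integrals of nonnegative functions, and only the one of the negative part, which
is bounded by a constant, matters for this inequality. *)
Lemma integral_upper_bound (A : set M) (a : R) (w : M -> R) :
  measurable (A : set (borel M)) -> 0 <= a -> (forall x, `|w x| <= a) ->
  (forall x, ~ A x -> w x = 0) ->
  (- (\int[dv]_x (w x)%:E) <= a%:E * dv A)%E.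
Proof.
move=> mA a0 wa wA; rewrite integralE.
set p := (\int[dv]_(x in _) _)%E; set m := (\int[dv]_(x in _) _)%E.
have p0 : (0 <= p)%E by apply: integral_ge0.
have mle : (m <= a%:E * dv A)%E.
  rewrite -(@integral_cst _ _ _ dv)//.
  apply: le_integral_nonmeas => x.
  - by move=> _; exact: funeneg_ge0.
  - by move=> _ /=; rewrite lee_fin.
  - move=> _ Ax; rewrite funenegE /= -EFin_max lee_fin ge_max a0 andbT.
    by rewrite (le_trans _ (wa x))// -normrN ler_norm.
  - by move=> _ nA; rewrite funenegE /= wA// oppr0 -EFin_max maxxx.
apply: le_trans mle; have m0 : (0 <= m)%E by apply: integral_ge0 => x _; exact: funeneg_ge0.
case: p p0 => [p| |] //; case: m m0 => [m| |] // m0 p0;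
  rewrite ?leey ?leNye//.
by move: m0 p0; rewrite -EFinB -EFinN !lee_fin; lra.
Qed.

(** Cauchy-Schwarz.  Where the norm of [X] is zero its inverse is zero as well, so
the normalised vector is zero and the bound persists. *)
Lemma inner_unit_le (x : M) (X : tcoords M) (phi : M -> R) (L : R) : 0 <= L ->
  smooth_fun phi -> local_slope L phi x ->
  `|inner x (fun c => (tnorm x X)^-1 *: X c) (grad phi x)| <= 2 * n.+1%:R * L.
Proof.
move=> L0 sphi slope; have [ac cx] := chart_atP x.
have Gn := grad_norm_le L0 sphi slope.
have cy := cfun_img cx.
have q0 v := qform_ge0 v ac cx.
have B0 : 0 <= 2 * n.+1%:R * L by rewrite !mulr_ge0.
apply: cauchy_schwarz_qform => //.
- exact: rmetric_sym.
- set t := tnorm x X.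
  have -> : qform (rmetric (chart_at x) (cfun (chart_at x) x)) (t^-1 *: X (chart_at x)) =
      t^-1 ^+ 2 * t ^+ 2.
    rewrite {3}/t /tnorm sqr_sqrtr ?q0//.
    by rewrite /qform linearZ/= -!scalemxAl -scalemxAr scalerA [LHS]mxE expr2.
  have [->|t0] := eqVneq t 0; first by rewrite invr0 expr0n mul0r ler01.
  by rewrite -exprMn mulVf// expr1n.
- rewrite -[X in X <= _]sqr_sqrtr ?q0// lerXn2r ?nnegrE ?sqrtr_ge0//.
Qed.

Lemma max0_lip (a b : R) : `|Num.max 0 a - Num.max 0 b| <= `|a - b|.
Proof.
wlog ab : a b / a <= b => [H|].
  by have [/H//|/ltW/H] := leP a b; rewrite distrC (distrC a).
rewrite distrC (distrC a) !ger0_norm ?subr_ge0//; last by rewrite ge_max !le_max lexx ab orbT.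
by rewrite /Num.max; case: ltP => a0; case: ltP => b0; lra.
Qed.

End energy_estimate.

Theorem proposition3p2 (R : realType) (n : nat) (M : riemannian_manifold R n)
    (dv : {measure set (borel M) -> \bar R}) :
  riemannian_volume dv -> complete_manifold M -> ~ compact [set: M] ->
  doubling dv ->
  ~ exists (f : M -> R) (X : M -> tcoords M),
      weak_IMCF dv f X /\
      exists (x0 : M) (l : \bar R), (0 < l)%E /\
        ess_inf_on dv (gball x0 r) (fun x => tnorm x (X x)) @[r --> +oo] --> l.
Proof.
move=> vol cM _ dbl [f [X [[_ _ weak] [x0 [l [l0 Hl]]]]]].
have [c c0 cl] : exists2 c : R, 0 < c & (c%:E < l)%E.
  case: l l0 {Hl} => [l| |]// l0; last by exists 1 => //; exact: ltry.
  rewrite lte_fin in l0; exists (l / 2); first by rewrite divr_gt0.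
  by rewrite lte_fin gtr_pMr// invf_lt1// ltr1n.
have [r0 r00 /andP[V0 _]] := small_gball_volume x0 vol.
have Vfin := gball_volume_finite x0 vol dbl.
have [D D0 HD] := dbl.
have [C C0 HC] := @lipschitz_smoothing R n M.
pose K := 2 * n.+1%:R * C.
have K0 : 0 <= K by rewrite !mulr_ge0// ltW.
have near_ess : \forall r \near +oo, (c%:E < ess_inf_on dv (gball x0 r) (fun x => tnorm x (X x)))%E.
  exact: (Hl [set u | (c%:E < u)%E] (open_ereal_gt' cl)).
have near_r0 : \forall r \near +oo, r0 < r by apply: nbhs_pinfty_gt; exact: num_real.
have near_big : \forall r \near +oo, 2 * K * (D * D * D) / c < r by apply: nbhs_pinfty_gt; exact: num_real.
have : \forall r \near +oo, [/\ (c%:E < ess_inf_on dv (gball x0 r) (fun x => tnorm x (X x)))%E,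
    r0 < r & 2 * K * (D * D * D) / c < r].
  by apply: filterS3 near_ess near_r0 near_big => r ? ? ?; split.
move=> /filter_ex[r [Hr rr0 rbig]].
have r_gt0 : 0 < r := lt_trans r00 rr0.
(* At least 1 on the ball of radius r, zero off the ball of radius 2 r, and
   1/r-Lipschitz; smoothing within 1/2 keeps it at least 1/2 on the ball of
   radius r. *)
pose psi x : R := Num.max 0 (2 - rho x0 x / r).
have psi0 x : 0 <= psi x by rewrite le_max lexx.
have psiL : rho_lipschitz r^-1 psi.
  move=> x y; have A : `|(2 - rho x0 x / r) - (2 - rho x0 y / r)| <= r^-1 * rho x y.
    rewrite opprB addrC addrA subrK -mulrBl normrM normfV (gtr0_norm r_gt0) mulrC.
    by rewrite ler_pM2l ?invr_gt0// distrC rho_lip.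
  by apply: le_trans A; exact: max0_lip.
have rI0 : 0 < r^-1 by rewrite invr_gt0.
have half0 : 0 < 2^-1 :> R by rewrite invr_gt0.
have KO : cball x0 (2 * r) `<=` gball x0 (4 * r).
  by move=> x /= H; apply/gballE; apply: (le_lt_trans H); rewrite ltr_pM2r// ltr_nat.
have psiK x : ~ cball x0 (2 * r) x -> psi x = 0.
  move=> /negP; rewrite -ltNge => H; rewrite /psi max_l// subr_le0 ler_pdivlMr//.
  exact: ltW.
have [phi [sphi phi0 phid phiO phisl]] := HC _ _ psi r^-1 2^-1
  (@hopf_rinow _ _ M x0 (2 * r) cM) (@gball_open _ _ M x0 (4 * r)) KO psi0 psiL rI0 half0 psiK.
have cphi : supp_compact phi setT.
  have c4 := @hopf_rinow _ _ M x0 (4 * r) cM.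
  split => //; apply: (subclosed_compact _ c4); first exact: closed_closure.
  have -> : cball x0 (4 * r) = closure (cball x0 (4 * r)).
    by apply/closure_id; exact: cball_closed.
  apply: closureS => x /= /eqP nx; apply: contrapT => nc; apply: nx; apply: phiO => /gballE H.
  by apply: nc; exact: ltW.
have E := weak phi sphi cphi.
pose A := gball x0 r.
have mA s : measurable (gball x0 s : set (borel M)) by exact: measurable_gball.
have [z /= [N [mN N0 HN]] cz] := ereal_sup_gt Hr.
have low : ((c / 2)%:E * dv A <= \int[dv]_x (tnorm x (X x) * phi x)%:E)%E.
  apply: (integral_lower_bound (mA r) mN N0).
  - by rewrite divr_ge0// ltW.
  - by move=> x; rewrite mulr_ge0// sqrtr_ge0.
  - move=> x Ax nN.
    have tx : c <= tnorm x (X x).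
      have : (z <= (tnorm x (X x))%:E)%E.
        by apply: contrapT => H; apply: nN; apply: HN => /= /(_ Ax).
      by move=> /(lt_le_trans cz); rewrite lte_fin => /ltW.
    have px : 2^-1 <= phi x.
      have p1 : 1 <= psi x.
        rewrite /psi le_max; apply/orP; right; rewrite lerBrDr -lerBrDl.
        have -> : 2 - 1 = 1 :> R by ring.
        by rewrite ler_pdivrMr// mul1r ltW//; exact/gballE.
      by have := phid x; rewrite ler_norml => /andP[]; lra.
    by rewrite ler_pM// ?ltW// invr_ge0.
set w := fun x => inner x (fun c => (tnorm x (X x))^-1 *: X x c) (grad phi x).
have up : (- (\int[dv]_x (w x)%:E) <= (K / r)%:E * dv (gball x0 (8 * r)))%E.
  apply: integral_upper_bound.
  - exact: mA.
  - by rewrite divr_ge0// ltW.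
  - move=> x; rewrite /K -mulrA; apply: inner_unit_le => //.
    by rewrite divr_ge0// ltW.
  (* Off the ball of radius 4 r the function phi is locally zero, so that its
     gradient vanishes; the radius 8 r makes the distance to x0 exceed 4 r
     strictly. *)
  - move=> x /gballE nx.
    have rx : 4 * r < rho x0 x.
      by rewrite ltNge; apply/negP => H; apply: nx; apply: (le_lt_trans H); rewrite ltr_pM2r// ltr_nat.
    have sl : local_slope 0 phi x.
      have nr : \forall y \near x, 4 * r < rho x0 y.
        exact: (rho_continuous (x := x0) (lt_nbhsr rx)).
      apply: filterS nr => y ry.
      have off u : 4 * r < rho x0 u -> phi u = 0.
        by move=> ru; apply: phiO => /gballE; rewrite ltNge (ltW ru).
      by rewrite !off// subrr normr0 mul0r.
    have := inner_unit_le (X x) (lexx 0) sphi sl.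
    by rewrite mulr0 normr_le0 => /eqP.
have V8 : (dv (gball x0 (8 * r)) <= (D * D * D)%:E * dv A)%E.
  have -> : 8 * r = 2 * (2 * (2 * r)) by ring.
  apply: (le_trans (HD _ _ _)); first by rewrite !mulr_gt0.
  rewrite -mulrA EFinM -muleA; apply: lee_wpmul2l; first by rewrite lee_fin ltW.
  apply: (le_trans (HD _ _ _)); first by rewrite !mulr_gt0.
  rewrite EFinM -muleA; apply: lee_wpmul2l; first by rewrite lee_fin ltW.
  exact: HD.
have VA0 : (0 < dv A)%E by apply: (lt_le_trans V0); apply: gball_volume_le; exact: ltW.
have [V VE] : exists V : R, dv A = V%:E.
  by exists (fine (dv A)); rewrite fineK// ge0_fin_numE ?Vfin// ltW.
have Kr : (0 <= (K / r)%:E)%E by rewrite lee_fin divr_ge0// ltW.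
have E' : (\int[dv]_x (tnorm x (X x) * phi x)%:E = - (\int[dv]_x (w x)%:E))%E.
  by rewrite E oppeK.
have := le_trans low (_ : _ <= (K / r)%:E * ((D * D * D)%:E * dv A))%E.
rewrite E' => /(_ (le_trans up (lee_wpmul2l Kr V8))).
rewrite VE lte_fin in VA0.
rewrite VE -!EFinM lee_fin mulrA ler_pM2r//.
apply/negP; rewrite -ltNge.
rewrite ltr_pdivrMr// in rbig.
by rewrite mulrAC ltr_pdivrMr//; lra.
Qed.
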